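(* For every undirected graph $G$ and set of terminals $K$, and every constant $\epsilon>0$, \[R_{\epsilon}(\mathrm{ED}_{K, n},G,K) =\tilde{\Theta}\left(\tau_{\mathrm{MCF}}(G,K,1)\right)\quad\text{and}\quad R_0(\mathrm{ED}_{K, n},G,K) =\tilde{\Theta}\left(\tau_{\mathrm{MCF}}(G,K,n)\right).\]
   Context: Communication model: $G=(V,E)$ is an undirected simple graph, $K\subseteq V$ a set of $k=|K|$ terminals. For $f:(\{0,1\}^n)^K\to\{0,1\}$, each terminal $u\in K$ receives an input $\mathbf{x}_u\in\{0,1\}^n$ (worst case), and at the end all terminals must know the value of $f$. Communication is synchronous: in each round every node sends a (possibly different) bit to each neighbour, both directions of an edge being usable simultaneously. Protocols know $G$ and may use public randomness. $R_\epsilon(f,G,K)$ is the minimum worst-case number of rounds of a randomized protocol erring with probability at most $\epsilon$ on every input; $R_0$ is the deterministic round complexity. $\tilde O,\tilde\Omega,\tilde\Theta$ ignore poly-logarithmic factors in the size of $G$ and in $n$. $\mathrm{ED}_{K,n}(\{\mathbf{x}_u\}_{u\in K})=\bigwedge_{u\neq v\in K}[\mathbf{x}_u\ne\mathbf{x}_v]$. Timed graph: for an integer $\tau\ge1$, $G^{(\tau)}$ is the directed graph on $V\times[0,\tau]$ with, for each $(u,v)\in E$ and $0\le i<\tau$, unit-capacity edges $((u,i),(v,i+1))$ and $((v,i),(u,i+1))$, plus infinite-capacity ''memory'' edges $((u,i),(u,i+1))$ for all $u\in V$. $\tau_{\mathrm{MCF}}(G,K,n')$ is the minimum $\tau$ such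 that there is a multicommodity flow in $G^{(\tau)}$ respecting capacities that simultaneously sends $n'/k$ units from $(u,0)$ to $(v,\tau)$ for every ordered pair $u,v\in K$ (i.e. the minimum number of rounds to simultaneously route $n'/k$ units of flow from every $u$ to every $v$ in $K$, when each edge carries at most one unit per direction per round).
   Formalization: The claim fails for ε ≥ 1/2, for |K| ≤ 1, and for |K| too close to or above 2^n; so ε < 1/2 is assumed, and the lower bounds are stated for 2 ≤ |K| ≤ 2^n (deterministic) and for |K| ≥ 2 with (1+δ)|K| ≤ 2^n, δ > 0 any fixed constant (randomized). *)

(* Defs.v *)
(* MathComp, with the real numbers of MathComp-Analysis. *)
From HB Require Import structures.
From mathcomp Require Import all_boot all_order all_algebra.
From mathcomp Require Import classical_sets reals ereal exp.

Set Implicit Arguments.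
Unset Strict Implicit.
Unset Printing Implicit Defensive.

Import Order.TTheory GRing.Theory Num.Theory.
Local Open Scope ring_scope.

Record sgraph := SGraph {
  vert :> finType;
  edge : rel vert;
  edge_sym : symmetric edge;
  edge_irr : irreflexive edge }.

(* The minimum of a set of natural numbers, equal to +oo if the set is empty. *)
Definition minE (R : realType) (A : nat -> Prop) : \bar R :=
  ereal_inf [set (t%:R : R)%:E | t in [set t | A t]]%classic.

Definition input (G : sgraph) (K : {set G}) (n : nat) : Type :=
  {ffun {u : G | u \in K} -> n.-tuple bool}.

Definition ED (G : sgraph) (K : {set G}) (n : nat) (x : input K n) : bool :=
  [forall u, forall v, (u != v) ==> (x u != x v)].

(* What a node sees: its own input (None for a non-terminal) and, for each past
   round, the bits received in that round, indexed by their sender. *)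
Definition local_input (G : sgraph) (K : {set G}) (n : nat) (x : input K n)
    (u : G) : option (n.-tuple bool) :=
  omap x (insub u).

(* [msg P u v a h] is the bit that u, with input a and received history h,
   sends to v in the next round; the round number is [size h]. *)
Record protocol (G : sgraph) (n : nat) := Protocol {
  msg : G -> G -> option (n.-tuple bool) -> seq {ffun G -> bool} -> bool;
  out : G -> option (n.-tuple bool) -> seq {ffun G -> bool} -> bool }.

(* Bits addressed to a non-neighbour are lost: they are read as false. *)
Fixpoint history (G : sgraph) (K : {set G}) (n : nat) (P : protocol G n)
    (x : input K n) (t : nat) (u : G) : seq {ffun G -> bool} :=
  if t is t'.+1 then
    rcons (history P x t' u)
      [ffun w => edge w u && msg P w u (local_input x w) (history P x t' w)]
  else [::].

Definition correct (G : sgraph) (K : {set G}) (n : nat) (f : input K n -> bool)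
    (T : nat) (P : protocol G n) (x : input K n) : bool :=
  [forall u in K, out P u (local_input x u) (history P x T u) == f x].

Definition det_rounds (G : sgraph) (K : {set G}) (n : nat)
    (f : input K n -> bool) (T : nat) : Prop :=
  exists P : protocol G n, forall x, correct f T P x.

(* The public random string has an arbitrary finite distribution mu.  As there
   are finitely many T-round protocols up to extensional equality, a more
   general probability space would not allow more. *)
Definition rand_rounds (R : realType) (eps : R) (G : sgraph) (K : {set G})
    (n : nat) (f : input K n -> bool) (T : nat) : Prop :=
  exists (Omega : finType) (mu : Omega -> R) (P : Omega -> protocol G n),
    [/\ forall w, 0 <= mu w,
        \sum_w mu w = 1 &
        forall x, \sum_(w | ~~ correct f T (P w) x) mu w <= eps].

Definition R0 (R : realType) (G : sgraph) (K : {set G}) (n : nat)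
    (f : input K n -> bool) : \bar R :=
  minE R (det_rounds f).

Definition Reps (R : realType) (eps : R) (G : sgraph) (K : {set G}) (n : nat)
    (f : input K n -> bool) : \bar R :=
  minE R (rand_rounds eps f).

(* Capacities in the timed graph; capacity 0 means that there is no edge. *)
Definition timed_cap (R : realType) (G : sgraph) (tau : nat)
    (a b : G * 'I_tau.+1) : \bar R :=
  if b.2 == a.2.+1 :> nat then
    if a.1 == b.1 then +oo%E else if edge a.1 b.1 then 1%:E else 0%:E
  else 0%:E.

(* phi is a flow of value d from s to t (not yet subject to capacities). *)
Definition is_flow (R : realType) (N : finType) (s t : N) (d : R)
    (phi : N -> N -> R) : Prop :=
  (forall a b, 0 <= phi a b) /\
  (forall a, \sum_b phi a b - \sum_b phi b a
             = (a == s)%:R * d - (a == t)%:R * d).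

Definition mcf_feasible (R : realType) (G : sgraph) (K : {set G}) (n' : R)
    (tau : nat) : Prop :=
  exists phi : G -> G -> G * 'I_tau.+1 -> G * 'I_tau.+1 -> R,
    (forall u v, u \in K -> v \in K ->
       is_flow (u, ord0) (v, ord_max) (n' / #|K|%:R) (phi u v)) /\
    (forall a b, ((\sum_(u in K) \sum_(v in K) phi u v a b)%:E
                  <= timed_cap R a b)%E).

Definition tau_MCF (R : realType) (G : sgraph) (K : {set G}) (n' : R) : \bar R :=
  minE R (fun tau => (1 <= tau)%N /\ mcf_feasible K n' tau).

Definition quantity (R : realType) := forall G : sgraph, {set G} -> nat -> \bar R.

(* f = O~(g) uniformly over the instances (G, K, n) in D; the shift by 2 only
   keeps the logarithm positive. *)
Definition soft_O (R : realType) (D : forall G : sgraph, {set G} -> nat -> Prop)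
    (f g : quantity R) : Prop :=
  exists (C : R) (c : nat), 0 < C /\
    forall (G : sgraph) (K : {set G}) (n : nat), D G K n ->
      (f G K n <= (C * ln (#|G| + n + 2)%:R ^+ c)%:E * g G K n)%E.

(* f = Theta~(g), where the bound f = O~(g) is for all instances and the bound
   f = Omega~(g) is for the instances in D. *)
Definition soft_Theta (R : realType)
    (D : forall G : sgraph, {set G} -> nat -> Prop) (f g : quantity R) : Prop :=
  soft_O (fun _ _ _ => True) f g /\ soft_O D g f.

(* Without these conditions no communication is needed: ED is constantly true
   if #|K| <= 1 and constantly false if 2 ^ n < #|K|. *)
Definition nontrivial (G : sgraph) (K : {set G}) (n : nat) : Prop :=
  (2 <= #|K| <= 2 ^ n)%N.

(* If the universe has only #|K| + o(#|K|) elements, randomized ED can be much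
   easier than flow: for 2 ^ n = #|K| it asks if the inputs exhaust {0,1}^n,
   which public-coin fingerprints decide along a spanning tree. *)
Definition slack (R : realType) (delta : R) (G : sgraph) (K : {set G})
    (n : nat) : Prop :=
  (2 <= #|K|)%N /\ (1 + delta) * #|K|%:R <= 2 ^+ n.

(* Main.v *)
(* Lower bounds.  Let S(0), S(1), ..., S(2T) be an increasing chain of sets of
   nodes, that is, a cut of the timed graph with 2T steps.  A T-round protocol
   yields a two-party protocol between Alice, who holds the inputs inside S(0),
   and Bob, who holds those outside S(2T), whose communication is the capacity
   of the cut: after i rounds Alice knows the states inside S(2T - i) and Bob
   those outside S(i), and each bit that one of them misses crosses the cut.
   ED contains the two-party problem "do x and y differ in every coordinate?"
   over a large alphabet (deterministic case, hard by matrix rank) and set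
   disjointness (randomized case, hard by information complexity with Hellinger
   distances), so every timed cut is large relative to the number of terminals
   on its smaller side.  Cuts become all-to-all flows by the cut-matching game:
   in consecutive windows, a single-commodity flow across a well-chosen
   bisection is averaged into the current routing matrix, which decreases its
   distance from the uniform matrix by a factor 1 - 1/O(log |G|).

   Upper bounds.  A multicommodity flow routes any balanced set of integral
   demands by two random phases and randomized rounding.  This simulates on the
   terminals a sorting network, after which equal inputs sit on consecutive
   wires.  In the randomized case the inputs are first hashed to O(log |K|)
   bits. *)

Require Import Defs.
From HB Require Import structures.
From mathcomp Require Import all_boot all_order all_algebra.
From mathcomp Require Import classical_sets reals ereal sequences exp boolp.
From mathcomp Require Import fintype finset.
From mathcomp Require Import zify ring lra.

Set Implicit Arguments.
Unset Strict Implicit.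
Unset Printing Implicit Defensive.

Import Order.TTheory GRing.Theory Num.Theory.
Local Open Scope ring_scope.

(** * Flows, cuts and walks in the timed graph *)

(** A cut of the timed graph limits what passes forwards, whereas a protocol is interactive.
    Doubling the time resolves this: the first [T] layers are charged with messages leaving the
    inner side, the last [T] layers, read backwards, with messages entering it, so one monotone
    chain pays for both directions. Congestion and time are interchangeable: spreading each round
    over [D] rounds divides every load by [D]. A cut bound that is off by a factor therefore costs
    only that factor in time, and no step needs an optimal flow. Randomized rounding must control
    all edges in all rounds, so its congestion grows with the logarithm of the duration, and a
    feasible flow may last arbitrarily long. The duration is therefore capped in advance:
    feasibility makes the terminals connected, and connectivity alone yields a flow of polynomial
    duration. All probabilistic existence arguments are averages over finite sets: sign vectors for
    the bisection, choices of walks for the rounding, all functions as hashes. *)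

Lemma sum_indic1 (R : pzRingType) (T : finType) (a : T) (F : T -> R) :
  \sum_b (a == b)%:R * F b = F a.
Proof.
rewrite (bigD1 a) //= eqxx mul1r big1 ?addr0 // => b /negbTE ba.
by rewrite eq_sym ba mul0r.
Qed.

Section MaxFlow.
Variables (N : finType) (cap : N -> N -> int) (s t : N).
Hypothesis st : s != t.

Definition skew_flow (f : N -> N -> int) (d : int) : Prop :=
  [/\ forall a b, f b a = - f a b,
      forall a b, f a b <= cap a b,
      forall a, a != s -> a != t -> \sum_b f a b = 0 &
      \sum_b f s b = d].

Fixpoint path_flow (x : N) (p : seq N) (a b : N) : int :=
  if p is y :: p' then
    ((a == x) && (b == y))%:R - ((a == y) && (b == x))%:R + path_flow y p' a b
  else 0.

Lemma path_flow_skew x p a b : path_flow x p b a = - path_flow x p a b.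
Proof.
elim: p x => [|y p IH] x /=; first by rewrite oppr0.
by rewrite IH opprD opprB; congr (_ - _); rewrite andbC [in X in _ - X]andbC.
Qed.

Lemma path_flow_div x p a :
  \sum_b path_flow x p a b = (a == x)%:R - (a == last x p)%:R.
Proof.
elim: p x => [|y p IH] x /=; first by rewrite big1 ?subrr.
have H (u v : N) : \sum_b ((a == u) && (b == v))%:R = (a == u)%:R :> int.
  under eq_bigr => b _ do rewrite -mulnb natrM mulrC eq_sym.
  by rewrite sum_indic1.
by rewrite big_split sumrB /= IH !H; ring.
Qed.

Lemma path_flow_out x p a b : a \notin x :: p -> path_flow x p a b = 0.
Proof.
elim: p x => [|y p IH] x //=; rewrite !inE !negb_or => /and3P[ax ay ap].
by rewrite (negbTE ax) (negbTE ay) IH ?addr0 ?subrr // inE negb_or ay.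
Qed.

(** Simplicity bounds the contribution of each arc by one unit, the least residual capacity of an
    unsaturated arc when capacities are integers. *)
Lemma path_flow_le (r : rel N) x p a b : path r x p -> uniq (x :: p) ->
  path_flow x p a b <= (r a b)%:R.
Proof.
elim: p x => [|y p IH] x /=; first by rewrite ler0n.
move=> /andP[rxy rp] /andP[xp up].
have [ax|ax] := eqVneq a x; last first.
  rewrite /= sub0r; apply: le_trans (IH _ rp up).
  by rewrite gerDr oppr_le0 ler0n.
rewrite ax path_flow_out // addr0 /=.
by have [/eqP ->|_] := boolP (b == y); rewrite ?rxy /= lerBlDr ?lerDl ?addr_ge0 ?ler0n.
Qed.

(** Ford-Fulkerson as an induction on the value: a flow of value [d] either has a residual path from
    [s] to [t], which carries one more unit because capacities are integers, or the set reachable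
    from [s] in the residual graph is a saturated cut of capacity [d], too small for the hypothesis
    at [d.+1]. *)
Lemma max_flow_min_cut (d : nat) :
  (forall a b, 0 <= cap a b) ->
  (forall S : {set N}, s \in S -> t \notin S ->
     d%:R <= \sum_(a in S) \sum_(b in ~: S) cap a b) ->
  exists f, skew_flow f d%:R.
Proof.
move=> cap0; elim: d => [|d IH] cut.
  by exists (fun _ _ => 0); split=> *; rewrite ?oppr0 ?big1.
have [S sS tS|f [fs fc fk fv]] := IH.
  by apply: le_trans (cut S sS tS); rewrite ler_nat.
pose r a b := f a b < cap a b.
have [/connectP[p0 rp0 tE]|ncon] := boolP (connect r s t).
  case: (shortenP rp0) tE => p rp up _ tE.
  exists (fun a b => f a b + path_flow s p a b); split.
  - by move=> a b; rewrite fs path_flow_skew opprD.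
  - move=> a b; have := path_flow_le a b rp up; rewrite /r.
    by have := fc a b; case: ltP => /=; lia.
  - move=> a as_ at_; rewrite big_split /= fk // path_flow_div -tE.
    by rewrite (negbTE as_) (negbTE at_).
  - by rewrite big_split /= fv path_flow_div -tE eqxx (negbTE st) subr0 -natr1.
pose S := [set a | connect r s a].
have := cut S; rewrite !inE connect0 => /(_ isT ncon).
suff -> : \sum_(a in S) \sum_(b in ~: S) cap a b = d%:R by rewrite ler_nat ltnn.
have -> : d%:R = \sum_(a in S) \sum_b f a b.
  rewrite (bigD1 s) /= ?inE ?connect0 // fv big1 ?addr0 // => a.
  rewrite inE => /andP[sa as_]; apply: fk => //.
  by apply: contraNneq ncon => <-.
have -> : \sum_(a in S) \sum_b f a b =
    \sum_(a in S) \sum_(b in S) f a b + \sum_(a in S) \sum_(b in ~: S) f a b.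
  rewrite -big_split; apply: eq_bigr => a _ /=.
  rewrite (bigID (mem S)) /=; congr (_ + _).
  by apply: eq_bigl => b; rewrite !inE.
have -> : \sum_(a in S) \sum_(b in S) f a b = 0.
  have : \sum_(a in S) \sum_(b in S) f a b = - \sum_(a in S) \sum_(b in S) f a b.
    rewrite {1}exchange_big /= -sumrN; apply: eq_bigr => a _.
    by rewrite -sumrN; apply: eq_bigr => b _.
  by lia.
rewrite add0r; apply: eq_bigr => a aS; apply: eq_bigr => b bS.
apply/eqP; rewrite eq_le fc andbT leNgt; apply/negP => rab.
move: aS bS; rewrite !inE => sa /negP[].
exact: connect_trans sa (connect1 rab).
Qed.

End MaxFlow.

Lemma sum_pair_fst (R : nmodType) (I J : finType) (P : pred I) (F : I * J -> R) :
  \sum_(p | P p.1) F p = \sum_(i | P i) \sum_j F (i, j).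
Proof.
rewrite (pair_big P xpredT (fun i j => F (i, j))) /=.
by apply: eq_big => -[i j] //=; rewrite ?andbT.
Qed.

Lemma sum_pair_snd (R : nmodType) (I J : finType) (P : pred J) (F : I * J -> R) :
  \sum_(p | P p.2) F p = \sum_(j | P j) \sum_i F (i, j).
Proof.
rewrite exchange_big (pair_big xpredT P (fun i j => F (i, j))) /=.
by apply: eq_big => -[i j].
Qed.

(* A weighted family of walks: item i of weight [wt i] is at [pos i t] at time
   t. Only a finite range of times matters. *)
Definition wload (R : numDomainType) (V I : finType) (wt : I -> R)
    (pos : I -> nat -> V) (t : nat) (x y : V) : R :=
  \sum_(i | (pos i t == x) && (pos i t.+1 == y)) wt i.

Lemma sum_wload_in (R : numDomainType) (V I : finType) (wt : I -> R)
    (pos : I -> nat -> V) t y :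
  \sum_x wload wt pos t x y = \sum_(i | pos i t.+1 == y) wt i.
Proof.
rewrite [RHS](partition_big (fun i => pos i t) xpredT) //=.
by apply: eq_bigr => x _; apply: eq_bigl => i; rewrite andbC.
Qed.

(* Items follow the Markov chain whose transition probabilities are the
   fractions of the flow through a node. *)
Lemma layered_flow_walks (R : numFieldType) (V : finType) (tau : nat)
    (phi : nat -> V -> V -> R) (a : V -> R) :
  (forall t x y, 0 <= phi t x y) ->
  (forall x, 0 <= a x) ->
  (forall x, (0 < tau)%N -> \sum_y phi 0%N x y = a x) ->
  (forall t y, (t.+1 < tau)%N -> \sum_x phi t x y = \sum_z phi t.+1 y z) ->
  exists (I : finType) (wt : I -> R) (pos : I -> nat -> V),
    [/\ forall i, 0 <= wt i,
        forall x, \sum_(i | pos i 0%N == x) wt i = a x &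
        forall t x y, (t < tau)%N -> wload wt pos t x y = phi t x y].
Proof.
move=> phi0 a0; elim: tau => [|tau IH] init cons.
  exists V, a, (fun i _ => i); split=> // x.
  by rewrite (bigD1 x) //= big1 ?addr0 // => i /andP[/eqP ->]; rewrite eqxx.
have [//|t y ht|I [wt [pos [wt0 wti wtl]]]] := IH.
- by move=> x tau0; apply: init.
- by apply: cons; apply: ltnW.
pose o x := \sum_y phi tau x y.
have o0 x : 0 <= o x by apply: sumr_ge0.
have mass x : \sum_(i | pos i tau == x) wt i = o x.
  case: tau @o init cons wtl {IH o0} => [|s] o init cons wtl.
    by rewrite wti /o init.
  by rewrite -sum_wload_in /o -cons //; apply: eq_bigr => w _; rewrite wtl.
(* Where the outflow vanishes the transition probabilities are 0/0 = 0; nothing is lost, because the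
   weight present there and the flow out of it vanish too. *)
have o0wt i : o (pos i tau) = 0 -> wt i = 0.
  rewrite -mass => /eqP; rewrite psumr_eq0 // => /allP/(_ i).
  by rewrite mem_index_enum eqxx => /(_ isT)/eqP.
have o0phi x y : o x = 0 -> phi tau x y = 0.
  move/eqP; rewrite psumr_eq0 // => /allP/(_ y).
  by rewrite mem_index_enum => /(_ isT)/eqP.
pose wt' (p : I * V) := wt p.1 * (phi tau (pos p.1 tau) p.2 / o (pos p.1 tau)).
pose pos' (p : I * V) t := if (t <= tau)%N then pos p.1 t else p.2.
have sumwt' i : \sum_y wt' (i, y) = wt i.
  rewrite /wt' /= -mulr_sumr -mulr_suml -/(o _).
  have [/eqP oe|/divff ->] := boolP (o (pos i tau) == 0); last by rewrite mulr1.
  by rewrite (o0wt i) ?mul0r.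
have sumP (P : pred I) : \sum_(p : I * V | P p.1) wt' p = \sum_(i | P i) wt i.
  by rewrite sum_pair_fst; apply: eq_bigr.
exists (I * V)%type, wt', pos'; split.
- by move=> p; rewrite /wt' mulr_ge0 ?divr_ge0.
- by move=> x; rewrite -wti -sumP.
move=> t x y; rewrite ltnS leq_eqVlt => /predU1P[->|tt].
  rewrite /wload /pos' leqnn ltnn.
  rewrite (eq_bigl (fun p : I * V => (pos p.1 tau == x) && (p.2 == y))) //.
  rewrite -(pair_big (fun i => pos i tau == x) (fun z => z == y)
                     (fun i z => wt' (i, z))) /=.
  under eq_bigr => i ix do rewrite (big_pred1 y) // /wt' /= (eqP ix).
  rewrite -mulr_suml mass.
  have [/eqP oe|on] := boolP (o x == 0); last by rewrite mulrC divfK.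
  by rewrite oe mul0r o0phi.
rewrite -wtl // /wload -sumP; apply: eq_bigl => p.
by rewrite /pos' tt (ltnW tt).
Qed.

(* The edges leaving the set [{(x, i) | x \in S i}] of nodes of the timed graph. *)
Definition cut_edges (G : sgraph) (T : nat) (S : nat -> {set G}) :
    {set 'I_T * (G * G)} :=
  [set e : 'I_T * (G * G) | [&& edge e.2.1 e.2.2, e.2.1 \in S e.1 & e.2.2 \notin S e.1.+1]].

(** The ratio [Q / q] is a congestion: edges of capacity [Q / q] per round would give each timed cut
    at least as much capacity as there are terminals on its smaller side. Monotone chains are the
    cuts that sever no memory edge. Two integers instead of a fraction keep the flow problem
    integral. *)
Definition cut_condition (G : sgraph) (K : {set G}) (T q Q : nat) : Prop :=
  forall S : nat -> {set G}, (forall i, S i \subset S i.+1) ->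
  (q * minn #|K :&: S 0| #|K :\: S T| <= Q * #|cut_edges T S|)%N.

Lemma ler_sum_inj (R : numDomainType) (E X : finType) (P : {set E}) (D : pred X)
    (g : E -> X) (c : X -> R) :
  {in P &, injective g} -> (forall e, e \in P -> D (g e)) ->
  (forall x, 0 <= c x) ->
  \sum_(e in P) c (g e) <= \sum_(x | D x) c x.
Proof.
move=> gi gD c0; rewrite -big_imset //= [leRHS](bigID (mem (g @: P))) /=.
rewrite (eq_bigl (fun x => D x && (x \in g @: P))).
  by rewrite lerDl; apply: sumr_ge0.
move=> x; apply/idP/andP => [xP|[]//]; split=> //.
by case/imsetP: xP => e eP ->; apply: gD.
Qed.

Section CutWalks.
Variables (G : sgraph) (K A : {set G}) (T q Q : nat).
Hypotheses (AK : A \subset K) (smallA : (#|A|.*2 <= #|K|)%N) (q0 : (0 < q)%N).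
Hypothesis cut : cut_condition K T q Q.

Local Notation node := ((G * 'I_T.+1) + bool)%type.
Local Notation nd x t := (inl (x, inord t) : node).
Local Notation src := (inr false : node).
Local Notation snk := (inr true : node).

(** All capacities are multiplied by [q]. Memory edges get [q * #|A|], the whole value of the flow,
    which acts as infinity. *)
Let cap (a b : node) : nat :=
  match a, b with
  | inr false, inl (x, i) => if (i == 0 :> nat) && (x \in A) then q else 0
  | inl (x, i), inr true => if (i == T :> nat) && (x \in K :\: A) then q else 0
  | inl (x, i), inl (y, j) =>
      if j == i.+1 :> nat then
        if x == y then (q * #|A|)%N else if edge x y then Q else 0
      else 0
  | _, _ => 0
  end.

Let cap_cut (S : {set node}) : src \in S -> snk \notin S ->
  (q * #|A| <= \sum_(p : node * node | (p.1 \in S) && (p.2 \notin S)) cap p.1 p.2)%N.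
Proof.
move=> sS tS.
pose S' i : {set G} := [set x | nd x (minn i T) \in S].
(* A chain that is not monotone severs a memory edge, whose capacity alone is the required
   [q * #|A|]. *)
have [mono|] := boolP [forall i : 'I_T, S' i \subset S' i.+1]; last first.
  case/forallPn => i /subsetPn[x]; rewrite !inE => xi xi1.
  rewrite (bigD1 (nd x (minn i T), nd x (minn i.+1 T))) /= ?xi //.
  rewrite eqxx !inordK ?ltnS ?geq_minr // (minn_idPl _) ?(minn_idPl _) ?eqxx ?leq_addr //.
  exact: ltnW.
have {}mono i : S' i \subset S' i.+1.
  have [iT|Ti] := ltnP i T; first exact: (forallP mono (Ordinal iT)).
  by apply/subsetP => x; rewrite !inE (minn_idPr Ti) (minn_idPr (leqW Ti)).
have := cut mono.
have S0 x : (x \in S' 0%N) = (nd x 0%N \in S) by rewrite inE min0n.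
have ST x : (x \in S' T) = (nd x T \in S) by rewrite inE minnn.
(* For a monotone chain, [P] indexes three disjoint families of severed arcs: source arcs to [A]
   outside [S' 0], timed edges, and sink arcs from [K :\: A] inside [S' T]. The injection [g] makes
   their total a lower bound for the cut. *)
pose P : {set G + ('I_T * (G * G)) + G} :=
  [set e | match e with
           | inl (inl x) => x \in A :\: S' 0%N
           | inl (inr e) => e \in cut_edges T S'
           | inr x => x \in (K :\: A) :&: S' T end].
pose g (e : G + ('I_T * (G * G)) + G) : node * node :=
  match e with
  | inl (inl x) => (src, nd x 0%N)
  | inl (inr e) => (nd e.2.1 e.1, nd e.2.2 e.1.+1)
  | inr x => (nd x T, snk) end.
have gi : injective g.
  move=> [[x|[i [x y]]]|x] [[x'|[i' [x' y']]]|x'] //= [] //; try by move->.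
  move=> -> ii' -> _; have := congr1 val ii'.
  rewrite /= !inordK ?ltnS ?(ltnW (ltn_ord _)) // => e.
  by rewrite (val_inj e : i = i').
have gD e : e \in P -> ((g e).1 \in S) && ((g e).2 \notin S).
  case: e => [[x|[i [x y]]]|x]; rewrite !inE /=.
  - by rewrite sS -S0 inE => /andP[].
  - rewrite !(minn_idPl _) ?(ltnW (ltn_ord _)) //.
    by case/and3P=> _ -> ->.
  - by rewrite tS andbT minnn => /andP[_ ->].
have : (\sum_(e in P) (cap (g e).1 (g e).2) <=
    \sum_(p : node * node | (p.1 \in S) && (p.2 \notin S)) cap p.1 p.2)%N.
  have := @ler_sum_inj int _ _ P (fun p => (p.1 \in S) && (p.2 \notin S)) g
     (fun p => (cap p.1 p.2)%:R) (in2W gi) gD (fun _ => ler0n _ _).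
  by rewrite -!natr_sum ler_nat.
move=> le c; apply: leq_trans le; move: c.
rewrite big_sumType big_sumType /=.
have -> : (\sum_(x | inl (inl x) \in P) cap src (nd x 0%N) = q * #|A :\: S' 0%N|)%N.
  rewrite mulnC -sum_nat_const; apply: eq_big => x; first by rewrite !inE.
  by rewrite !inE /cap inordK //= => /andP[_ ->].
have -> : (\sum_(x | inr x \in P) cap (nd x T) snk = q * #|(K :\: A) :&: S' T|)%N.
  rewrite mulnC -sum_nat_const; apply: eq_big => x; first by rewrite !inE.
  by rewrite !inE /cap inordK //= eqxx !inE => /andP[-> _].
have -> : (\sum_(e | inl (inr e) \in P) cap (nd e.2.1 e.1) (nd e.2.2 e.1.+1)
     = Q * #|cut_edges T S'|)%N.
  rewrite mulnC -sum_nat_const; apply: eq_big => -[i [x y]]; first by rewrite !inE.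
  rewrite !inE /= => /andP[exy _].
  rewrite !inordK ?ltnS ?(ltnW (ltn_ord _)) ?eqxx // exy.
  by case: eqVneq exy => // ->; rewrite edge_irr.
have c1 : (#|A| <= #|K :&: S' 0%N| + #|A :\: S' 0%N|)%N.
  by rewrite -(cardsID (S' 0%N) A) leq_add2r; apply/subset_leq_card/setSI.
have c2 : (#|A| <= #|K :\: S' T| + #|(K :\: A) :&: S' T|)%N.
  have : (#|A| <= #|K :\: A|)%N by rewrite cardsDS //; lia.
  move/leq_trans; apply; rewrite -(cardsID (S' T) (K :\: A)) addnC leq_add2r.
  by apply/subset_leq_card/setSD/subsetDl.
move: c1 c2; set k0 := #|K :&: _|; set a0 := #|A :\: _|; set k1 := #|K :\: _|.
set b1 := #|_ :&: S' T|; set E := #|cut_edges _ _|; set a := #|A|.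
clear -q0 => c c1 c2; move: c; by case: (leqP k0 k1) => _ c; nia.
Qed.

Let flow_exists : exists f : node -> node -> int,
  skew_flow (fun a b => (cap a b)%:Z) src snk f (q * #|A|)%:R.
Proof.
apply: max_flow_min_cut => // S sS tS.
rewrite pair_big_dep /=.
rewrite (eq_bigl (fun p : node * node => (p.1 \in S) && (p.2 \notin S))); last first.
  by move=> p; rewrite !inE.
by under eq_bigr => p _ do rewrite -natz; rewrite -natr_sum ler_nat cap_cut.
Qed.

Lemma cut_walks (R : numFieldType) :
  exists (I : finType) (wt : I -> R) (pos : I -> nat -> G),
    [/\ forall i, 0 <= wt i,
        forall x, \sum_(i | pos i 0%N == x) wt i = (x \in A)%:R,
        forall y, \sum_(i | pos i T == y) wt i <= (y \in K :\: A)%:R &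
        forall t x y, (t < T)%N -> x != y ->
          wload wt pos t x y <= (edge x y)%:R * (Q%:R / q%:R)].
Proof.
have [f [fs fc fk fv]] := flow_exists.
have fz a b : cap a b = 0%N -> cap b a = 0%N -> f a b = 0.
  by move=> ab ba; have := fc a b; have := fc b a; rewrite fs ab ba; lia.
have qR : (q%:R : R) != 0 by rewrite pnatr_eq0 -lt0n.
(* The value of the flow equals the total capacity of the source arcs, so each of them is
   saturated. *)
have fsrc b : f src b = (cap src b)%:Z.
  have : \sum_b ((cap src b)%:Z - f src b) = 0.
    have s2 : \sum_(b : bool) (cap src (inr b))%:Z = 0 by rewrite big_bool.
    have s3 : \sum_b (cap src b)%:Z = \sum_p (cap src (inl p))%:Z.
      by rewrite big_sumType s2; apply: addr0.
    rewrite sumrB fv s3.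
    rewrite (eq_bigr (fun p : G * 'I_T.+1 => (cap src (inl (p.1, p.2)))%:Z)); last by case.
    rewrite -(pair_big xpredT xpredT (fun x i => (cap src (inl (x, i)))%:Z)).
    rewrite natrM -sum1_card natr_sum mulr_sumr [X in _ - X]big_mkcond /=.
    apply/eqP; rewrite subr_eq0; apply/eqP; apply: eq_bigr => x _.
    rewrite (bigD1 ord0) //= big1 ?addr0; last first.
      by move=> i i0; rewrite -(inj_eq val_inj) in i0; rewrite (negbTE i0).
    by rewrite /=; case: (x \in A); rewrite // mulr1 natz.
  move/eqP; rewrite psumr_eq0 => [/allP/(_ b)|c _]; last by rewrite subr_ge0.
  by rewrite mem_index_enum subr_eq0 => /(_ isT)/eqP.
pose F t x y : int := f (nd x t) (nd y t.+1).
have F0 t x y : (t < T)%N -> 0 <= F t x y.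
  move=> tT; rewrite /F -[f _ _]opprK -fs oppr_ge0; apply: le_trans (fc _ _) _.
  by rewrite /= !inordK ?ltnS ?(ltnW tT) // ltn_eqF // ltnS leqnSn.
have bal t x : (t <= T)%N ->
  (if (t < T)%N then \sum_y F t x y else 0)
  - (if t is t'.+1 then \sum_y F t' y x else (cap src (nd x 0%N))%:Z)
  + f (nd x t) snk = 0.
  move=> tT; have := fk (nd x t) isT isT.
  rewrite big_sumType big_bool.
  rewrite (eq_bigr (fun p : G * 'I_T.+1 => f (nd x t) (inl (p.1, p.2)))); last by case.
  rewrite -(pair_big xpredT xpredT (fun y i => f (nd x t) (inl (y, i)))) /=.
  have -> : \sum_y \sum_j f (nd x t) (inl (y, j)) =
    (if (t < T)%N then \sum_y F t x y else 0) -
    (if t is t'.+1 then \sum_y F t' y x else 0).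
    have -> : (if (t < T)%N then \sum_y F t x y else 0) =
        \sum_y (if (t < T)%N then F t x y else 0).
      by case: ifP => // _; rewrite big1.
    have -> : (if t is t'.+1 then \sum_y F t' y x else 0) =
        \sum_y (if t is t'.+1 then F t' y x else 0).
      by case: (t) => // *; rewrite big1.
    rewrite -sumrB; apply: eq_bigr => y _.
    have jE (j : 'I_T.+1) : f (nd x t) (inl (y, j)) =
       (if (t < T)%N then (inord t.+1 == j)%:R * F t x y else 0) -
       (if t is t'.+1 then (inord t' == j)%:R * F t' y x else 0).
      have ordE u : (u <= T)%N -> (inord u == j) = (u == j).
        by move=> uT; rewrite -(inj_eq val_inj) /= inordK.
      have [jt|jt] := eqVneq (j : nat) t.+1.
        have tT' : (t < T)%N by have := ltn_ord j; rewrite jt ltnS.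
        rewrite tT' ordE // -jt eqxx mul1r /F -jt inord_val.
        case: (t) tT jt => [|t'] tT jt; rewrite ?subr0 //.
        by rewrite ordE ?jt ?ltn_eqF ?mul0r ?subr0 // ltnW.
      rewrite (_ : (if (t < T)%N then _ else 0) = 0); last first.
        by case: ifP => // tT'; rewrite ordE // eq_sym (negbTE jt) mul0r.
      have [tj|tj] := eqVneq t j.+1.
        by rewrite tj inord_val eqxx mul1r sub0r /F inord_val fs.
      rewrite fz /=; first 1 last.
      - by rewrite inordK ?ltnS // (negbTE jt).
      - by rewrite inordK ?ltnS // (negbTE tj).
      case: (t) tT tj => [|t'] tT tj; rewrite ?subr0 //.
      by rewrite ordE ?(ltnW tT) // -eqSS (negbTE tj) mul0r subr0.
    under eq_bigr => j _ do rewrite jE.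
    rewrite sumrB; congr (_ - _).
      by case: ifP => _; rewrite ?sum_indic1 // big1.
    by case: (t) => [|t']; rewrite ?sum_indic1 // big1.
  rewrite [f _ src]fs fsrc; move/(etrans _); apply.
  case: t tT => [|t'] tT /=; first by rewrite subr0 addrA addrAC.
  by congr (_ + _); rewrite inordK //= subr0.
have [t x y|//|x T0|t y tT|I [wt [pos [wt0 wti wtl]]]] := @layered_flow_walks R G T
  (fun t x y => if (t < T)%N then (F t x y)%:~R / q%:R else 0) (fun x => (x \in A)%:R).
- by case: ifP => // tT; rewrite divr_ge0 ?ler0z ?F0.
- rewrite T0 -mulr_suml -rmorph_sum /=.
  have := bal 0%N x (leq0n _); rewrite T0 /= inordK //= fz //=; last first.
    by rewrite inordK // ltn_eqF.
  rewrite addr0 => /eqP; rewrite subr_eq0 => /eqP ->.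
  by case: (x \in A); rewrite ?mul0r // divff.
- rewrite tT (ltnW tT) -!mulr_suml -!rmorph_sum /=.
  have := bal t.+1 y (ltnW tT); rewrite tT /= fz //=; last first.
    by rewrite inordK ?ltn_eqF // ltnW.
  by rewrite addr0 => /eqP; rewrite subr_eq0 => /eqP ->.
exists I, wt, pos; split=> //.
- move=> y.
  have -> : \sum_(i | pos i T == y) wt i = (f (nd y T) snk)%:~R / q%:R.
    have [T0|T0] := posnP T.
      have T0' : (0 < T)%N = false by rewrite T0.
      have e : inord T = inord 0 :> 'I_T.+1 by apply: val_inj; rewrite /= !inordK.
      rewrite {1}T0 wti e; have := bal 0%N y (leq0n _).
      rewrite T0' sub0r addrC => /eqP; rewrite subr_eq0 => /eqP ->.
      by rewrite /= inordK //=; case: (y \in A); rewrite ?mul0r // divff.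
    have := bal T.-1.+1 y; rewrite /= prednK // leqnn ltnn sub0r => /(_ isT).
    rewrite addrC => /eqP; rewrite subr_eq0 => /eqP ->.
    rewrite -{1}(prednK T0) -sum_wload_in rmorph_sum mulr_suml.
    by apply: eq_bigr => x _; rewrite wtl prednK // leqnn.
  rewrite ler_pdivrMr ?ltr0n // -natrM pmulrn ler_int.
  have := fc (nd y T) snk; rewrite /= inordK // eqxx /=.
  by move/le_trans; apply; case: ifP => _; rewrite ?mul1n ?mul0n.
move=> t x y tT xy; rewrite wtl // tT mulrA ler_wpM2r ?invr_ge0 //.
have := fc (nd x t) (nd y t.+1); rewrite /= !inordK ?ltnS ?(ltnW tT) //.
rewrite eqxx (negbTE xy) -(ler_int R) /F; move/le_trans; apply.
by case: ifP => _; rewrite ?mul1r ?mul0r.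
Qed.

End CutWalks.

(** * Cut-matching game *)

Lemma sum_mulb (R : pzRingType) (I : finType) (P : pred I) (F : I -> R) :
  \sum_i F i * (P i)%:R = \sum_(i | P i) F i.
Proof.
rewrite [RHS]big_mkcond; apply: eq_bigr => i _.
by case: (P i); rewrite ?mulr1 ?mulr0.
Qed.

(** Flows are kept as weighted walks rather than as functions on arcs, because walks can be
    reversed, concatenated, thinned and slowed down individually. Waiting at a node is free, hence
    the condition [x != y]. *)
Definition routing (R : numFieldType) (G : sgraph) (T : nat) (c : R)
    (W : G -> G -> R) : Prop :=
  exists (I : finType) (wt : I -> R) (pos : I -> nat -> G),
    [/\ forall i, 0 <= wt i,
        forall u v, \sum_(i | (pos i 0%N == u) && (pos i T == v)) wt i = W u v &
        forall t x y, (t < T)%N -> x != y ->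
          wload wt pos t x y <= (edge x y)%:R * c].

Lemma routing_ge0 (R : numFieldType) (G : sgraph) T (c : R) (W : G -> G -> R) u v :
  routing T c W -> 0 <= W u v.
Proof. by move=> [I [wt [pos [h1 <- h3]]]]; apply: sumr_ge0. Qed.

Lemma routing_stay (R : numFieldType) (G : sgraph) (c : R) (K : {set G}) :
  routing 0 c (fun u v => ((u == v) && (u \in K))%:R).
Proof.
exists G, (fun x => (x \in K)%:R), (fun x _ => x); split=> // u v.
rewrite big_mkcond (bigD1 u) //= eqxx /= big1 ?addr0 => [|x xu].
  by case: eqP; rewrite //= ?mul1r.
by rewrite (negbTE xu).
Qed.

(** Walks are paired when the first ends where the second starts, with product weights. Each
    terminal receives mass 1 in the first routing and emits mass 1 in the second, so pairing leaves
    the marginals, hence the loads, no larger than before. *)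
Lemma routing_cat (R : numFieldType) (G : sgraph) (K : {set G}) (T1 T2 : nat) (c : R)
    (W1 W2 : G -> G -> R) :
  routing T1 c W1 -> routing T2 c W2 ->
  (forall v, \sum_u W1 u v = (v \in K)%:R) ->
  (forall u, \sum_v W2 u v = (u \in K)%:R) ->
  routing (T1 + T2) c (fun u v => \sum_w W1 u w * W2 w v).
Proof.
move=> [I [wt1 [pos1 [w10 w1m w1l]]]] [J [wt2 [pos2 [w20 w2m w2l]]]] W1in W2out.
pose wt (p : I * J) := wt1 p.1 * wt2 p.2 * (pos1 p.1 T1 == pos2 p.2 0%N)%:R.
pose pos (p : I * J) t := if (t <= T1)%N then pos1 p.1 t else pos2 p.2 (t - T1)%N.
have m1 x : \sum_(i | pos1 i T1 == x) wt1 i = (x \in K)%:R.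
  rewrite -W1in (partition_big (fun i => pos1 i 0%N) xpredT) //.
  by apply: eq_bigr => u _; rewrite -w1m; apply: eq_bigl => i; rewrite andbC.
have m2 x : \sum_(i | pos2 i 0%N == x) wt2 i = (x \in K)%:R.
  rewrite -W2out (partition_big (fun i => pos2 i T2) xpredT) //.
  by apply: eq_bigr => u _; rewrite -w2m.
have s1 i : \sum_j wt (i, j) <= wt1 i.
  rewrite /wt /= (sum_mulb (fun j => pos1 i T1 == pos2 j 0%N)) -mulr_sumr.
  under eq_bigl => j do rewrite eq_sym.
  by rewrite m2 ler_piMr // lern1 leq_b1.
have s2 j : \sum_i wt (i, j) <= wt2 j.
  rewrite /wt /= (sum_mulb (fun i => pos1 i T1 == pos2 j 0%N)) -mulr_suml mulrC.
  by rewrite m1 ler_piMr // lern1 leq_b1.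
exists (I * J)%type, wt, pos; split.
- by move=> p; rewrite /wt !mulr_ge0.
- move=> u v.
  have e (p : I * J) : (if (pos p 0%N == u) && (pos p (T1 + T2)%N == v) then wt p else 0)
     = \sum_w (if (pos1 p.1 0%N == u) && (pos1 p.1 T1 == w) then wt1 p.1 else 0) *
              (if (pos2 p.2 0%N == w) && (pos2 p.2 T2 == v) then wt2 p.2 else 0).
    rewrite (bigD1 (pos1 p.1 T1)) //= big1 ?addr0; last first.
      by move=> w wn; rewrite [pos1 _ _ == w]eq_sym (negbTE wn) andbF mul0r.
    rewrite eqxx andbT /pos leq0n /wt eq_sym [pos2 p.2 0%N == _]eq_sym.
    have -> : (if (T1 + T2 <= T1)%N then pos1 p.1 (T1 + T2)%N
               else pos2 p.2 (T1 + T2 - T1)%N) = if T2 == 0%N then pos1 p.1 T1 else pos2 p.2 T2.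
      by rewrite -[X in (_ <= X)%N]addn0 leq_add2l leqn0 addKn; case: eqP => // ->; rewrite addn0.
    have [e|e] := eqVneq (pos1 p.1 T1) (pos2 p.2 0%N); last first.
      by rewrite mulr0 mulr0; case: ifP.
    have -> : (if T2 == 0%N then pos1 p.1 T1 else pos2 p.2 T2) = pos2 p.2 T2.
      by case: eqP => // ->.
    rewrite mulr1 /= [u == _]eq_sym; case: (_ == u); case: (_ == v) => //=;
      by rewrite ?mulr0 ?mul0r.
  rewrite big_mkcond /= (eq_bigr _ (fun p _ => e p)) exchange_big /=.
  apply: eq_bigr => w _; rewrite -w1m -w2m big_mkcond [in RHS]big_mkcond /=.
  rewrite [X in _ = _ * X]big_mkcond mulr_suml /=.
  by rewrite (sum_pair_fst xpredT); apply: eq_bigr => i _; rewrite mulr_sumr.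
move=> t x y tT xy; have [tT1|tT1] := ltnP t T1.
  apply: le_trans (w1l t x y tT1 xy).
  rewrite /wload (eq_bigl (fun p : I * J => (pos1 p.1 t == x) && (pos1 p.1 t.+1 == y))).
    by rewrite (sum_pair_fst (fun i => (pos1 i t == x) && (pos1 i t.+1 == y))); apply: ler_sum.
  by move=> p; rewrite /pos tT1 (ltnW tT1).
have tT2 : (t - T1 < T2)%N by rewrite ltn_subLR.
apply: le_trans (w2l _ x y tT2 xy).
have -> : wload wt pos t x y =
  \sum_(p : I * J | (pos2 p.2 (t - T1)%N == x) && (pos2 p.2 (t - T1).+1 == y)) wt p.
  rewrite /wload big_mkcond [in RHS]big_mkcond /=; apply: eq_bigr => p _.
  rewrite /pos ltnNge tT1 /= subSn //.
  have [->|tn] := eqVneq t T1.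
    rewrite leqnn subnn /wt.
    have [e|e] := eqVneq (pos1 p.1 T1) (pos2 p.2 0%N); first by rewrite e.
    by rewrite mulr0 !if_same.
  suff -> : (t <= T1)%N = false by [].
  by apply/negbTE; rewrite -ltnNge ltn_neqAle eq_sym tn.
rewrite (sum_pair_snd (fun j => (pos2 j (t - T1)%N == x) && (pos2 j (t - T1).+1 == y))).
exact: ler_sum.
Qed.

(** Each walk out of [A] is run with half its weight, and so is its reversal; the remaining mass
    [st] stays put. Reversal makes [W] symmetric. A terminal is either in [A] or not, so it sends or
    receives at most one unit, and at least half of its mass stays. *)
Lemma cut_stage (R : realFieldType) (G : sgraph) (K A : {set G}) (T q Q : nat) :
  A \subset K -> (#|A|.*2 <= #|K|)%N -> (0 < q)%N -> cut_condition K T q Q ->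
  exists W : G -> G -> R,
    [/\ routing T (Q%:R / q%:R) W,
        forall u v, W u v = W v u,
        forall u, \sum_v W u v = (u \in K)%:R,
        forall u, u \in K -> 2^-1 <= W u u &
        forall a, a \in A -> 2^-1 <= \sum_(b in K :\: A) W a b].
Proof.
move=> AK smallA q0 cut.
have [I [wt [pos [wt0 wti wtT wtl]]]] := cut_walks AK smallA q0 cut R.
pose m u v := \sum_(i | (pos i 0%N == u) && (pos i T == v)) wt i.
pose inb y := \sum_(i | pos i T == y) wt i.
have m0 u v : 0 <= m u v by apply: sumr_ge0.
have mout u : \sum_v m u v = (u \in A)%:R.
  by rewrite -wti [RHS](partition_big (fun i => pos i T) xpredT).
have min_ v : \sum_u m u v = inb v.
  rewrite [RHS](partition_big (fun i => pos i 0%N) xpredT) //.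
  by apply: eq_bigr => u _; apply: eq_bigl => i; rewrite andbC.
pose st u := (u \in K)%:R - 2^-1 * ((u \in A)%:R + inb u).
have inb0 u : 0 <= inb u by apply: sumr_ge0.
have h0 : (0 : R) <= 2^-1 by rewrite invr_ge0.
have stge u : (u \in K)%:R * 2^-1 <= st u.
  rewrite /st; have := wtT u; rewrite -/(inb u) inE.
  case: (boolP (u \in A)) => uA /=; last first.
    by case: (u \in K) => /= h; rewrite ?mulr1n ?mulr0n; lra.
  by rewrite (subsetP AK u uA) mulr1n => h; lra.
pose W u v := 2^-1 * m u v + 2^-1 * m v u + (u == v)%:R * st u.
have W0 u v : 0 <= W u v.
  by rewrite /W !addr_ge0 ?mulr_ge0 // (le_trans _ (stge u)) // mulr_ge0.
exists W; split.
- pose wt' (j : I + I + G) := match j with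
    | inl (inl i) | inl (inr i) => 2^-1 * wt i | inr x => st x end.
  pose pos' (j : I + I + G) t := match j with
    | inl (inl i) => pos i t | inl (inr i) => pos i (T - t)%N | inr x => x end.
  exists (I + I + G)%type, wt', pos'; split.
  + move=> [[i|i]|x] /=; rewrite ?mulr_ge0 //.
    by rewrite (le_trans _ (stge x)) // mulr_ge0.
  + move=> u v; rewrite big_sumType big_sumType /= /W; congr (_ + _ + _).
    * by rewrite mulr_sumr.
    * rewrite mulr_sumr; apply: eq_bigl => i.
      by rewrite subn0 subnn andbC.
    * rewrite big_mkcond (bigD1 u) //= eqxx /= big1 ?addr0.
        by case: eqP; rewrite ?mul1r ?mul0r.
      by move=> x /negbTE xu; rewrite xu.
  + move=> t x y tT xy; rewrite /wload big_sumType big_sumType /=.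
    rewrite [X in _ + _ + X]big1 ?addr0; last first.
      by move=> z /andP[/eqP-> e]; rewrite e in xy.
    have l1 := wtl t x y tT xy.
    have tT' : (T - t.+1 < T)%N by rewrite -subn_gt0 subKn.
    have l2 := wtl (T - t.+1)%N y x tT' (etrans (congr1 negb (eq_sym y x)) xy).
    rewrite -!mulr_sumr -/(wload wt pos t x y).
    rewrite (eq_bigl (fun i => (pos i (T - t.+1)%N == y) && (pos i (T - t.+1).+1 == x))).
      rewrite -/(wload wt pos (T - t.+1) y x); rewrite edge_sym in l2.
      by lra.
    by move=> i; rewrite andbC subnSK.
- move=> u v; rewrite /W [2^-1 * m u v + _]addrC; congr (_ + _).
  by case: eqVneq => [->|]; rewrite ?mul0r.
- move=> u; rewrite /W !big_split /= -!mulr_sumr mout min_ sum_indic1 /st.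
  by ring.
- move=> u uK; rewrite /W eqxx mul1r.
  have := stge u; rewrite uK mul1r => /le_trans; apply.
  by rewrite lerDr addr_ge0 ?mulr_ge0.
- move=> a aA.
  have -> : 2^-1 = 2^-1 * \sum_(b in K :\: A) m a b.
    suff -> : \sum_(b in K :\: A) m a b = \sum_b m a b by rewrite mout aA mulr1.
    rewrite [RHS](bigID (mem (K :\: A))) /= [X in _ + X]big1 ?addr0 // => b bK.
    apply/eqP; rewrite eq_le m0 andbT; apply: le_trans (_ : inb b <= 0).
      rewrite -min_ (bigD1 a) //= lerDl; exact: sumr_ge0.
    by apply: le_trans (wtT b) _; rewrite (negbTE bK).
  rewrite mulr_sumr; apply: ler_sum => b bK; rewrite /W -addrA lerDl.
  by rewrite addr_ge0 ?mulr_ge0 // (le_trans _ (stge a)) // mulr_ge0.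
Qed.

(** Hoeffding's bound with a worse constant: up to 1/2 the exponentials are at most [1 / (1 - x)]
    and [1 / (1 + x)], and beyond that [x <= 2 * x ^+ 2]. *)
Lemma cosh_le_expR (R : realType) (x : R) :
  expR x + expR (- x) <= 2 * expR (2 * x ^+ 2).
Proof.
have ge1 (y : R) := expR_ge1Dx y.
wlog x0 : x / 0 <= x => [H|].
  have [/H //|/ltW xn] := leP 0 x.
  by have := H (- x); rewrite oppr_ge0 opprK sqrrN addrC; apply.
have [xs|xs] := leP x 2^-1.
  have h1 : expR x <= (1 - x)^-1.
    by rewrite -[x in leLHS]opprK expRN lef_pV2 ?posrE ?expR_gt0 //; first [exact: ge1 | lra].
  have h2 : expR (- x) <= (1 + x)^-1.
    by rewrite expRN lef_pV2 ?posrE ?expR_gt0 //; lra.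
  have h3 : (1 - x)^-1 + (1 + x)^-1 <= 2 * (1 + 2 * x ^+ 2).
    have -> : (1 - x)^-1 + (1 + x)^-1 = 2 / (1 - x ^+ 2) :> R.
      by field; apply/and3P; split; nra.
    have y4 : 0 <= x ^+ 2 <= 4^-1 by apply/andP; split; nra.
    rewrite ler_pdivrMr; last by lra.
    by move: (x ^+ 2) y4 => y /andP[y0 y4]; nra.
  have := ge1 (2 * x ^+ 2); lra.
have : expR x <= expR (2 * x ^+ 2) by rewrite ler_expR; nra.
have : expR (- x) <= expR (2 * x ^+ 2) by rewrite ler_expR; nra.
by lra.
Qed.

Section Signs.
Variables (R : realType) (S : finType).
Implicit Types (r : {ffun S -> bool}) (v : S -> R).

Definition signed_sum v r : R := \sum_u (-1) ^+ r u * v u.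

Lemma signed_sum_sqr v :
  \sum_r signed_sum v r ^+ 2 = 2 ^+ #|S| * \sum_u v u ^+ 2.
Proof.
under eq_bigr => r _ do rewrite expr2 mulr_suml.
rewrite exchange_big /= mulr_sumr; apply: eq_bigr => u _.
under eq_bigr => r _ do rewrite mulr_sumr.
rewrite exchange_big /= (bigD1 u) //= [X in _ + X]big1 ?addr0.
  rewrite (eq_bigr (fun _ => v u ^+ 2)).
    by rewrite sumr_const card_ffun card_bool -[LHS]mulr_natl natrX.
  by move=> r _; rewrite mulrACA -signr_addb addbb mul1r expr2.
move=> w wu.
pose F i (b : bool) : R := if (i == u) || (i == w) then (-1) ^+ b else 1.
rewrite (eq_bigr (fun r : {ffun S -> bool} => (\prod_i F i (r i)) * (v u * v w))).
  rewrite -mulr_suml -(bigA_distr_bigA F) (bigD1 u) //= /F eqxx big_bool /=.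
  by rewrite expr1 expr0 addNr !mul0r.
move=> r _; rewrite mulrACA; congr (_ * _).
rewrite (bigD1 u) //= (bigD1 w) //= big1 ?mulr1 /F ?eqxx ?orbT //.
by move=> i /andP[/negbTE -> /negbTE ->].
Qed.

(** The sum over all sign vectors factors over the coordinates, so a random projection has
    subgaussian tails. *)
Lemma signed_sum_expR t v :
  \sum_r expR (t * signed_sum v r)
    <= 2 ^+ #|S| * expR (2 * t ^+ 2 * \sum_u v u ^+ 2).
Proof.
rewrite (eq_bigr (fun r : {ffun S -> bool} => \prod_u expR (t * ((-1) ^+ r u * v u)))); last first.
  by move=> r _; rewrite -expR_sum /signed_sum mulr_sumr.
rewrite -(bigA_distr_bigA (fun u (b : bool) => expR (t * ((-1) ^+ b * v u)))).
rewrite mulr_sumr expR_sum.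
have -> : 2 ^+ #|S| = \prod_(u : S) (2 : R) by rewrite prodr_const.
rewrite -big_split /=; apply: ler_prod => u _.
rewrite big_bool /= expr1 expr0 mul1r mulN1r mulrN addr_ge0 ?expR_ge0 //=.
by rewrite addrC (le_trans (cosh_le_expR _)) // exprMn mulrA.
Qed.
End Signs.

(** Take the largest value with at most half of [K] strictly below it; if more than half lay above,
    the next larger value would qualify as well. *)
Lemma median_exists (R : realDomainType) (V : finType) (K : {set V}) (z : V -> R) :
  (0 < #|K|)%N ->
  exists eta, (#|[set w in K | (z w < eta)%R]|.*2 <= #|K|)%N /\
              (#|[set w in K | (eta < z w)%R]|.*2 <= #|K|)%N.
Proof.
case/card_gt0P => w0 w0K.
pose lo w := [set v in K | (z v < z w)%R].
have [m mK mmin] := @arg_minP _ _ _ w0 (mem K) z w0K.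
pose P := [pred w | (w \in K) && (#|lo w|.*2 <= #|K|)%N].
have Pm : P m.
  rewrite inE (mK : m \in K) (_ : lo m = finset.set0) ?cards0 //; apply/setP => v; rewrite !inE.
  by apply/negP => /andP[vK]; rewrite ltNge mmin.
have [w /andP[wK wlo] wmax] := @arg_maxP _ _ _ m P z Pm.
exists (z w); split=> //; rewrite leqNgt; apply/negP => hi.
have [|v1] := posnP #|[set v in K | (z w < z v)%R]|; first by lia.
case/card_gt0P: v1 => v1 v1P.
have [v vP vmin] := @arg_minP _ _ _ v1 (mem [set v in K | (z w < z v)%R]) z v1P.
have /andP[vK wv] : (v \in K) && (z w < z v) by have : v \in [set v in K | (z w < z v)%R] := vP; rewrite inE.
have /wmax : P v; last by rewrite /= leNgt wv.
rewrite inE vK /=.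
have : (#|lo v| + #|[set v in K | (z w < z v)%R]| <= #|K|)%N.
  rewrite -cardsUI (_ : _ :&: _ = finset.set0) ?cards0 ?addn0.
    by apply/subset_leq_card/subsetP => x; rewrite !inE => /orP[] /andP[].
  apply/setP => x; rewrite !inE; apply/negP => /andP[/andP[xK xv] /andP[_ wx]].
  have /vmin : x \in [set v in K | (z w < z v)%R] by rewrite inE xK.
by rewrite leNgt xv.
by lia.
Qed.

Lemma sqr_sum_le (R : realDomainType) (I : finType) (a : I -> R) :
  (\sum_i a i) ^+ 2 <= #|I|%:R * \sum_i a i ^+ 2.
Proof.
have : 0 <= \sum_i \sum_j (a i - a j) ^+ 2.
  by apply: sumr_ge0 => i _; apply: sumr_ge0 => j _; apply: sqr_ge0.
have s1 : \sum_(i : I) \sum_(j : I) a i ^+ 2 = #|I|%:R * \sum_i a i ^+ 2.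
  by rewrite mulr_sumr; apply: eq_bigr => i _; rewrite sumr_const mulr_natl.
have s2 : \sum_i \sum_j 2 * (a i * a j) = 2 * (\sum_i a i) ^+ 2.
  rewrite expr2 mulr_suml mulr_sumr; apply: eq_bigr => i _.
  by rewrite !mulr_sumr.
rewrite (eq_bigr (fun i => \sum_(j : I) a i ^+ 2 + \sum_j a j ^+ 2 - \sum_j 2 * (a i * a j))).
  by rewrite sumrB big_split /= [X in _ + X - _]exchange_big /= s1 s2; lra.
move=> i _; rewrite -big_split -sumrB /=; apply: eq_bigr => j _; ring.
Qed.

(** In spectral terms on [K] the claim is that eigenvalues satisfy [lambda ^ 2 <= lambda]; the
    diagonal of at least 1/2 makes them nonnegative. The proof works row by row instead. *)
Lemma lazy_contraction (R : realFieldType) (V : finType) (K : {set V})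
    (W : V -> V -> R) (x : V -> R) :
  (forall u v, 0 <= W u v) -> (forall u v, W u v = W v u) ->
  (forall u, \sum_v W u v = (u \in K)%:R) ->
  (forall u, u \in K -> 2^-1 <= W u u) ->
  \sum_v (\sum_w W v w * x w) ^+ 2 <=
    \sum_v x v ^+ 2 - 2^-1 * \sum_v \sum_w W v w * (x v - x w) ^+ 2.
Proof.
move=> W0 Wsym Wrow Wdiag.
have Wout v w : v \notin K -> W v w = 0.
  move=> vK; apply/eqP; rewrite eq_le W0 andbT.
  have := Wrow v; rewrite (negbTE vK) mulr0n => <-; rewrite (bigD1 w) //= lerDl.
  exact: sumr_ge0.
have step v : (\sum_w W v w * x w) ^+ 2 <=
    \sum_w W v w * x w ^+ 2 - 2^-1 * \sum_w W v w * (x v - x w) ^+ 2.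
  have [vK|vK] := boolP (v \in K); last first.
    rewrite !big1 ?mulr0 ?subr0 ?expr0n // => w _; by rewrite Wout ?mul0r.
  set D := \sum_w W v w * (x w - x v).
  set Q := \sum_w _ * (_ - _) ^+ 2.
  have row : \sum_w W v w = 1 by rewrite Wrow vK.
  have e1 : \sum_w W v w * x w = x v + D.
    rewrite /D; under [in RHS]eq_bigr => w _ do rewrite mulrBr.
    by rewrite sumrB -mulr_suml row; ring.
  have e2 : \sum_w W v w * x w ^+ 2 = x v ^+ 2 + 2 * x v * D + Q.
    have -> : x v ^+ 2 = \sum_w W v w * x v ^+ 2 by rewrite -mulr_suml row mul1r.
    rewrite /D /Q mulr_sumr -!big_split /=; apply: eq_bigr => w _; ring.
  (* Shifting by [2 * D] reproduces [Q], while the diagonal term alone contributes at least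
     [2 * D ^+ 2]; hence [D ^+ 2 <= Q / 2], which is the row inequality. *)
  have e3 : \sum_w W v w * (x w - x v - 2 * D) ^+ 2 = Q.
    transitivity (Q - 4 * D * D + 4 * D ^+ 2 * \sum_w W v w); last by rewrite row; ring.
    have -> : 4 * D * D = \sum_w 4 * D * (W v w * (x w - x v)) by rewrite -mulr_sumr.
    rewrite /Q [X in _ + X]mulr_sumr -sumrB -big_split /=; apply: eq_bigr => w _; ring.
  have : W v v * (4 * D ^+ 2) <= Q.
    rewrite -e3 (bigD1 v) //= (_ : x v - x v - 2 * D = - (2 * D)); last by ring.
    rewrite sqrrN exprMn (_ : 2 ^+ 2 = 4 :> R) ?lerDl; last by ring.
    by apply: sumr_ge0 => w _; rewrite mulr_ge0 ?sqr_ge0.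
  have := Wdiag v vK; rewrite e1 e2 => h1 h2.
  by have := sqr_ge0 D; nra.
apply: le_trans (ler_sum _ (fun v _ => step v)) _.
rewrite sumrB -mulr_sumr lerD2r exchange_big /=.
apply: ler_sum => w _; rewrite -mulr_suml.
under eq_bigr => v _ do rewrite Wsym.
by rewrite Wrow; case: (w \in K); rewrite ?mul1r ?mul0r ?sqr_ge0.
Qed.

(** [A] is the side of the median with more of the squared deviation from it. That deviation
    dominates the left side because [z] has mean 0. Terminals outside [A] lie at or beyond the
    median, so each [a] differs from them by at least its distance to the median. One factor 2 comes
    from taking one side, the other from the mass 1/2 sent across. *)
Lemma cut_1d (R : realFieldType) (V : finType) (K : {set V}) (z : V -> R) :
  (0 < #|K|)%N -> \sum_(w in K) z w = 0 ->
  exists A : {set V}, [/\ A \subset K, (#|A|.*2 <= #|K|)%N &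
    forall W : V -> V -> R, (forall u v, 0 <= W u v) ->
    (forall a, a \in A -> 2^-1 <= \sum_(b in K :\: A) W a b) ->
    \sum_(w in K) z w ^+ 2 <=
      4 * \sum_(a in A) \sum_(b in K :\: A) W a b * (z a - z b) ^+ 2].
Proof.
move=> K0 z0; have [eta [lo hi]] := median_exists z K0.
set L := [set w in K | _] in lo; set H := [set w in K | _] in hi.
have ge : \sum_(w in K) z w ^+ 2 <=
    \sum_(w in L) (z w - eta) ^+ 2 + \sum_(w in H) (z w - eta) ^+ 2.
  have <- : \sum_(w in K) (z w - eta) ^+ 2 =
    \sum_(w in L) (z w - eta) ^+ 2 + \sum_(w in H) (z w - eta) ^+ 2.
    rewrite (big_mkcond (mem K)) (big_mkcond (mem L)) (big_mkcond (mem H)) -big_split /=.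
    apply: eq_bigr => w _; rewrite !inE; case: (w \in K) => /=; rewrite ?addr0 //.
    by case: ltgtP => [||->]; rewrite ?addr0 ?add0r ?subrr ?expr0n.
  under [leRHS]eq_bigr => w _ do rewrite sqrrB.
  rewrite big_split sumrB /= sumrMnl -mulr_suml z0 mul0r mul0rn subr0 lerDl.
  by apply: sumr_ge0 => w _; apply: sqr_ge0.
have heavy (A : {set V}) (AK : A \subset K) :
  (forall a b, a \in A -> b \in K :\: A -> (z a - eta) ^+ 2 <= (z a - z b) ^+ 2) ->
  forall W : V -> V -> R, (forall u v, 0 <= W u v) ->
    (forall a, a \in A -> 2^-1 <= \sum_(b in K :\: A) W a b) ->
  \sum_(a in A) (z a - eta) ^+ 2 <=
    2 * \sum_(a in A) \sum_(b in K :\: A) W a b * (z a - z b) ^+ 2.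
  move=> far W W0 Wh; rewrite mulr_sumr; apply: ler_sum => a aA.
  apply: (@le_trans _ _ (2 * (\sum_(b in K :\: A) W a b * (z a - eta) ^+ 2))).
    by rewrite -mulr_suml; have := Wh a aA; have := sqr_ge0 (z a - eta); nra.
  rewrite ler_pM2l //; apply: ler_sum => b bA; rewrite ler_wpM2l //.
  exact: far.
have LK : L \subset K by apply/subsetP => w; rewrite inE => /andP[].
have HK : H \subset K by apply/subsetP => w; rewrite inE => /andP[].
have [le|le] := leP (\sum_(w in L) (z w - eta) ^+ 2) (\sum_(w in H) (z w - eta) ^+ 2).
  exists H; split=> // W W0 Wh.
  have := heavy H HK _ W W0 Wh.
  suff fa a b : a \in H -> b \in K :\: H -> (z a - eta) ^+ 2 <= (z a - z b) ^+ 2.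
    by move=> /(_ fa); lra.
  rewrite !inE => /andP[_ az] /andP[bz bK]; move: bz; rewrite bK /= -leNgt => bz.
  by nra.
exists L; split=> // W W0 Wh.
have := heavy L LK _ W W0 Wh.
suff fa a b : a \in L -> b \in K :\: L -> (z a - eta) ^+ 2 <= (z a - z b) ^+ 2.
  by move=> /(_ fa); lra.
rewrite !inE => /andP[_ az] /andP[bz bK]; move: bz; rewrite bK /= -leNgt => bz.
by nra.
Qed.

(* Averaging over random signs yields a projection that keeps half of the
   potential and stretches no difference by more than a logarithmic factor. *)
Lemma good_cut (R : realType) (V : finType) (K : {set V}) (X : V -> V -> R) :
  (0 < #|K|)%N -> (forall u, \sum_(w in K) X w u = 0) ->
  exists A : {set V}, [/\ A \subset K, (#|A|.*2 <= #|K|)%N &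
    forall W : V -> V -> R, (forall u v, 0 <= W u v) ->
    (forall a, a \in A -> 2^-1 <= \sum_(b in K :\: A) W a b) ->
    \sum_(w in K) \sum_u X w u ^+ 2 <= 72 * ln (2 * #|V|%:R ^+ 3) *
      \sum_v \sum_w W v w * \sum_u (X v u - X w u) ^+ 2].
Proof.
move=> K0 X0; set Phi := \sum_(w in K) _; set N : R := #|V|%:R.
have KV : #|K|%:R <= N by rewrite ler_nat max_card.
have K1 : 1 <= #|K|%:R :> R by rewrite ler1n.
have N1 : 1 <= N by apply: le_trans KV.
have L0 : 0 < ln (2 * N ^+ 3).
  have N3 : 1 <= N ^+ 3 by rewrite exprn_ege1.
  by apply: ln_gt0; lra.
set L := ln _ in L0 *.
have Phi0 : 0 <= Phi by apply: sumr_ge0 => w _; apply: sumr_ge0 => u _; apply: sqr_ge0.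
have [Phi00|Phin0] := eqVneq Phi 0.
  exists finset.set0; split; rewrite ?sub0set ?cards0 // => W W0 _.
  rewrite Phi00 !mulr_ge0 ?(ltW L0) //.
  apply: sumr_ge0 => v _; apply: sumr_ge0 => w _; rewrite mulr_ge0 //.
  by apply: sumr_ge0 => u _; apply: sqr_ge0.
have Phip : 0 < Phi by rewrite lt_neqAle eq_sym Phin0.
(* A bound [expR (t * y) <= 2 * N ^ 3 * expR (2 * t ^ 2)] gives [y <= L / t + 2 * t]; this choice
   balances the two terms and yields [3 * t]. *)
pose t := Num.sqrt L.
have tt : t ^+ 2 = L by rewrite sqr_sqrtr // ltW.
have t0 : 0 < t by rewrite sqrtr_gt0.
pose n a b := Num.sqrt (\sum_u (X a u - X b u) ^+ 2).
have ss0 a b : 0 <= \sum_u (X a u - X b u) ^+ 2.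
  by apply: sumr_ge0 => u _; apply: sqr_ge0.
have nn a b : n a b ^+ 2 = \sum_u (X a u - X b u) ^+ 2 by rewrite sqr_sqrtr.
pose Y a b u := (X a u - X b u) / n a b.
have Y1 a b : \sum_u Y a b u ^+ 2 <= 1.
  rewrite /Y; under eq_bigr => u _ do rewrite exprMn.
  rewrite -mulr_suml -nn; have [->|n0] := eqVneq (n a b) 0.
    by rewrite expr0n mul0r.
  by rewrite -exprMn divff ?expr1n.
pose z r w := signed_sum (X w) r.
pose E r := \sum_(a in K) \sum_(b in K) expR (t * signed_sum (Y a b) r).
have zz r a b : z r a - z r b = n a b * signed_sum (Y a b) r.
  rewrite /z /signed_sum mulr_sumr -sumrB; apply: eq_bigr => u _.
  rewrite /Y -mulrBr; have [n0|n0] := eqVneq (n a b) 0; last by field.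
  have /eqP : \sum_u (X a u - X b u) ^+ 2 = 0 by rewrite -nn n0 expr0n.
  rewrite psumr_eq0 => [/allP/(_ u)|i _]; last exact: sqr_ge0.
  by rewrite mem_index_enum sqrf_eq0 => /(_ isT)/eqP ->; rewrite n0 !mulr0 mul0r.
pose e2 := expR (2 * t ^+ 2).
have e20 : 0 < e2 by apply: expR_gt0.
(* [E] penalizes long projections of the normalized differences. Over all [r], the squared sum has
   mean [Phi] and [E r] has mean at most [N ^+ 2 * e2]; this weight makes the mean penalty at most
   [Phi / 2], so a single [r] has a large squared sum and a small [E r]. *)
pose lam := Phi / (2 * N ^+ 2 * e2).
have N2 : 0 < N ^+ 2 by rewrite exprn_gt0 //; lra.
have lam0 : 0 < lam by apply: divr_gt0 => //; do 2?apply: mulr_gt0 => //; lra.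
pose hPhi := Phi / 2.
have [r rP] : exists r : {ffun V -> bool},
    hPhi <= \sum_(w in K) z r w ^+ 2 - lam * E r.
  apply: contrapT => /forallNP bad.
  have : \sum_(r : {ffun V -> bool}) (\sum_(w in K) z r w ^+ 2 - lam * E r) <
         \sum_(r : {ffun V -> bool}) hPhi.
    apply: ltr_sum.
      by apply/hasP; exists [ffun=> true]; rewrite ?mem_index_enum.
    by move=> r _; have /negP := bad r; rewrite -ltNge.
  apply/negP; rewrite -leNgt sumrB exchange_big /= -[X in _ <= _ - X]mulr_sumr.
  under [X in _ <= X - _]eq_bigr => w _ do rewrite signed_sum_sqr.
  rewrite -[X in _ <= X - _]mulr_sumr -/Phi sumr_const card_ffun card_bool -[leLHS]mulr_natl natrX.
  have : \sum_r E r <= 2 ^+ #|V| * (N ^+ 2 * e2).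
    rewrite exchange_big /=.
    apply: (@le_trans _ _ (\sum_(a in K) \sum_(b in K) 2 ^+ #|V| * e2)).
      apply: ler_sum => a _; rewrite exchange_big /=; apply: ler_sum => b _.
      apply: le_trans (signed_sum_expR _ _) _; rewrite ler_pM2l ?exprn_gt0 // ler_expR.
      by rewrite -[leRHS]mulr1 ler_wpM2l ?Y1 // mulr_ge0 ?sqr_ge0.
    rewrite !sumr_const -mulrnA -[leLHS]mulr_natl mulrCA ler_pM2l ?exprn_gt0 //.
    by rewrite ler_wpM2r ?(ltW e20) // natrM expr2 ler_pM ?ler0n.
  rewrite -(ler_pM2l lam0) => /le_trans h.
  have : lam * (2 ^+ #|V| * (N ^+ 2 * e2)) = 2 ^+ #|V| * hPhi.
    have gen (P a b : R) : a != 0 -> b != 0 ->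
        Phi / (2 * a * b) * (P * (a * b)) = P * (Phi / 2).
      by move=> a0 b0; field; rewrite a0 b0.
    by apply: gen; rewrite gt_eqF.
  move=> e; have := h _ (lexx _); rewrite e.
  have : 2 ^+ #|V| * Phi = 2 * (2 ^+ #|V| * hPhi) by rewrite /hPhi; field.
  by lra.
rewrite /hPhi in rP.
have E0 : 0 <= E r by do 2 apply: sumr_ge0 => ? _; apply: expR_ge0.
have zN : \sum_(w in K) z r w ^+ 2 <= N * Phi.
  rewrite mulr_sumr; apply: ler_sum => w _; apply: le_trans (sqr_sum_le _) _.
  rewrite ler_wpM2l ?ler0n //; apply: ler_sum => u _.
  by rewrite exprMn sqrr_sign mul1r.
have zPhi : Phi <= 2 * \sum_(w in K) z r w ^+ 2.
  by have := mulr_ge0 (ltW lam0) E0; lra.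
have EN : E r <= 2 * N ^+ 3 * e2.
  have : lam * E r <= N * Phi by lra.
  rewrite -ler_pdivlMl // => /le_trans; apply.
  rewrite /lam invf_div le_eqVlt; apply/orP; left; apply/eqP.
  have gen (a b c : R) : c != 0 -> 2 * a ^+ 2 * b / c * (a * c) = 2 * a ^+ 3 * b.
    by move=> c0; field.
  exact: gen.
have ybound a b : a \in K -> b \in K -> signed_sum (Y a b) r <= 3 * t.
  move=> aK bK; rewrite -(ler_pM2l t0).
  have -> : t * (3 * t) = L + 2 * t ^+ 2 by rewrite -tt; ring.
  rewrite -ler_expR expRD lnK ?posrE; last by rewrite mulr_gt0 ?exprn_gt0 //; lra.
  apply: le_trans EN; rewrite /E (bigD1 a) //= (bigD1 b) //= -addrA lerDl.
  by apply: addr_ge0; do ?[apply: sumr_ge0 => ? _]; apply: expR_ge0.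
have zbound a b : a \in K -> b \in K ->
    (z r a - z r b) ^+ 2 <= 9 * L * \sum_u (X a u - X b u) ^+ 2.
  move=> aK bK; rewrite -nn.
  have n0 : 0 <= n a b by apply: sqrtr_ge0.
  have nba : n b a = n a b.
    by congr Num.sqrt; apply: eq_bigr => u _; rewrite -sqrrN opprB.
  have h1 : z r a - z r b <= n a b * (3 * t) by rewrite zz ler_wpM2l ?ybound.
  have h2 : z r b - z r a <= n a b * (3 * t) by rewrite zz nba ler_wpM2l ?ybound.
  have -> : 9 * L * n a b ^+ 2 = (n a b * (3 * t)) ^+ 2 by rewrite -tt; ring.
  by rewrite -subr_ge0 subr_sqr mulr_ge0 //; lra.
have zsum : \sum_(w in K) z r w = 0.
  rewrite exchange_big /= big1 // => u _.
  by rewrite -mulr_sumr X0 mulr0.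
have [A [AK sA cutA]] := cut_1d K0 zsum.
exists A; split=> // W W0 Wh; apply: le_trans zPhi _.
have := cutA W W0 Wh.
have : \sum_(a in A) \sum_(b in K :\: A) W a b * (z r a - z r b) ^+ 2 <=
  9 * L * \sum_v \sum_w W v w * \sum_u (X v u - X w u) ^+ 2.
  rewrite mulr_sumr big_mkcond /=; apply: ler_sum => a _.
  have S0 b : 0 <= 9 * L * (W a b * \sum_u (X a u - X b u) ^+ 2).
    by rewrite !mulr_ge0 ?(ltW L0).
  case: ifP => aA; last by rewrite mulr_sumr sumr_ge0.
  rewrite mulr_sumr big_mkcond /=; apply: ler_sum => b _.
  case: ifP => bA; last exact: S0.
  have bK : b \in K by move: bA; rewrite inE => /andP[].
  by rewrite [leRHS]mulrCA ler_wpM2l // zbound // (subsetP AK).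
by lra.
Qed.

(** The row of [w] says how the mass now at [w] is distributed over the origins [u], relative to
    uniform. These rows are the points that a bisection separates and that a stage averages. *)
Definition deviation (R : numFieldType) (G : sgraph) (K : {set G})
    (P : G -> G -> R) (w u : G) : R :=
  ((u \in K) && (w \in K))%:R * (P u w - #|K|%:R^-1).

(** [P'] is the product of [P] with the stage matrix, whose symmetry turns this into an averaging of
    the rows of [deviation]. [lazy_contraction], applied to each origin, removes half of the energy,
    and [good_cut] bounds the potential by [72 * ln (2 * #|G| ^ 3)] times the energy: hence 144. *)
Lemma game_step (R : realType) (G : sgraph) (K : {set G}) (T0 T q Q : nat)
    (P : G -> G -> R) :
  (0 < #|K|)%N -> (0 < q)%N -> cut_condition K T q Q ->
  routing T0 (Q%:R / q%:R) P ->
  (forall v, \sum_u P u v = (v \in K)%:R) ->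
  (forall u, \sum_v P u v = (u \in K)%:R) ->
  exists P' : G -> G -> R,
    [/\ routing (T0 + T) (Q%:R / q%:R) P',
        forall v, \sum_u P' u v = (v \in K)%:R,
        forall u, \sum_v P' u v = (u \in K)%:R &
        \sum_w \sum_u deviation K P' w u ^+ 2 <=
          (1 - (144 * ln (2 * #|G|%:R ^+ 3))^-1) *
          \sum_w \sum_u deviation K P w u ^+ 2].
Proof.
move=> K0 q0 cut rP Pcol Prow.
have kR : #|K|%:R != 0 :> R by rewrite pnatr_eq0 -lt0n.
have P0 u v : 0 <= P u v := routing_ge0 u v rP.
have PoutK u w : w \notin K -> P u w = 0.
  move=> wK; apply/eqP; rewrite eq_le P0 andbT.
  by have := Pcol w; rewrite (negbTE wK) mulr0n => <-; rewrite (bigD1 u) //= lerDl sumr_ge0.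
set X := deviation K P.
have XK w u : w \notin K -> X w u = 0 by move=> /negbTE wK; rewrite /X /deviation wK andbF mul0r.
have X0 u : \sum_(w in K) X w u = 0.
  rewrite /X /deviation; case: (boolP (u \in K)) => uK /=; last first.
    by rewrite big1 // => w _; rewrite mul0r.
  under eq_bigr => w -> do rewrite mul1r.
  rewrite sumrB sumr_const -[_ *+ _]mulr_natl divff //.
  have -> : \sum_(w in K) P u w = \sum_w P u w.
    rewrite [RHS](bigID (mem K)) /= [X in _ + X]big1 ?addr0 // => w; exact: PoutK.
  by rewrite Prow uK subrr.
have [A [AK sA cutA]] := good_cut K0 X0.
have [W [rW Wsym Wrow Wdiag Wcut]] := cut_stage R AK sA q0 cut.
have W0 u v : 0 <= W u v := routing_ge0 u v rW.
have WoutK v w : w \notin K -> W v w = 0.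
  move=> wK; apply/eqP; rewrite eq_le W0 andbT Wsym.
  by have := Wrow w; rewrite (negbTE wK) mulr0n => <-; rewrite (bigD1 v) //= lerDl sumr_ge0.
pose P' u v := \sum_w P u w * W w v.
have main : \sum_w \sum_u deviation K P' w u ^+ 2 <= \sum_w \sum_u X w u ^+ 2 -
    2^-1 * \sum_v \sum_w W v w * \sum_u (X v u - X w u) ^+ 2.
  have e1 v u : deviation K P' v u ^+ 2 <= (\sum_w W v w * X w u) ^+ 2.
    rewrite {1}/deviation; case: (boolP (u \in K)) => uK /=; last first.
      by rewrite mul0r expr0n /= sqr_ge0.
    case: (boolP (v \in K)) => vK; last by rewrite mul0r expr0n /= sqr_ge0.
    rewrite mul1r le_eqVlt; apply/orP; left; apply/eqP; congr (_ ^+ 2).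
    have -> : #|K|%:R^-1 = \sum_w W v w * #|K|%:R^-1 :> R by rewrite -mulr_suml Wrow vK mul1r.
    rewrite /P' -sumrB; apply: eq_bigr => w _; rewrite /X /deviation uK /=.
    case: (boolP (w \in K)) => wK; first by rewrite Wsym mul1r; ring.
    by rewrite Wsym WoutK ?mul0r ?mulr0 ?subr0.
  apply: (@le_trans _ _ (\sum_u \sum_v (\sum_w W v w * X w u) ^+ 2)).
    by rewrite exchange_big; apply: ler_sum => u _; apply: ler_sum => v _.
  apply: le_trans (ler_sum _ (fun u _ => lazy_contraction (X ^~ u) W0 Wsym Wrow Wdiag)) _.
  rewrite sumrB exchange_big -mulr_sumr lerD2l lerN2 ler_pM2l ?invr_gt0 //=.
  rewrite [leRHS]exchange_big /= le_eqVlt; apply/orP; left; apply/eqP.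
  apply: eq_bigr => v _; rewrite [RHS]exchange_big /=; apply: eq_bigr => w _.
  by rewrite mulr_sumr.
exists P'; split.
- exact: routing_cat rP rW Pcol Wrow.
- move=> v; rewrite exchange_big /=.
  under eq_bigr => w _ do rewrite -mulr_suml Pcol mulrC.
  rewrite (sum_mulb (mem K)) /= -Wrow [RHS](bigID (mem K)) /= [X in _ = _ + X]big1.
    by rewrite addr0; apply: eq_bigr => w _; rewrite Wsym.
  by move=> w; apply: WoutK.
- move=> u; rewrite exchange_big /=.
  under eq_bigr => w _ do rewrite -mulr_sumr Wrow.
  rewrite (sum_mulb (mem K)) /= -Prow [RHS](bigID (mem K)) /= [X in _ = _ + X]big1 ?addr0 //.
  by move=> w; apply: PoutK.
apply: le_trans main _; rewrite mulrBl mul1r lerD2l lerN2.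
have N1 : 1 <= #|G|%:R :> R.
  by rewrite ler1n (leq_trans K0) // max_card.
have L0 : 0 < ln (2 * #|G|%:R ^+ 3 : R).
  have N3 : 1 <= #|G|%:R ^+ 3 :> R by rewrite exprn_ege1.
  by apply: ln_gt0; lra.
rewrite -ler_pdivlMl ?invr_gt0 ?mulr_gt0 // invrK mulrA.
have -> : \sum_w \sum_u X w u ^+ 2 = \sum_(w in K) \sum_u X w u ^+ 2.
  rewrite [LHS](bigID (mem K)) /= [X in _ + X]big1 ?addr0 // => w wK.
  by rewrite big1 // => u _; rewrite XK // expr0n.
apply: le_trans (cutA W W0 Wcut) _; rewrite le_eqVlt; apply/orP; left; apply/eqP.
by congr (_ * _); field.
Qed.

(** [144 * (3 * l + 1)] stages shrink the potential by a factor e, because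
    [ln (2 * #|G| ^ 3) <= 3 * l + 1] when [#|G| <= 2 ^ l]. Repeating this [3 * l + 3] times brings
    the initial [2 * #|K|] below the inverse square of [2 * #|K|], since
    [(2 * #|K|) ^ 3 <= 2 ^ (3 * l + 3)]. *)
Definition mixing_steps (l : nat) : nat := 144 * (3 * l + 1) * (3 * l + 3).

Lemma pow2_le_expR (R : realType) (m : nat) : 2 ^+ m <= expR m%:R :> R.
Proof.
rewrite -[m%:R]mulr1 expRM_natl lerXn2r ?nnegrE ?expR_ge0 //.
by have := @expR_ge1Dx R 1; lra.
Qed.

Lemma mixing (R : realType) (G : sgraph) (K : {set G}) (T q Q l : nat) :
  (0 < #|K|)%N -> (0 < q)%N -> cut_condition K T q Q -> (#|G| <= 2 ^ l)%N ->
  exists P : G -> G -> R, routing (mixing_steps l * T) (Q%:R / q%:R) P /\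
    forall u v, u \in K -> v \in K -> (2 * #|K|%:R)^-1 <= P u v.
Proof.
move=> K0 q0 cut Gl.
have k1 : 1 <= #|K|%:R :> R by rewrite ler1n.
have kR : #|K|%:R != 0 :> R by rewrite pnatr_eq0 -lt0n.
have kG : (#|K| <= #|G|)%N by apply: max_card.
have kl : #|K|%:R <= 2 ^+ l :> R by rewrite -natrX ler_nat (leq_trans kG).
pose s : R := 144 * (3 * l + 1)%:R.
have s0 : 0 < s by rewrite mulr_gt0 // ltr0n addn1.
have sL : 1 - (144 * ln (2 * #|G|%:R ^+ 3))^-1 <= 1 - s^-1 :> R.
  have N1 : 1 <= #|G|%:R :> R by rewrite ler1n (leq_trans K0).
  have N3 : 1 <= #|G|%:R ^+ 3 :> R by rewrite exprn_ege1.
  have L0 : 0 < ln (2 * #|G|%:R ^+ 3 : R) by apply: ln_gt0; lra.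
  rewrite lerD2l lerN2 lef_pV2 ?posrE ?mulr_gt0 // ler_pM2l //.
  rewrite -ler_expR lnK ?posrE; last by lra.
  apply: le_trans (pow2_le_expR _ _).
  have -> : 2 ^+ (3 * l + 1) = 2 * (2 ^+ l) ^+ 3 :> R by rewrite addn1 exprS mulnC exprM.
  rewrite ler_pM2l // lerXn2r ?nnegrE ?exprn_ge0 //.
  by rewrite -natrX ler_nat.
have iter j : exists P : G -> G -> R,
    [/\ routing (j * T) (Q%:R / q%:R) P,
        forall v, \sum_u P u v = (v \in K)%:R,
        forall u, \sum_v P u v = (u \in K)%:R &
        \sum_w \sum_u deviation K P w u ^+ 2 <= (1 - s^-1) ^+ j * (2 * #|K|%:R)].
  have s1 : 0 <= 1 - s^-1.
    rewrite subr_ge0 invf_le1 // /s; have : 1 <= (3 * l + 1)%:R :> R by rewrite ler1n addn1.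
    by lra.
  elim: j => [|j [P [rP Pc Pr Pd]]].
    exists (fun u v => ((u == v) && (u \in K))%:R); split.
    - exact: routing_stay.
    - move=> v; rewrite (bigD1 v) //= eqxx big1 ?addr0 // => u /negbTE uv.
      by rewrite uv.
    - move=> u; rewrite (bigD1 u) //= eqxx big1 ?addr0 // => v /negbTE uv.
      by rewrite eq_sym uv.
    rewrite mul1r.
    apply: (@le_trans _ _ (\sum_w \sum_u ((w \in K)%:R * (u == w)%:R +
       (w \in K)%:R * ((u \in K)%:R * #|K|%:R^-1 ^+ 2)))).
      apply: ler_sum => w _; apply: ler_sum => u _; rewrite /deviation.
      have i1 : #|K|%:R^-1 <= 1 :> R by rewrite invf_le1 ?(lt_le_trans _ k1).
      have i0 : 0 <= #|K|%:R^-1 :> R by rewrite invr_ge0.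
      case: (u \in K); case: (w \in K) => /=; case: (u == w) => /=;
        rewrite ?mulr1n ?mulr0n; nra.
    under eq_bigr => w _ do rewrite big_split -!mulr_sumr -mulr_suml /=.
    rewrite big_split -!mulr_suml /=.
    have c : \sum_(u : G) (u \in K)%:R = #|K|%:R :> R.
      rewrite (eq_bigr (fun u => if u \in K then 1 else 0)) => [|u _]; last by case: (u \in K).
      by rewrite -big_mkcond sumr_const.
    rewrite c (eq_bigr (fun w => (w \in K)%:R)) ?c; last first.
      by move=> w _; rewrite (bigD1 w) //= eqxx big1 ?addr0 ?mulr1 // => u /negbTE ->.
    have : #|K|%:R * (#|K|%:R * #|K|%:R^-1 ^+ 2) = 1 :> R by field.
    by lra.
  have [P' [rP' Pc' Pr' Pd']] := game_step K0 q0 cut rP Pc Pr.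
  exists P'; split=> //; first by rewrite mulSnr.
  have -> : (1 - s^-1) ^+ j.+1 * (2 * #|K|%:R) =
      (1 - s^-1) * ((1 - s^-1) ^+ j * (2 * #|K|%:R)) by rewrite exprS -mulrA.
  apply: le_trans Pd' _.
  apply: le_trans (ler_wpM2r _ sL) _; last by rewrite ler_wpM2l.
  by do 2 apply: sumr_ge0 => ? _; apply: sqr_ge0.
have [P [rP _ _ Pd]] := iter (mixing_steps l).
exists P; split=> // u v uK vK.
have small : (1 - s^-1) ^+ mixing_steps l * (2 * #|K|%:R) <= ((2 * #|K|%:R)^-1) ^+ 2.
  have e : (1 - s^-1) ^+ mixing_steps l <= (2 ^+ (3 * l + 3))^-1.
    apply: (@le_trans _ _ (expR (- s^-1) ^+ mixing_steps l)).
      rewrite lerXn2r ?nnegrE ?expR_ge0 ?expR_ge1Dx // subr_ge0 invf_le1 // /s.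
      by have : 1 <= (3 * l + 1)%:R :> R; [rewrite ler1n addn1 | lra].
    rewrite -expRM_natl /mixing_steps mulrN expRN lef_pV2 ?posrE ?expR_gt0 ?exprn_gt0 //.
    rewrite natrM natrM -/s mulrAC divff ?mul1r ?gt_eqF //.
    exact: pow2_le_expR.
  have k2 : 0 < 2 * #|K|%:R :> R by lra.
  apply: le_trans (ler_wpM2r (ltW k2) e) _.
  rewrite exprVn ler_pdivrMl ?exprn_gt0 // -ler_pdivrMr ?invr_gt0 ?exprn_gt0 //.
  rewrite invrK -exprS.
  have -> : 2 ^+ (3 * l + 3) = (2 * 2 ^+ l) ^+ 3 :> R.
    by rewrite -[in RHS]exprS -exprM; congr (_ ^+ _); lia.
  by rewrite lerXn2r ?nnegrE ?mulr_ge0 ?exprn_ge0 ?ler0n // ler_pM2l.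
have : deviation K P v u ^+ 2 <= ((2 * #|K|%:R)^-1) ^+ 2.
  apply: le_trans small; apply: le_trans Pd; rewrite (bigD1 v) //= (bigD1 u) //= -addrA lerDl.
  by apply: addr_ge0; do ?[apply: sumr_ge0 => ? _]; apply: sqr_ge0.
rewrite /deviation uK vK mul1r.
have -> : #|K|%:R^-1 = 2 * (2 * #|K|%:R)^-1 :> R by field.
have i0 : 0 < (2 * #|K|%:R)^-1 :> R by rewrite invr_gt0; lra.
move: (_^-1) i0 => i i0; nra.
Qed.

(** * Thinning and slowing down routings; conversion to multicommodity flows *)

(** Every walk from [u] to [v] is scaled by [W' u v / W u v], at most [lam]. This is how a routing
    that is only bounded below becomes exactly uniform. *)
Lemma routing_thin (R : realFieldType) (G : sgraph) T (c lam : R) (W W' : G -> G -> R) :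
  0 <= lam -> (forall u v, 0 <= W' u v <= lam * W u v) ->
  routing T c W -> routing T (lam * c) W'.
Proof.
move=> lam0 W'le [I [wt [pos [w0 wm wl]]]].
pose r i := W' (pos i 0%N) (pos i T) / W (pos i 0%N) (pos i T).
have W0 u v : 0 <= W u v by rewrite -wm sumr_ge0.
have r0 i : 0 <= r i by rewrite /r divr_ge0 //; case/andP: (W'le (pos i 0%N) (pos i T)).
have rle i : r i <= lam.
  rewrite /r; have /andP[W'0 le] := W'le (pos i 0%N) (pos i T).
  have [->|Wn] := eqVneq (W (pos i 0%N) (pos i T)) 0; first by rewrite invr0 mulr0.
  by rewrite ler_pdivrMr // lt_neqAle eq_sym Wn W0.
exists I, (fun i => wt i * r i), pos; split.
- by move=> i; rewrite mulr_ge0.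
- move=> u v; rewrite (eq_bigr (fun i => wt i * (W' u v / W u v))); last first.
    by move=> i /andP[/eqP <- /eqP <-].
  rewrite -mulr_suml wm; have [e|Wn] := eqVneq (W u v) 0; last by rewrite mulrC divfK.
  have := W'le u v; rewrite e mulr0 => le; rewrite mul0r.
  by apply/eqP; rewrite eq_sym eq_le andbC.
- move=> t x y tT xy; rewrite mulrCA; apply: le_trans (ler_wpM2l lam0 (wl t x y tT xy)).
  rewrite /wload mulr_sumr; apply: ler_sum => i _.
  by rewrite mulrC ler_wpM2r.
Qed.

(** Every round becomes [D] rounds and every walk splits into [D] equal copies, copy [j] moving in
    round [j] of each block, so only one copy at a time loads the edge. *)
Lemma routing_dilate (R : realFieldType) (G : sgraph) T (D : nat) (c : R)
    (W : G -> G -> R) :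
  (0 < D)%N -> routing T c W -> routing (T * D) (c / D%:R) W.
Proof.
move=> D0 [I [wt [pos [w0 wm wl]]]].
have DR : D%:R != 0 :> R by rewrite pnatr_eq0 -lt0n.
pose pos' (p : I * 'I_D) t := pos p.1 (t %/ D + (p.2 < t %% D))%N.
have posS p t : pos' p t.+1 = pos p.1 (t %/ D + (p.2 <= t %% D))%N.
  rewrite /pos'; congr pos.
  have tE := divn_eq t D; set q := (t %/ D)%N in tE *; set j := (t %% D)%N in tE *.
  have jD : (j < D)%N by rewrite ltn_mod.
  have [jD1|jD1] := ltnP j.+1 D.
    by rewrite {1 2}tE -addnS divnMDl // modnMDl modn_small // divn_small // addn0 ltnS.
  have e : j.+1 = D by apply/eqP; rewrite eqn_leq jD jD1.
  rewrite {1 2}tE -addnS e -mulSnr mulnK // modnMl ltn0 addn0.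
  have -> : (p.2 <= j)%N by rewrite -ltnS e.
  by rewrite addn1.
exists (I * 'I_D)%type, (fun p => wt p.1 / D%:R), pos'; split.
- by move=> p; rewrite divr_ge0.
- move=> u v; rewrite -wm.
  rewrite (eq_bigl (fun p : I * 'I_D => (pos p.1 0%N == u) && (pos p.1 T == v))).
    rewrite (sum_pair_fst (fun i => (pos i 0%N == u) && (pos i T == v))) /=.
    apply: eq_bigr => i _; rewrite sumr_const card_ord -[LHS]mulr_natl mulrC.
    by rewrite divfK.
  by move=> p; rewrite /pos' div0n mod0n mulnK // modnMl ltn0 !addn0.
move=> t x y tT xy.
have qT : (t %/ D < T)%N by rewrite ltn_divLR.
have jD : (t %% D < D)%N by rewrite ltn_mod.
rewrite mulrA; apply: le_trans (ler_wpM2r _ (wl _ x y qT xy)); last by rewrite invr_ge0.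
rewrite /wload (eq_bigl (fun p : I * 'I_D => ((pos p.1 (t %/ D)%N == x) &&
    (pos p.1 (t %/ D)%N.+1 == y)) && (p.2 == Ordinal jD))).
  rewrite -(pair_big (fun i => (pos i (t %/ D)%N == x) && (pos i (t %/ D)%N.+1 == y))
     (pred1 (Ordinal jD)) (fun i _ => wt i / D%:R)) /=.
  by under eq_bigr => i _ do rewrite big_pred1_eq; rewrite -mulr_suml.
move=> p; rewrite posS /pos' -(inj_eq val_inj) /=.
case: ltngtP => _; rewrite ?addn1 ?addn0 ?andbT ?andbF //;
  by apply/negP => /andP[/eqP -> e]; rewrite e in xy.
Qed.

Lemma routing_mcf (R : realType) (G : sgraph) (K : {set G}) (T : nat) (n' c : R)
    (W : G -> G -> R) :
  (0 < T)%N -> c <= 1 ->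
  (forall u v, u \in K -> v \in K -> W u v = n' / #|K|%:R) ->
  routing T c W -> mcf_feasible K n' T.
Proof.
move=> T0 c1 WK [I [wt [pos [w0 wm wl]]]].
pose on i (a : G * 'I_T.+1) := pos i a.2 == a.1.
pose phi u v (a b : G * 'I_T.+1) := \sum_(i | (pos i 0%N == u) && (pos i T == v))
   wt i * ((b.2 == a.2.+1 :> nat) && (on i a && on i b))%:R.
exists phi; split.
  move=> u v uK vK; split.
    by move=> a b; apply: sumr_ge0 => i _; rewrite mulr_ge0.
  move=> a; rewrite -(WK u v) // -wm !mulr_sumr /phi exchange_big [X in _ - X]exchange_big /=.
  rewrite -!sumrB; apply: eq_bigr => i /andP[/eqP i0 /eqP iT].
  rewrite -!mulr_sumr -mulrBr -mulrBl mulrC; congr (_ * _).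
  have -> : \sum_(b : G * 'I_T.+1) ((b.2 == a.2.+1 :> nat) && (on i a && on i b))%:R
      = ((a.2 < T)%N && on i a)%:R :> R.
    have [aT|aT] := ltnP a.2 T; last first.
      apply: big1 => b _; have := ltn_ord b.2; rewrite ltnS => bT.
      by rewrite ltn_eqF // ltnS (leq_trans bT).
    pose b0 : G * 'I_T.+1 := (pos i a.2.+1, Ordinal (aT : a.2.+1 < T.+1)%N).
    rewrite (bigD1 b0) //= eqxx /on eqxx andbT big1 ?addr0 // => -[x j] bn.
    case: eqP => //= e; case: eqP => //= e1; case: eqP => // e2; case/eqP: bn.
    by rewrite /b0 -e2 e; congr (_, _); apply: val_inj.
  have -> : \sum_(b : G * 'I_T.+1) ((a.2 == b.2.+1 :> nat) && (on i b && on i a))%:R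
      = ((0 < a.2)%N && on i a)%:R :> R.
    have [a0|a0] := posnP a.2; first by rewrite a0 big1.
    have aT : (a.2.-1 < T.+1)%N by rewrite (leq_ltn_trans (leq_pred _)).
    pose b0 : G * 'I_T.+1 := (pos i a.2.-1, Ordinal aT).
    rewrite (bigD1 b0) //= prednK // eqxx /on eqxx big1 ?addr0 // => -[x j] bn.
    case: eqP => //= e; case: eqP => //= e1; case/eqP: bn.
    by rewrite /b0 -e1; congr (_, _); [rewrite e | apply: val_inj; rewrite /= e].
  have -> : (a == (u, ord0)) = (a.2 == 0%N :> nat) && on i a.
    case: a => x j; rewrite /on xpair_eqE andbC /= -(inj_eq val_inj) /=.
    by case: eqP => //= ->; rewrite i0 eq_sym.
  have -> : (a == (v, ord_max)) = (a.2 == T :> nat) && on i a.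
    case: a => x j; rewrite /on xpair_eqE andbC /= -(inj_eq val_inj) /=.
    by case: eqP => //= ->; rewrite iT eq_sym.
  case: (on i a); rewrite ?andbF ?andbT //.
  have := ltn_ord a.2; rewrite ltnS leq_eqVlt => /orP[/eqP ->|aT].
    by rewrite eqxx ltnn T0 gtn_eqF.
  by rewrite aT (ltn_eqF aT) lt0n; case: eqP; rewrite ?subrr ?subr0.
move=> [x i] [y j]; rewrite /timed_cap /=.
case: eqP => [ji|ji]; last first.
  by rewrite lee_fin /phi big1 // => u _; rewrite big1 // => v _; rewrite big1 // => p _; rewrite /= (introF eqP ji) mulr0.
have [//|xy] := eqVneq x y; first by rewrite leey.
have iT : (i < T)%N by have := ltn_ord j; rewrite ji.
have le1 : \sum_(u in K) \sum_(v in K) phi u v (x, i) (y, j) <= (edge x y)%:R.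
  apply: (@le_trans _ _ (\sum_u \sum_v phi u v (x, i) (y, j))).
    have p0 u v : 0 <= phi u v (x, i) (y, j).
      by apply: sumr_ge0 => p _; rewrite mulr_ge0.
    rewrite big_mkcond /=; apply: ler_sum => u _; case: ifP => _; last exact: sumr_ge0.
    by rewrite big_mkcond /=; apply: ler_sum => v _; case: ifP.
  apply: le_trans (_ : wload wt pos i x y <= _).
    rewrite le_eqVlt; apply/orP; left; apply/eqP.
    rewrite /wload -[RHS]sum_mulb [RHS](partition_big (fun p => pos p 0%N) xpredT) //=.
    apply: eq_bigr => u _; rewrite [RHS](partition_big (fun p => pos p T) xpredT) //=.
    by apply: eq_bigr => v _; apply: eq_bigr => p _; rewrite /on /= ji eqxx.
  apply: le_trans (wl i x y iT xy) _.
  by rewrite ler_piMr.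
by move: le1; case: ifP => exy le1; rewrite lee_fin.
Qed.

(** Mixing puts at least [1 / (2 * #|K|)] on every pair, so scaling by [2 * n'] and thinning gives
    exactly [n' / #|K|] at congestion [2 * n' * Q / q]; the extra factor [D] of time brings this
    down to unit capacity. *)
Lemma cut_mcf (R : realType) (G : sgraph) (K : {set G}) (T q Q l D : nat) (n' : R) :
  (0 < #|K|)%N -> (0 < q)%N -> (0 < T)%N -> cut_condition K T q Q ->
  (#|G| <= 2 ^ l)%N -> 0 <= n' -> (0 < D)%N -> 2 * n' * Q%:R <= q%:R * D%:R ->
  mcf_feasible K n' (mixing_steps l * T * D).
Proof.
move=> K0 q0 T0 cut Gl n'0 D0 le.
have [P [rP Pge]] := mixing R K0 q0 cut Gl.
pose W u v : R := (u \in K)%:R * (v \in K)%:R * (n' / #|K|%:R).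
have kR : 0 < #|K|%:R :> R by rewrite ltr0n.
have qR : 0 < q%:R :> R by rewrite ltr0n.
have DR : 0 < D%:R :> R by rewrite ltr0n.
have rW : routing (mixing_steps l * T) (2 * n' * (Q%:R / q%:R)) W.
  apply: (routing_thin _ _ rP); first by lra.
  move=> u v; have P0 := routing_ge0 u v rP; rewrite /W.
  case: (boolP (u \in K)) => uK; last by rewrite !mul0r lexx !mulr_ge0.
  case: (boolP (v \in K)) => vK; last by rewrite mulr0 mul0r lexx !mulr_ge0.
  rewrite !mul1r divr_ge0 //= ?(ltW kR) //.
  have := ler_wpM2l (_ : 0 <= 2 * n') (Pge u v uK vK); rewrite mulr_ge0 // => /(_ isT).
  by apply: le_trans; rewrite invfM mulrACA divff ?mul1r.
apply: (routing_mcf _ _ _ (routing_dilate D0 rW)).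
- by rewrite /mixing_steps !muln_gt0 T0 D0 !addn_gt0 !orbT.
- by rewrite ler_pdivrMr // mul1r mulrA ler_pdivrMr // [leRHS]mulrC.
- by move=> u v uK vK; rewrite /W uK vK !mul1r.
Qed.

(** * Two-party lower bounds across timed cuts *)

Lemma mono_sub (T : finType) (S : nat -> {set T}) :
  (forall i, S i \subset S i.+1) -> forall i j, (i <= j)%N -> S i \subset S j.
Proof.
move=> mono i j; elim: j => [|j IH]; first by rewrite leqn0 => /eqP ->.
rewrite leq_eqVlt => /predU1P[-> //|]; rewrite ltnS => /IH h.
exact: subset_trans h (mono j).
Qed.

Section Simulation.
Variables (G : sgraph) (K : {set G}) (n T : nat) (P : protocol G n).
Variables (S : nat -> {set G}) (X Y : Type) (inp : X -> Y -> input K n).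
Hypothesis mono : forall i, S i \subset S i.+1.
Hypothesis inpA : forall a b b' u, val u \in S (T + T)%N -> inp a b u = inp a b' u.
Hypothesis inpB : forall a a' b u, val u \notin S 0%N -> inp a b u = inp a' b u.

Local Notation E := (cut_edges (T + T) S).
Local Notation st a b t u :=
  (local_input (inp a b) u, history P (inp a b) t u).

(** A cut edge [(i, (x, y))] with [i < T] stands for the message from [x] to [y] in round [i]. For
    later [i] time runs backwards: it stands for the message from [y] to [x] in round
    [2T - 1 - i]. *)
Let bit a b (e : 'I_(T + T) * (G * G)) : bool :=
  if (e.1 < T)%N then msg P e.2.1 e.2.2 (st a b e.1 e.2.1).1 (st a b e.1 e.2.1).2
  else let j := (T + T - e.1.+1)%N in
    msg P e.2.2 e.2.1 (st a b j e.2.2).1 (st a b j e.2.2).2.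

Let tr_set a b := [set e in E | bit a b e].

Let tr_bit a b a' b' e : tr_set a b = tr_set a' b' -> e \in E -> bit a b e = bit a' b' e.
Proof. by move=> /setP/(_ e) h eE; move: h; rewrite !inE in eE *; rewrite eE. Qed.

Let locA a b b' u : u \in S (T + T)%N ->
  local_input (inp a b) u = local_input (inp a b') u.
Proof. by rewrite /local_input; case: insubP => //= v _ <- uS; rewrite (inpA _ _ b'). Qed.

Let locB a a' b u : u \notin S 0%N ->
  local_input (inp a b) u = local_input (inp a' b) u.
Proof. by rewrite /local_input; case: insubP => //= v _ <- uS; rewrite (inpB _ a'). Qed.

(* At time i Alice knows the states of the nodes in [S (2T - i)] and Bob those
   outside [S i]. These two sets cover the graph, and the bits that one of them
   misses cross the cut, used forwards by Alice and in reversed time by Bob. *)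
Let simulation a b a' b' : tr_set a b = tr_set a' b' -> forall i, (i <= T)%N ->
  (forall v, v \in S (T + T - i)%N -> history P (inp a b') i v = history P (inp a b) i v) /\
  (forall v, v \notin S i -> history P (inp a b') i v = history P (inp a' b') i v).
Proof.
move=> tre; elim=> [//|i IH] iT.
have [IHA IHB] := IH (ltnW iT).
have sub := mono_sub mono.
have SS : S i \subset S (T + T - i)%N by apply: sub; lia.
split=> v vS /=.
  have vS' : v \in S (T + T - i)%N by apply: (subsetP (sub _ _ _)) vS; lia.
  rewrite IHA //; congr rcons; apply/ffunP => w; rewrite !ffunE.
  case: (boolP (edge w v)) => //= wv.
  have [wS|wS] := boolP (w \in S (T + T - i)%N).
    rewrite IHA // (locA a b' b) //; apply: (subsetP (sub _ _ _)) wS; lia.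
  have wSi : w \notin S i by apply: contra wS; apply: (subsetP SS).
  have wS0 : w \notin S 0%N by apply: contra wSi; apply: (subsetP (sub _ _ _)).
  rewrite IHB // (locB a a') //.
  have jT : (T + T - i.+1 < T + T)%N by lia.
  have := tr_bit (e := (Ordinal jT, (v, w))) tre.
  have jE : (T + T - (T + T - i.+1).+1)%N = i by lia.
  have jF : (T + T - i.+1 < T)%N = false by lia.
  rewrite /bit /= jF jE.
  by move=> -> //; rewrite inE /= edge_sym wv vS subnSK ?wS //; lia.
have vS' : v \notin S i by apply: contra vS; apply: (subsetP (mono _)).
rewrite IHB //; congr rcons; apply/ffunP => w; rewrite !ffunE.
case: (boolP (edge w v)) => //= wv.
have [wS|wS] := boolP (w \in S i); last first.
  rewrite IHB // (locB a a') //; apply: contra wS; exact: (subsetP (sub _ _ _)).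
have wSi := subsetP SS w wS.
have wS2 : w \in S (T + T)%N by apply: (subsetP (sub _ _ _)) wS; lia.
rewrite IHA // (locA a b' b) //.
have jT : (i < T + T)%N by lia.
have := tr_bit (e := (Ordinal jT, (w, v))) tre.
by rewrite /bit /= iT; apply; rewrite inE /= wv wS vS.
Qed.

Let trP a b : tr_set a b \in powerset E.
Proof. by rewrite inE; apply/subsetP => e; rewrite inE => /andP[]. Qed.

Lemma cut_simulation (u : G) : u \in S 0%N ->
  exists (Tr : finType) (tr : X -> Y -> Tr),
    [/\ #|Tr| = (2 ^ #|cut_edges (T + T) S|)%N,
        forall a b a' b', tr a b = tr a' b' -> tr a b' = tr a b &
        forall a b b', tr a b = tr a b' ->
          out P u (local_input (inp a b) u) (history P (inp a b) T u) =
          out P u (local_input (inp a b') u) (history P (inp a b') T u)].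
Proof.
move=> uS; exists {s : {set 'I_(T + T) * (G * G)} | s \in powerset E}.
exists (fun a b => exist _ (tr_set a b) (trP a b)).
have sub := mono_sub mono.
split.
- by rewrite card_sig -card_powerset; apply: eq_card => s; rewrite inE.
- move=> a b a' b' /(congr1 val) /= tre; apply: val_inj => /=.
  apply/setP => e; rewrite !inE; case: (boolP (edge _ _ && _)) => //= eE.
  have [iT|iT] := ltnP e.1 T.
    rewrite /bit iT /=; case/and3P: eE => _ xS _.
    have [simA _] := simulation tre (ltnW iT).
    have [h1 h2] : (e.1 <= T + T)%N /\ (e.1 <= T + T - e.1)%N.
      by clear -iT; move: (nat_of_ord e.1) iT => i; split; lia.
    by rewrite simA ?(locA a b' b) //; apply: (subsetP (sub _ _ _)) xS.
  have eE' : e \in E by rewrite inE.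
  rewrite (tr_bit tre eE') /bit ltnNge iT /=; case/and3P: eE => _ _ yS.
  have [jT h2] : (T + T - e.1.+1 <= T)%N /\ (T + T - e.1.+1 <= e.1.+1)%N.
    by clear -iT; move: (nat_of_ord e.1) iT => i; split; lia.
  have [_ simB] := simulation tre jT.
  by rewrite simB ?(locB a a') //; apply: contra yS; apply: (subsetP (sub _ _ _)).
- move=> a b b' /(congr1 val) /= tre.
  have [simA _] := simulation tre (leqnn T).
  rewrite simA ?(locA a b' b) //; apply: (subsetP (sub _ _ _)) uS; lia.
Qed.

End Simulation.

Lemma sum_enum_val (R : nmodType) (T : finType) (F : T -> R) :
  \sum_(i < #|T|) F (enum_val i) = \sum_x F x.
Proof. by rewrite [RHS](reindex _ (onW_bij _ (@enum_val_bij T))). Qed.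

(* Transcripts of a two-party protocol after which Alice knows the value. *)
Definition rectangular (X Y Tr : Type) (tr : X -> Y -> Tr) (f : X -> Y -> bool) : Prop :=
  (forall a b a' b', tr a b = tr a' b' -> tr a b' = tr a b) /\
  (forall a b b', tr a b = tr a b' -> f a b = f a b').

(** Each transcript is a rectangle on which the value depends only on Alice's input, so the matrix
    of [f] is a sum of one rank-one 0/1 matrix per transcript. *)
Lemma rectangle_sum (R : pzSemiRingType) (X Y Tr : finType) (tr : X -> Y -> Tr)
    (f : X -> Y -> bool) a b : rectangular tr f ->
  (f a b)%:R = \sum_t [exists b', (tr a b' == t) && f a b']%:R *
                      [exists a', tr a' b == t]%:R :> R.
Proof.
move=> [rect val]; rewrite (bigD1 (tr a b)) //= [X in _ + X]big1 ?addr0.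
  rewrite (_ : [exists a', tr a' b == tr a b] = true) ?mulr1; last by apply/existsP; exists a.
  congr (nat_of_bool _)%:R; apply/idP/existsP => [fab|[b' /andP[/eqP e]]].
    by exists b; rewrite eqxx.
  by rewrite (val _ _ _ e).
move=> t tn; case: existsP => [[b' /andP[/eqP e1 _]]|]; last by rewrite mul0r.
case: existsP => [[a' /eqP e2]|]; last by rewrite mulr0.
by case/eqP: tn; rewrite (rect a b' a' b) ?e1 ?e2.
Qed.

(* The matrix of the function is the m-th tensor power of J - I, whose inverse
   is the m-th tensor power of J / (M - 1) - I. *)
Lemma nonequality_rank (m M : nat) (Tr : finType)
    (tr : {ffun 'I_m -> 'I_M} -> {ffun 'I_m -> 'I_M} -> Tr) :
  (1 < M)%N -> rectangular tr (fun a b => [forall i, a i != b i]) ->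
  (M ^ m <= #|Tr|)%N.
Proof.
move=> M1 rect; pose X := {ffun 'I_m -> 'I_M}.
pose f (a b : X) := [forall i, a i != b i].
have -> : (M ^ m)%N = #|X| by rewrite card_ffun !card_ord.
pose ev (i : 'I_#|X|) : X := enum_val i.
pose A : 'M[rat]_#|X| := \matrix_(i, j) (f (ev i) (ev j))%:R.
pose L : 'M[rat]_(#|X|, #|Tr|) := \matrix_(i, t)
  [exists b, (tr (ev i) b == enum_val t) && f (ev i) b]%:R.
pose Q : 'M[rat]_(#|Tr|, #|X|) := \matrix_(t, j) [exists a, tr a (ev j) == enum_val t]%:R.
have ALQ : A = L *m Q.
  apply/matrixP => i j; rewrite !mxE (rectangle_sum _ _ _ rect).
  rewrite -(sum_enum_val (fun t : Tr => [exists b', (tr (ev i) b' == t) && f (ev i) b']%:R *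
    [exists a', tr a' (ev j) == t]%:R)) /=.
  by apply: eq_bigr => t _; rewrite !mxE.
pose c : rat := (M.-1%:R)^-1.
pose B : 'M[rat]_#|X| := \matrix_(i, j) \prod_(l < m) (c - (ev i l == ev j l)%:R).
have AB : A *m B = 1%:M.
  apply/matrixP => i j; rewrite !mxE.
  under eq_bigr => h _ do rewrite !mxE.
  rewrite (sum_enum_val (fun x : X => (f (ev i) x)%:R *
    \prod_(l < m) (c - (x l == ev j l)%:R))) /=.
  have -> : (i == j) = [forall l, ev i l == ev j l].
    apply/eqP/forallP => [-> //|h]; apply: enum_val_inj; apply/ffunP => l.
    exact/eqP.
  have fE (x : X) : (f (ev i) x)%:R = \prod_(l < m) (ev i l != x l)%:R :> rat.
    rewrite /f; case: (boolP [forall l, _]) => [/forallP h|/forallPn[l h]].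
      by rewrite big1 // => l _; rewrite h.
    by rewrite (bigD1 l) //= (negbTE h) mul0r.
  rewrite (eq_bigr (fun x : X => \prod_(l < m) ((ev i l != x l)%:R * (c - (x l == ev j l)%:R)))); last first.
    by move=> x _; rewrite fE -big_split.
  rewrite -(bigA_distr_bigA (fun l y => (ev i l != y)%:R * (c - (y == ev j l)%:R))).
  have -> : [forall l, ev i l == ev j l]%:R = \prod_(l < m) (ev i l == ev j l)%:R :> rat.
    case: (boolP [forall l, _]) => [/forallP h|/forallPn[l h]].
      by rewrite big1 // => l _; rewrite h.
    by rewrite (bigD1 l) //= (negbTE h) mul0r.
  apply: eq_bigr => l _; move: (ev i l) (ev j l) => x z.
  have MR : M.-1%:R != 0 :> rat by rewrite pnatr_eq0; lia.
  under eq_bigr => y _ do rewrite mulrBr.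
  rewrite sumrB -mulr_suml.
  have -> : \sum_y (x != y)%:R = M.-1%:R :> rat.
    rewrite -natr_sum; congr (_%:R).
    transitivity #|predC1 x|; last by rewrite cardC1 card_ord.
    rewrite -sum1_card [RHS]big_mkcond; apply: eq_bigr => y _.
    by rewrite inE eq_sym; case: eqP.
  rewrite divff // (bigD1 z) //= eqxx mulr1 big1 ?addr0.
    by case: eqP; rewrite ?subr0 ?subrr.
  by move=> y /negbTE ->; rewrite mulr0.
have rA : \rank A = #|X| by apply: mxrank_unit; have [] := mulmx1_unit AB.
by rewrite -rA ALQ; apply: leq_trans (mxrankM_maxl _ _) (rank_leq_col _).
Qed.

(** * Entropy, Hellinger distance and disjointness *)

(** With [y = sqrt (2 * p)] this is [y ^ 2 * (1 - 1 / y) <= y ^ 2 * ln y]. *)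
Lemma xlnx_ge (R : realType) (p : R) : 0 <= p ->
  2 * p - Num.sqrt 2 * Num.sqrt p <= p * (ln 2 + ln p).
Proof.
rewrite le_eqVlt => /predU1P[<-|p0]; first by rewrite sqrtr0 !mulr0 mul0r subr0.
pose y := Num.sqrt 2 * Num.sqrt p.
have y0 : 0 < y by rewrite mulr_gt0 ?sqrtr_gt0.
have yy : y ^+ 2 = 2 * p by rewrite exprMn !sqr_sqrtr // ltW.
have -> : ln 2 + ln p = 2 * ln y.
  by rewrite -lnM ?posrE // -yy lnXn // mulr_natl.
have : 1 - y^-1 <= ln y.
  have := @le_ln1Dx R (y^-1 - 1); rewrite addrCA subrr addr0 lnV ?posrE // => h.
  by have := h _; rewrite ltrBrDl subrr invr_gt0 => /(_ y0); lra.
move=> h; have -> : p * (2 * ln y) = y ^+ 2 * ln y by rewrite yy; ring.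
rewrite -yy -/y; have : y ^+ 2 * (1 - y^-1) <= y ^+ 2 * ln y by rewrite ler_wpM2l ?sqr_ge0.
have gen (z : R) : z != 0 -> z ^+ 2 * (1 - z^-1) = z ^+ 2 - z by move=> z0; field.
by rewrite gen ?gt_eqF.
Qed.

(* Subadditivity of entropy, with the deficit of each binary marginal bounded
   below by a squared Hellinger distance. *)
Lemma entropy_hellinger (R : realType) (I : finType) (A : {set {ffun I -> bool}}) :
  \sum_i (Num.sqrt #|[set u in A | u i]|%:R - Num.sqrt #|[set u in A | ~~ u i]|%:R) ^+ 2
    <= 2 * #|A|%:R * (#|I|%:R * ln 2 - ln #|A|%:R) :> R.
Proof.
have [A0|A0] := posnP #|A|.
  rewrite A0 mulr0 mul0r big1 // => i _.
  have z (P : pred {ffun I -> bool}) : #|[set u in A | P u]| = 0%N.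
    by apply/eqP; rewrite -leqn0 -A0; apply/subset_leq_card/subsetP => u; rewrite inE => /andP[].
  by rewrite !z subrr expr0n.
have a0 : 0 < #|A|%:R :> R by rewrite ltr0n.
pose c i b : R := #|[set u in A | u i == b]|%:R.
have c0 i b : 0 <= c i b by rewrite ler0n.
pose p i b := c i b / #|A|%:R.
have p0 i b : 0 <= p i b by rewrite divr_ge0 // ltW.
have cE i b : c i b = #|A|%:R * p i b by rewrite mulrC divfK ?gt_eqF.
have p1 i : p i true + p i false = 1.
  rewrite /p -mulrDl /c -natrD.
  rewrite (_ : (_ + _)%N = #|A|) ?divff ?gt_eqF //.
  rewrite -(cardsID [set u : {ffun I -> bool} | u i] A); congr (_ + _)%N; apply: eq_card => u.
    by rewrite !inE eqb_id.
  by rewrite !inE eqbF_neg andbC.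
have pA u i : u \in A -> 0 < p i (u i).
  move=> uA; rewrite divr_gt0 // ltr0n; apply/card_gt0P; exists u.
  by rewrite inE uA eqxx.
(* Gibbs' inequality for the uniform distribution on [A] against the product of its own
   marginals. *)
have gibbs : \sum_(u in A) ln (#|A|%:R * \prod_i p i (u i)) <= 0.
  apply: (@le_trans _ _ (\sum_(u in A) (#|A|%:R * \prod_i p i (u i) - 1))).
    apply: ler_sum => u uA; have := @le_ln1Dx R (#|A|%:R * \prod_i p i (u i) - 1).
    rewrite addrCA subrr addr0; apply; rewrite ltrBrDl subrr mulr_gt0 // prodr_gt0 // => i _.
    exact: pA.
  rewrite sumrB sumr_const -mulr_sumr -[1 *+ _]mulr_natl mulr1 subr_le0.
  rewrite -[leRHS]mulr1 ler_pM2l //.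
  have s1 : \sum_(u : {ffun I -> bool}) \prod_i p i (u i) = 1.
    rewrite -(bigA_distr_bigA p) big1 // => i _; by rewrite big_bool; apply: p1.
  rewrite -[leRHS]s1 big_mkcond /=; apply: ler_sum => u _; case: ifP => // _.
  by apply: prodr_ge0.
have ent : #|A|%:R * ln #|A|%:R + \sum_i \sum_b c i b * ln (p i b) <= 0.
  rewrite (le_trans _ gibbs) // le_eqVlt; apply/orP; left; apply/eqP.
  have -> : \sum_(u in A) ln (#|A|%:R * \prod_i p i (u i)) =
     \sum_(u in A) (ln #|A|%:R + \sum_i ln (p i (u i))).
    apply: eq_bigr => u uA; have pu i : 0 < p i (u i) by apply: pA.
    have W0 (r : seq I) : 0 < \prod_(i <- r) p i (u i) by apply: prodr_gt0.
    rewrite lnM ?posrE //; congr (_ + _).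
    elim: (index_enum I) => [|i r IH]; first by rewrite !big_nil ln1.
    by rewrite !big_cons lnM ?posrE // IH.
  rewrite big_split sumr_const [X in _ = _ + X]exchange_big /= -[X in _ = X + _]mulr_natl; congr (_ + _).
  apply: eq_bigr => i _; rewrite [RHS](partition_big (fun u : {ffun I -> bool} => u i) xpredT) //=.
  apply: eq_bigr => b _.
  rewrite (eq_bigr (fun _ => ln (p i b))); last by move=> u /andP[_ /eqP ->].
  rewrite (eq_bigl (mem [set u in A | u i == b])); last by move=> u; rewrite !inE.
  by rewrite sumr_const -[RHS]mulr_natl.
have step i : (Num.sqrt (c i true) - Num.sqrt (c i false)) ^+ 2 <=
   2 * #|A|%:R * (ln 2 + \sum_b p i b * ln (p i b)).
  have se b : Num.sqrt (c i b) = Num.sqrt #|A|%:R * Num.sqrt (p i b).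
    by rewrite cE sqrtrM // (ltW a0).
  rewrite !se -mulrBr exprMn sqr_sqrtr ?(ltW a0) // [2 * _]mulrC -[leRHS]mulrA ler_pM2l //.
  rewrite big_bool /=.
  (* Twice the sum of the two lower bounds is [4 - 2 * r * (a + b)], which exceeds [(a - b) ^+ 2] by
     exactly [(a + b - r) ^+ 2]. *)
  have gen (x y a b l lx ly r : R) : a ^+ 2 = x -> b ^+ 2 = y -> x + y = 1 ->
      r ^+ 2 = 2 -> 2 * x - r * a <= x * (l + lx) -> 2 * y - r * b <= y * (l + ly) ->
      (a - b) ^+ 2 <= 2 * (l + (x * lx + y * ly)).
    move=> ax by_ e r2 h1 h2; have := sqr_ge0 (a + b - r).
    have : x * l + y * l = l by rewrite -mulrDl e mul1r.
    have -> : (a + b - r) ^+ 2 = a ^+ 2 + b ^+ 2 + 2 * (a * b) + r ^+ 2 - 2 * (r * a) - 2 * (r * b) by ring.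
    have -> : (a - b) ^+ 2 = a ^+ 2 + b ^+ 2 - 2 * (a * b) by ring.
    by rewrite ax by_ r2; lra.
  exact: gen (sqr_sqrtr (p0 i true)) (sqr_sqrtr (p0 i false)) (p1 i) (sqr_sqrtr (ler0n _ _))
    (xlnx_ge (p0 i true)) (xlnx_ge (p0 i false)).
have -> : \sum_i (Num.sqrt #|[set u in A | u i]|%:R - Num.sqrt #|[set u in A | ~~ u i]|%:R) ^+ 2
    = \sum_i (Num.sqrt (c i true) - Num.sqrt (c i false)) ^+ 2.
  apply: eq_bigr => i _; rewrite /c; congr ((Num.sqrt _%:R - Num.sqrt _%:R) ^+ 2);
    apply: eq_card => u; by rewrite !inE ?eqb_id ?eqbF_neg.
apply: le_trans (ler_sum _ (fun i _ => step i)) _.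
rewrite -mulr_sumr ler_wpM2l ?mulr_ge0 // big_split sumr_const /=.
rewrite -[ln 2 *+ _]mulr_natl lerD2l -(ler_pM2l a0) mulr_sumr.
have -> : \sum_i #|A|%:R * \sum_b p i b * ln (p i b) = \sum_i \sum_b c i b * ln (p i b).
  by apply: eq_bigr => i _; rewrite mulr_sumr; apply: eq_bigr => b _; rewrite cE mulrA.
by move: ent; rewrite mulrN; lra.
Qed.

Lemma injective_code (Z T : finType) (D : {set Z}) :
  (#|D| <= #|T|)%N -> T -> exists e : Z -> T, {in D &, injective e}.
Proof.
move=> DT t0; exists (fun z => nth t0 (enum T) (index z (enum D))).
move=> z z' zD z'D /eqP.
have i y : y \in D -> (index y (enum D) < size (enum T))%N.
  by move=> yD; rewrite -cardE (leq_trans _ DT) // cardE index_mem mem_enum.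
rewrite nth_uniq ?enum_uniq ?i // => /eqP e.
by rewrite -(nth_index z (_ : z \in enum D)) ?mem_enum // e nth_index // mem_enum.
Qed.

Lemma injection_into (T : finType) (A : {set T}) (m : nat) : (m <= #|A|)%N ->
  exists f : 'I_m -> T, injective f /\ forall i, f i \in A.
Proof.
move=> mA; exists (fun i => enum_val (widen_ord mA i)).
split=> [i j /enum_val_inj/(congr1 val) /= e|i]; last exact: enum_valP.
exact: val_inj.
Qed.

Lemma ED_P (G : sgraph) (K : {set G}) n (x : input K n) :
  reflect (injective x) (ED x).
Proof.
apply: (iffP forallP) => [h u v e|h u].
  by have /forallP/(_ v) := h u; rewrite e eqxx implybF negbK => /eqP.
by apply/forallP => v; apply/implyP; apply: contra_neq => /h.
Qed.

(** The [i]-th chosen terminals of [A] and [B] hold codes of [(i, a i)] and [(i, b i)], all other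
    terminals fixed private codes. Only the two terminals of a pair can collide. *)
Lemma embedding (G : sgraph) (K A B : {set G}) (n m M : nat) :
  A \subset K -> B \subset K -> [disjoint A & B] ->
  (m <= #|A|)%N -> (m <= #|B|)%N -> (M * m + (#|K| - m.*2) <= 2 ^ n)%N ->
  exists inp : {ffun 'I_m -> 'I_M} -> {ffun 'I_m -> 'I_M} -> input K n,
    [/\ forall a b b' u, val u \notin B -> inp a b u = inp a b' u,
        forall a a' b u, val u \notin A -> inp a b u = inp a' b u &
        forall a b, ED (inp a b) = [forall i, a i != b i]].
Proof.
move=> AK BK dAB mA mB fits.
have [fa [faI faA]] := injection_into mA.
have [fb [fbI fbB]] := injection_into mB.
have fab i j : fa i != fb j.
  by apply: contraTneq (faA i) => ->; rewrite (disjointFl dAB).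
pose U := [set fa i | i : 'I_m] :|: [set fb i | i : 'I_m].
pose D : {set 'I_m * 'I_M + G} :=
  [set z | match z with inl _ => true | inr u => u \in K :\: U end].
have cU : #|U| = m.*2.
  rewrite cardsU !card_imset // card_ord addnn (_ : _ :&: _ = finset.set0) ?cards0 ?subn0 //.
  apply/setP => u; rewrite !inE; apply/negP => /andP[/imsetP[i _ ->] /imsetP[j _ e]].
  by have := fab i j; rewrite e eqxx.
have UK : U \subset K.
  apply/subsetP => u; rewrite inE => /orP[] /imsetP[i _ ->].
    exact: (subsetP AK).
  exact: (subsetP BK).
have cD : #|D| = (M * m + (#|K| - m.*2))%N.
  rewrite -cU -cardsDS //.
  rewrite -sum1_card big_sumType /=; congr (_ + _)%N.
    rewrite (eq_bigl xpredT); last by move=> z; rewrite inE.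
    by rewrite sum1_card card_prod !card_ord mulnC.
  by rewrite sum1dep_card; apply: eq_card => u; rewrite !inE.
have [e eI] : exists e : _ -> n.-tuple bool, {in D &, injective e}.
  apply: injective_code; last exact: [tuple of nseq n false].
  by rewrite cD card_tuple card_bool.
pose sym (a b : {ffun 'I_m -> 'I_M}) (u : G) : 'I_m * 'I_M + G :=
  if [pick i | fa i == u] is Some i then inl (i, a i)
  else if [pick i | fb i == u] is Some i then inl (i, b i) else inr u.
have symA a b i : sym a b (fa i) = inl (i, a i).
  by rewrite /sym; case: pickP => [j /eqP/faI -> //|/(_ i)]; rewrite eqxx.
have symB a b i : sym a b (fb i) = inl (i, b i).
  rewrite /sym; case: pickP => [j|_]; first by rewrite (negbTE (fab j i)).
  by case: pickP => [j /eqP/fbI -> //|/(_ i)]; rewrite eqxx.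
have symO a b u : u \notin U -> sym a b u = inr u.
  rewrite !inE negb_or => /andP[uA uB]; rewrite /sym.
  case: pickP => [i /eqP e1|_]; first by rewrite -e1 imset_f in uA.
  by case: pickP => [i /eqP e1|//]; rewrite -e1 imset_f in uB.
have cases u : [\/ exists i, u = fa i, exists i, u = fb i | u \notin U].
  have [|] := boolP (u \in U); last by constructor 3.
  rewrite inE => /orP[] /imsetP[i _ ->]; [constructor 1|constructor 2]; by exists i.
have symD a b u : u \in K -> sym a b u \in D.
  move=> uK; have [[i ->]|[i ->]|uU] := cases u.
  - by rewrite symA inE.
  - by rewrite symB inE.
  - by rewrite symO // inE in_setD uU.
pose inp a b : input K n := [ffun u : {u : G | u \in K} => e (sym a b (val u))].
exists inp; split.
- move=> a b b' u uB; rewrite !ffunE; congr e.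
  have [[i ->]|[i ui]|uU] := cases (val u); last by rewrite !symO.
    by rewrite !symA.
  by rewrite ui fbB in uB.
- move=> a a' b u uA; rewrite !ffunE; congr e.
  have [[i ui]|[i ->]|uU] := cases (val u); last by rewrite !symO.
    by rewrite ui faA in uA.
  by rewrite !symB.
move=> a b; apply/ED_P/forallP => [inj i|ne [u uK] [v vK]].
  apply: contraTneq (fab i i) => ab; rewrite negbK.
  have ak := subsetP AK _ (faA i); have bk := subsetP BK _ (fbB i).
  have := inj (exist (fun u => u \in K) (fa i) ak) (exist _ (fb i) bk); rewrite !ffunE /= symA symB ab.
  by move=> /(_ erefl)/(congr1 val) /= e1; apply/eqP.
rewrite !ffunE /= => /(eI _ _ (symD a b u uK) (symD a b v vK)) se; apply: val_inj => /=.
have [[i ui]|[i ui]|uU] := cases u; have [[j vj]|[j vj]|vU] := cases v;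
  move: se; rewrite ?ui ?vj ?symA ?symB ?symO //.
- by case=> ->.
- by case=> <- e1; have := ne i; rewrite e1 eqxx.
- by case=> <- e1; have := ne i; rewrite e1 eqxx.
- by case=> ->.
- by case=> ->.
Qed.

Lemma cauchy_schwarz_sum (R : realFieldType) (I : finType) (a b : I -> R) :
  (\sum_i a i * b i) ^+ 2 <= (\sum_i a i ^+ 2) * \sum_i b i ^+ 2.
Proof.
set A := \sum_i a i ^+ 2; set B := \sum_i b i ^+ 2; set C := \sum_i _ * _.
have B0 : 0 <= B by apply: sumr_ge0 => i _; apply: sqr_ge0.
have : 0 <= \sum_i (B * a i - C * b i) ^+ 2 by apply: sumr_ge0 => i _; apply: sqr_ge0.
have -> : \sum_i (B * a i - C * b i) ^+ 2 = B * (A * B - C ^+ 2).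
  transitivity (B ^+ 2 * A - 2 * B * C * C + C ^+ 2 * B); last by ring.
  have eC : 2 * B * C * C = \sum_i 2 * B * C * (a i * b i) by rewrite -mulr_sumr.
  rewrite eC ![_ ^+ 2 * _]mulr_sumr -sumrB -big_split /=; apply: eq_bigr => i _; ring.
have [B00|Bn] := eqVneq B 0; last first.
  by rewrite pmulr_rge0 ?subr_ge0 // lt_neqAle eq_sym Bn.
move=> _; rewrite B00 mulr0 (_ : C = 0) ?expr0n // /C big1 // => i _.
move/eqP: B00; rewrite psumr_eq0 => [/allP/(_ i)|j _]; last exact: sqr_ge0.
by rewrite mem_index_enum sqrf_eq0 => /(_ isT)/eqP ->; rewrite mulr0.
Qed.

(* The cut-and-paste property of rectangles: the transcript distributions
   [q x * r y] satisfy H(P00, P11) = H(P01, P10) for the Hellinger distance. *)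
Lemma hellinger_gap (R : rcfType) (Tr : finType) (q r : bool -> Tr -> R) (e : Tr -> R) :
  (forall b t, 0 <= q b t) -> (forall b t, 0 <= r b t) ->
  (forall x y, \sum_t q x t * r y t = 1) ->
  (forall t, 0 <= e t <= q true t) ->
  (\sum_t e t * (r false t - r true t)) ^+ 2 <=
    24 * (\sum_t r false t * (Num.sqrt (q true t) - Num.sqrt (q false t)) ^+ 2 +
          \sum_t q false t * (Num.sqrt (r true t) - Num.sqrt (r false t)) ^+ 2).
Proof.
move=> q0 r0 sum1 eq.
pose s := @Num.sqrt R.
have ss x : 0 <= x -> s x ^+ 2 = x by move=> x0; rewrite sqr_sqrtr.
have e0 t : 0 <= e t by case/andP: (eq t).
have -> : \sum_t e t * (r false t - r true t) =
  \sum_t (s (e t) * (s (r true t) - s (r false t))) * (- s (e t) * (s (r true t) + s (r false t))).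
  apply: eq_bigr => t _; rewrite -{1}(ss _ (e0 t)) -{1}(ss _ (r0 false t)) -{1}(ss _ (r0 true t)).
  ring.
apply: le_trans (cauchy_schwarz_sum _ _) _.
have h2 : \sum_t (- s (e t) * (s (r true t) + s (r false t))) ^+ 2 <= 4.
  apply: (@le_trans _ _ (\sum_t (2 * (q true t * r true t) + 2 * (q true t * r false t)))).
    apply: ler_sum => t _; rewrite exprMn sqrrN ss //.
    have := ss _ (r0 true t); have := ss _ (r0 false t); have /andP[_ eqt] := eq t.
    move: (s _) (s _) => a b <- <-.
    have : e t * (b + a) ^+ 2 <= q true t * (b + a) ^+ 2 by rewrite ler_wpM2r ?sqr_ge0.
    have : 0 <= q true t * (b - a) ^+ 2 by rewrite mulr_ge0 ?sqr_ge0.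
    lra.
  by rewrite big_split -!mulr_sumr !sum1 /=; lra.
have h1 : \sum_t (s (e t) * (s (r true t) - s (r false t))) ^+ 2 <=
    6 * \sum_t r false t * (s (q true t) - s (q false t)) ^+ 2 +
    4 * \sum_t q false t * (s (r true t) - s (r false t)) ^+ 2.
  (* The four product distributions have the same total mass, so this combination sums to zero;
     adding it makes the inequality hold term by term. *)
  have z : \sum_t 2 * (q false t * r false t + q true t * r true t
                        - q false t * r true t - q true t * r false t) = 0.
    by rewrite -mulr_sumr !sumrB big_split /= !sum1; ring.
  rewrite -[leRHS]addr0 -[X in _ <= _ + X]z !mulr_sumr -!big_split /=; apply: ler_sum => t _.
  rewrite exprMn ss //.
  have gen (a b c d x : R) : x <= b ^+ 2 -> x * (d - c) ^+ 2 <=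
      6 * (c ^+ 2 * (b - a) ^+ 2) + 4 * (a ^+ 2 * (d - c) ^+ 2) +
      2 * (a ^+ 2 * c ^+ 2 + b ^+ 2 * d ^+ 2 - a ^+ 2 * d ^+ 2 - b ^+ 2 * c ^+ 2).
    move=> xb; apply: (@le_trans _ _ (b ^+ 2 * (d - c) ^+ 2)).
      by rewrite ler_wpM2r ?sqr_ge0.
    rewrite -subr_ge0.
    set lhs := (X in 0 <= X).
    have -> : lhs = ((b * c - a * c) - (a * c - b * d)) ^+ 2 * 0 + lhs by ring.
    have := sqr_ge0 ((b * c - a * c) - (a * c - b * d)).
    have := sqr_ge0 ((a * d - a * c) - (a * c - b * c)).
    rewrite /lhs; nra.
  have := gen (s (q false t)) (s (q true t)) (s (r false t)) (s (r true t)) (e t).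
  by rewrite !ss //; apply; case/andP: (eq t).
have g1 : 0 <= \sum_t (s (e t) * (s (r true t) - s (r false t))) ^+ 2.
  by apply: sumr_ge0 => t _; apply: sqr_ge0.
have g2 : 0 <= \sum_t r false t * (s (q true t) - s (q false t)) ^+ 2.
  by apply: sumr_ge0 => t _; rewrite mulr_ge0 ?sqr_ge0.
have g3 : 0 <= \sum_t q false t * (s (r true t) - s (r false t)) ^+ 2.
  by apply: sumr_ge0 => t _; rewrite mulr_ge0 ?sqr_ge0.
apply: le_trans (ler_wpM2l g1 h2) _; rewrite -/s; lra.
Qed.

Section Disjointness.
Variables (R : realType) (I Tr : finType).
Local Notation X := {ffun I -> bool}.
Variables (tr : X -> X -> Tr) (f : X -> X -> bool).
Hypothesis rect : rectangular tr f.

Definition upd (i : I) (b : bool) (x : X) : X := [ffun j => if j == i then b else x j].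
(* In coordinate j only Alice's bit is random if [d j], and only Bob's if not. *)
Definition alice (d u : X) : X := [ffun j => d j && u j].
Definition bob (d u : X) : X := [ffun j => ~~ d j && u j].

Let N : R := #|{: X}|%:R.
Let N0 : 0 < N. Proof. by rewrite ltr0n; apply/card_gt0P; exists [ffun=> true]. Qed.
Let NE : N = 2 ^+ #|I|. Proof. by rewrite /N card_ffun card_bool natrX. Qed.

Let Rt t (x : X) := [exists y, tr x y == t].
Let Ct t (y : X) := [exists x, tr x y == t].
Let Ft t (x : X) := [exists y, (tr x y == t) && f x y].

(** The probability of a transcript is a product [q * r] with one factor per party, because
    transcripts are rectangles. Coordinate [i] is overwritten by [b], the others are drawn according
    to [d]. *)
Let q i d b t : R := N^-1 * \sum_u (Rt t (upd i b (alice d u)))%:R.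
Let r i d b t : R := N^-1 * \sum_u (Ct t (upd i b (bob d u)))%:R.
(** Squared Hellinger distances, up to normalization, between the transcript distributions for the
    bits (0,0) and (1,0) in coordinate [i]; [H01] is the same for (0,0) and (0,1). *)
Let H10 i d := \sum_t r i d false t * (Num.sqrt (q i d true t) - Num.sqrt (q i d false t)) ^+ 2.
Let H01 i d := \sum_t q i d false t * (Num.sqrt (r i d true t) - Num.sqrt (r i d false t)) ^+ 2.

(** Under [alice d] and [bob d] no coordinate has both bits set. Overwriting coordinate [i] by (1,0)
    keeps this and by (1,1) violates it, so a function that recognizes disjointness has gap 1. *)
Definition and_gap i d : R := N^-1 ^+ 2 * \sum_u \sum_v
  ((f (upd i true (alice d u)) (upd i false (bob d v)))%:R -
   (f (upd i true (alice d u)) (upd i true (bob d v)))%:R).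

Let flip i (u : X) : X := upd i (~~ u i) u.

Let flipK i : involutive (flip i).
Proof. by move=> u; apply/ffunP => j; rewrite !ffunE eqxx negbK; case: eqP => // ->. Qed.

Let sum_upd i b (F : X -> R) : \sum_u F (upd i b u) = 2 * \sum_(u : X | u i == b) F u.
Proof.
rewrite (bigID (fun u : X => u i == b)) /= mulr2n mulrDl mul1r; congr (_ + _).
  apply: eq_bigr => u /eqP ub; congr F; apply/ffunP => j; rewrite ffunE.
  by case: eqP => // ->.
rewrite (reindex_inj (inv_inj (flipK i))) /=; apply: eq_big => u.
  by rewrite ffunE eqxx; case: (u i); case: b.
rewrite ffunE eqxx => ub; congr F; apply/ffunP => j; rewrite !ffunE.
by case: eqP => // ->; move: ub; case: (u i); case: b.
Qed.

Let rect1 x y : \sum_t (Rt t x)%:R * (Ct t y)%:R = 1 :> R.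
Proof.
have rect' : rectangular tr (fun _ _ => true) by case: rect.
apply: (etrans _ (esym (rectangle_sum R x y rect'))).
apply: eq_bigr => t _; congr (_%:R * _); congr nat_of_bool.
by apply: eq_existsb => z; rewrite andbT.
Qed.

Let q0 i d b t : 0 <= q i d b t.
Proof. by rewrite mulr_ge0 ?invr_ge0 ?(ltW N0) // sumr_ge0. Qed.
Let r0 i d b t : 0 <= r i d b t.
Proof. by rewrite mulr_ge0 ?invr_ge0 ?(ltW N0) // sumr_ge0. Qed.

Let qr1 i d x y : \sum_t q i d x t * r i d y t = 1.
Proof.
under eq_bigr => t _ do rewrite mulrACA big_distrlr /=.
rewrite -mulr_sumr exchange_big /=.
under eq_bigr => u _ do rewrite exchange_big /=.
under eq_bigr => u _ do under eq_bigr => v _ do rewrite rect1.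
rewrite sumr_const sumr_const -mulrnA -[_ *+ _]mulr_natl mulr1 natrM -/N.
by field; rewrite gt_eqF.
Qed.

Let gap_le i d : and_gap i d ^+ 2 <= 24 * (H10 i d + H01 i d).
Proof.
pose e t : R := N^-1 * \sum_u (Ft t (upd i true (alice d u)))%:R.
have -> : and_gap i d = \sum_t e t * (r i d false t - r i d true t).
  under [RHS]eq_bigr => t _ do rewrite /r -mulrBr -sumrB mulrACA big_distrlr /=.
  rewrite -mulr_sumr /and_gap expr2; congr (_ * _).
  rewrite [RHS]exchange_big; apply: eq_bigr => u _ /=.
  rewrite [RHS]exchange_big; apply: eq_bigr => v _ /=.
  rewrite !(rectangle_sum R _ _ rect) -sumrB; apply: eq_bigr => t _.
  by rewrite mulrBr.
apply: (hellinger_gap (q0 i d) (r0 i d) (qr1 i d)) => t.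
rewrite mulr_ge0 ?invr_ge0 ?(ltW N0) ?sumr_ge0 //= ler_wpM2l ?invr_ge0 ?(ltW N0) //.
apply: ler_sum => u _; rewrite ler_nat /Ft /Rt.
by case: existsP => //= -[y /andP[ty _]]; case: existsP => // -[]; exists y.
Qed.

(** For fixed [d], transcript [t] leaves the random bits uniform on [A t] and [B t], and the mean
    loss of entropy is the entropy of the transcript, at most [ln #|Tr|]. [entropy_hellinger]
    distributes this loss over the coordinates. *)
Let info (d : X) : \sum_i (if d i then H10 i d else H01 i d) <= 4 * ln #|Tr|%:R.
Proof.
pose A t := [set u : X | Rt t (alice d u)].
pose B t := [set u : X | Ct t (bob d u)].
pose p t : R := #|A t|%:R * #|B t|%:R / N ^+ 2.
have p0 t : 0 <= p t by rewrite divr_ge0 ?mulr_ge0 ?exprn_ge0 ?(ltW N0).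
have sumA t : \sum_u (Rt t (alice d u))%:R = #|A t|%:R :> R.
  by rewrite -sum1_card natr_sum [RHS]big_mkcond; apply: eq_bigr => u _; rewrite inE; case: Rt.
have sumB t : \sum_u (Ct t (bob d u))%:R = #|B t|%:R :> R.
  by rewrite -sum1_card natr_sum [RHS]big_mkcond; apply: eq_bigr => u _; rewrite inE; case: Ct.
have p1 : \sum_t p t = 1.
  rewrite -mulr_suml; have -> : \sum_t #|A t|%:R * #|B t|%:R = N ^+ 2 :> R.
    under eq_bigr => t _ do rewrite -sumA -sumB big_distrlr /=.
    rewrite exchange_big /=; under eq_bigr => u _ do rewrite exchange_big /=.
    under eq_bigr => u _ do under eq_bigr => v _ do rewrite rect1.
    by rewrite sumr_const sumr_const -mulrnA -[_ *+ _]mulr_natl mulr1 natrM.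
  by rewrite divff // expf_neq0 // gt_eqF.
have Tr0 : (0 < #|Tr|)%N by apply/card_gt0P; exists (tr [ffun=> true] [ffun=> true]).
have TrR : 0 < #|Tr|%:R :> R by rewrite ltr0n.
have entropy : \sum_t p t * (- ln (p t)) <= ln #|Tr|%:R.
  have -> : ln #|Tr|%:R = \sum_t p t * ln #|Tr|%:R by rewrite -mulr_suml p1 mul1r.
  rewrite -subr_le0 -sumrB.
  apply: (@le_trans _ _ (\sum_t (#|Tr|%:R^-1 - p t))); last first.
    have c1 : \sum_(t : Tr) #|Tr|%:R^-1 = 1 :> R.
      by rewrite sumr_const -[LHS]mulr_natl divff ?gt_eqF.
    by rewrite sumrB p1 c1 subrr.
  apply: ler_sum => t _; have := p0 t; rewrite le_eqVlt => /predU1P[<-|pt].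
    by rewrite !mul0r subr0 subr0 invr_ge0 ltW.
  have np : 0 < (p t * #|Tr|%:R)^-1 by rewrite invr_gt0 mulr_gt0.
  have lnE : ln (p t * #|Tr|%:R)^-1 = - ln (p t) - ln #|Tr|%:R.
    have gen (a b : R) : 0 < a -> 0 < b -> ln (a * b)^-1 = - ln a - ln b.
      by move=> a0 b0; rewrite lnV ?posrE ?mulr_gt0 // lnM ?posrE // opprD.
    exact: gen.
  have h : ln (p t * #|Tr|%:R)^-1 <= (p t * #|Tr|%:R)^-1 - 1.
    by have := @le_ln1Dx R ((p t * #|Tr|%:R)^-1 - 1); rewrite addrCA subrr addr0; apply; lra.
  have gen (a n x y : R) : 0 < a -> 0 < n -> x - y <= (a * n)^-1 - 1 ->
      a * x - a * y <= n^-1 - a.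
    move=> a0 n0 le; rewrite -mulrBr (_ : n^-1 - a = a * ((a * n)^-1 - 1)).
      by rewrite ler_pM2l.
    by field; rewrite !gt_eqF.
  by rewrite lnE in h; apply: gen.
have qE i b t : d i -> q i d b t = 2 / N * #|[set u in A t | u i == b]|%:R.
  move=> di; rewrite /q.
  have e (u : X) : upd i b (alice d u) = alice d (upd i b u).
    by apply/ffunP => j; rewrite !ffunE; case: eqP => // ->; rewrite di.
  under eq_bigr => u _ do rewrite e.
  rewrite (sum_upd i b (fun u => (Rt t (alice d u))%:R)) mulrCA mulrA; congr (_ * _).
  rewrite -sum1_card natr_sum big_mkcond [RHS]big_mkcond; apply: eq_bigr => u _.
  by rewrite !inE; case: Rt; case: eqP.
have rE i b t : ~~ d i -> r i d b t = 2 / N * #|[set u in B t | u i == b]|%:R.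
  move=> di; rewrite /r.
  have e (u : X) : upd i b (bob d u) = bob d (upd i b u).
    by apply/ffunP => j; rewrite !ffunE; case: eqP => // ->; rewrite di.
  under eq_bigr => u _ do rewrite e.
  rewrite (sum_upd i b (fun u => (Ct t (bob d u))%:R)) mulrCA mulrA; congr (_ * _).
  rewrite -sum1_card natr_sum big_mkcond [RHS]big_mkcond; apply: eq_bigr => u _.
  by rewrite !inE; case: Ct; case: eqP.
have q0E i t : ~~ d i -> q i d false t = #|A t|%:R / N.
  move=> di; rewrite mulrC -sumA; congr (_ * _); apply: eq_bigr => u _.
  congr (nat_of_bool (Rt t _))%:R; apply/ffunP => j; rewrite !ffunE.
  by case: eqP => // ->; rewrite (negbTE di).
have r0E i t : d i -> r i d false t = #|B t|%:R / N.
  move=> di; rewrite mulrC -sumB; congr (_ * _); apply: eq_bigr => u _.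
  congr (nat_of_bool (Ct t _))%:R; apply/ffunP => j; rewrite !ffunE.
  by case: eqP => // ->; rewrite di.
pose hA i t : R := (Num.sqrt #|[set u in A t | u i]|%:R - Num.sqrt #|[set u in A t | ~~ u i]|%:R) ^+ 2.
pose hB i t : R := (Num.sqrt #|[set u in B t | u i]|%:R - Num.sqrt #|[set u in B t | ~~ u i]|%:R) ^+ 2.
have c0 : 0 <= 2 / N ^+ 2 by rewrite divr_ge0 ?exprn_ge0 ?(ltW N0).
have term i : (if d i then H10 i d else H01 i d) <=
  \sum_t 2 / N ^+ 2 * (#|B t|%:R * hA i t + #|A t|%:R * hB i t).
  have eT (D : {set X}) : #|[set u in D | u i == true]| = #|[set u in D | u i]|.
    by apply: eq_card => u; rewrite !inE eqb_id.
  have eF (D : {set X}) : #|[set u in D | u i == false]| = #|[set u in D | ~~ u i]|.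
    by apply: eq_card => u; rewrite !inE eqbF_neg.
  have sqd (a x y : R) : 0 <= a ->
      (Num.sqrt (a * x) - Num.sqrt (a * y)) ^+ 2 = a * (Num.sqrt x - Num.sqrt y) ^+ 2.
    by move=> a0; rewrite !sqrtrM // -mulrBr exprMn sqr_sqrtr.
  have N20 : 0 <= 2 / N by rewrite divr_ge0 ?(ltW N0).
  case: ifPn => di; apply: ler_sum => t _.
    rewrite r0E // !qE // eT eF sqd // -/(hA i t).
    have -> : #|B t|%:R / N * (2 / N * hA i t) = 2 / N ^+ 2 * (#|B t|%:R * hA i t).
      by field; rewrite gt_eqF.
    by rewrite ler_wpM2l // lerDl mulr_ge0 ?sqr_ge0.
  rewrite q0E // !rE // eT eF sqd // -/(hB i t).
  have -> : #|A t|%:R / N * (2 / N * hB i t) = 2 / N ^+ 2 * (#|A t|%:R * hB i t).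
    by field; rewrite gt_eqF.
  by rewrite ler_wpM2l // lerDr mulr_ge0 ?sqr_ge0.
apply: le_trans (ler_sum _ (fun i _ => term i)) _.
rewrite exchange_big /= (le_trans _ (ler_wpM2l (ler0n _ 4) entropy)) // mulr_sumr.
apply: ler_sum => t _; rewrite -mulr_sumr big_split -!mulr_sumr /=.
have hAl := entropy_hellinger R (A t); have hBl := entropy_hellinger R (B t).
have lnN : #|I|%:R * ln 2 = ln N by rewrite NE lnXn // mulr_natl.
rewrite lnN -!/(hA _ _) in hAl hBl.
have [z|nz] := boolP ((#|A t| == 0%N) || (#|B t| == 0%N)).
  have pz : p t = 0.
    by rewrite /p; case/orP: z => /eqP ->; rewrite ?mulr0 !mul0r.
  rewrite pz mul0r mulr0 -[leRHS](mulr0 (2 / N ^+ 2)) ler_wpM2l //.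
  have hA0 : 0 <= \sum_i hA i t by apply: sumr_ge0 => i _; apply: sqr_ge0.
  have hB0 : 0 <= \sum_i hB i t by apply: sumr_ge0 => i _; apply: sqr_ge0.
  case/orP: z => /eqP z; rewrite z mul0r in hAl hBl *.
    by rewrite addr0 mulr_ge0_le0 // (le_trans hAl) // mulr0 mul0r.
  by rewrite add0r mulr_ge0_le0 // (le_trans hBl) // mulr0 mul0r.
move: nz; rewrite negb_or -!lt0n => /andP[a0 b0].
have aR : 0 < #|A t|%:R :> R by rewrite ltr0n.
have bR : 0 < #|B t|%:R :> R by rewrite ltr0n.
have -> : - ln (p t) = (ln N - ln #|A t|%:R) + (ln N - ln #|B t|%:R).
  rewrite /p ln_div ?posrE ?mulr_gt0 ?exprn_gt0 // lnM ?posrE // lnXn // mulr2n; ring.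
have -> : 4 * (p t * (ln N - ln #|A t|%:R + (ln N - ln #|B t|%:R))) =
  2 / N ^+ 2 * (#|B t|%:R * (2 * #|A t|%:R * (ln N - ln #|A t|%:R)) +
                #|A t|%:R * (2 * #|B t|%:R * (ln N - ln #|B t|%:R))).
  by rewrite /p; field; rewrite gt_eqF.
by rewrite ler_wpM2l // lerD // ler_wpM2l.
Qed.

(** Coordinate [i] is overwritten, so the distances at [i] do not depend on [d i]; pairing [d] with
    its flip at [i] lets [info] control both of them. The constant is 24 * 2 * 4. *)
Lemma disjointness_gap :
  (\sum_i \sum_d and_gap i d) ^+ 2 <= 192 * #|I|%:R * N ^+ 2 * ln #|Tr|%:R.
Proof.
have updal i b d u : upd i b (alice (flip i d) u) = upd i b (alice d u).
  by apply/ffunP => j; rewrite !ffunE; case: eqP.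
have updbo i b d u : upd i b (bob (flip i d) u) = upd i b (bob d u).
  by apply/ffunP => j; rewrite !ffunE; case: eqP.
have qf i d b t : q i (flip i d) b t = q i d b t.
  by congr (_ * _); apply: eq_bigr => u _; rewrite updal.
have rf i d b t : r i (flip i d) b t = r i d b t.
  by congr (_ * _); apply: eq_bigr => u _; rewrite updbo.
have sumH i : \sum_d (H10 i d + H01 i d) = 2 * \sum_(d : X) (if d i then H10 i d else H01 i d).
  rewrite mulr2n mulrDl mul1r [X in _ = _ + X](reindex_inj (inv_inj (flipK i))) -big_split /=.
  apply: eq_bigr => d _; rewrite ffunE eqxx.
  have -> : H10 i (flip i d) = H10 i d.
    by apply: eq_bigr => t _; rewrite rf !qf.
  have -> : H01 i (flip i d) = H01 i d.
    by apply: eq_bigr => t _; rewrite qf !rf.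
  by case: (d i) => //=; rewrite addrC.
have e (F : I -> X -> R) : \sum_i \sum_d F i d = \sum_(z : I * X) F z.1 z.2.
  by rewrite (pair_big xpredT xpredT F).
rewrite e; apply: le_trans (sqr_sum_le _) _.
rewrite card_prod natrM -/N.
have -> : 192 * #|I|%:R * N ^+ 2 * ln #|Tr|%:R =
  #|I|%:R * N * (24 * (2 * (N * (4 * ln #|Tr|%:R)))) :> R by ring.
rewrite ler_wpM2l ?mulr_ge0 ?(ltW N0) // -(e (fun i d => and_gap i d ^+ 2)).
apply: (@le_trans _ _ (\sum_i \sum_d 24 * (H10 i d + H01 i d))).
  by apply: ler_sum => i _; apply: ler_sum => d _; apply: gap_le.
under eq_bigr => i _ do rewrite -mulr_sumr sumH.
rewrite -mulr_sumr ler_pM2l // -mulr_sumr ler_pM2l // exchange_big /=.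
apply: le_trans (ler_sum _ (fun d _ => info d)) _.
by rewrite sumr_const -[leLHS]mulr_natl.
Qed.

End Disjointness.

Lemma cut_protocol (G : sgraph) (K : {set G}) (n T m M : nat) (S : nat -> {set G}) :
  (forall i, S i \subset S i.+1) -> (0 < m)%N ->
  (m <= #|K :&: S 0%N|)%N -> (m <= #|K :\: S (T + T)%N|)%N ->
  (M * m + (#|K| - m.*2) <= 2 ^ n)%N ->
  exists (inp : {ffun 'I_m -> 'I_M} -> {ffun 'I_m -> 'I_M} -> input K n) (u : G),
    [/\ u \in K, forall a b, ED (inp a b) = [forall i, a i != b i] &
    forall P : protocol G n,
    exists (Tr : finType) (tr : {ffun 'I_m -> 'I_M} -> {ffun 'I_m -> 'I_M} -> Tr),
      #|Tr| = (2 ^ #|cut_edges (T + T) S|)%N /\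
      rectangular tr (fun a b =>
        out P u (local_input (inp a b) u) (history P (inp a b) T u))].
Proof.
move=> mono m0 mA mB fits.
have S0T : S 0%N \subset S (T + T)%N by apply: mono_sub.
have dAB : [disjoint K :&: S 0%N & K :\: S (T + T)%N].
  rewrite disjoints_subset; apply/subsetP => u; rewrite !inE => /andP[_ uS].
  by rewrite (subsetP S0T).
have [inp [inpA inpB inpED]] := embedding (subsetIl _ _) (subsetDl _ _) dAB mA mB fits.
have /card_gt0P[u] : (0 < #|K :&: S 0%N|)%N by apply: leq_trans mA.
rewrite inE => /andP[uK uS]; exists inp, u; split=> // P.
have [||Tr [tr [cTr tr1 tr2]]] := cut_simulation (T := T) P mono (inp := inp) _ _ uS.
- by move=> a b b' v vS; apply: inpA; rewrite inE vS.
- by move=> a a' b v vS; apply: inpB; rewrite inE (negbTE vS) andbF.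
by exists Tr, tr.
Qed.

Lemma card_cut_sides (G : sgraph) (K : {set G}) (S : nat -> {set G}) j :
  (forall i, S i \subset S i.+1) ->
  ((minn #|K :&: S 0%N| #|K :\: S j|).*2 <= #|K|)%N.
Proof.
move=> mono; have S0T : S 0%N \subset S j by apply: mono_sub.
have : (#|K :&: S 0%N| + #|K :\: S j| <= #|K|)%N.
  rewrite -[leqRHS](cardsID (S j) K) leq_add2r.
  by apply/subset_leq_card/setIS.
by rewrite minnE; lia.
Qed.

Lemma det_cut_condition (G : sgraph) (K : {set G}) (n T l : nat) :
  (2 <= #|K| <= 2 ^ n)%N -> (#|G| <= 2 ^ l)%N ->
  det_rounds (@ED G K n) T -> cut_condition K (T + T) n l.+1.
Proof.
move=> /andP[k2 kn] Gl [P Pok] S mono.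
have m2 := card_cut_sides K (T + T) mono.
set m := minn _ _ in m2 *.
have [->|m0] := posnP m; first by rewrite muln0.
(* Half of the terminals on each side is the worst case for the embedding, and there the codes fit
   if [M * #|K| <= 2 * 2 ^ n]. *)
pose M := ((2 * 2 ^ n) %/ #|K|)%N.
have k0 : (0 < #|K|)%N by apply: leq_trans k2.
have Mk : (M * #|K| <= 2 * 2 ^ n)%N by apply: leq_divM.
have Mk1 : (2 * 2 ^ n < M.+1 * #|K|)%N by apply: ltn_ceil.
have M2 : (2 <= M)%N by rewrite leq_divRL // leq_mul2l.
have fits : (M * m + (#|K| - m.*2) <= 2 ^ n)%N.
  have gen (N k M' m' : nat) : (M' * k <= 2 * N)%N -> (m'.*2 <= k)%N -> (2 <= M')%N ->
      (M' * m' + (k - m'.*2) <= N)%N.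
    move=> h1 h2 h3; have : ((M' - 2) * m'.*2 <= (M' - 2) * k)%N by rewrite leq_mul2l h2 orbT.
    by nia.
  exact: gen.
have mA : (m <= #|K :&: S 0%N|)%N by apply: geq_minl.
have mB : (m <= #|K :\: S (T + T)%N|)%N by apply: geq_minr.
have [inp [u [uK inpED sim]]] := cut_protocol mono m0 mA mB fits.
have [Tr [tr [cTr rect]]] := sim P.
have rect' : rectangular tr (fun a b : {ffun 'I_m -> 'I_M} => [forall i, a i != b i]).
  case: rect => r1 r2; split=> // a b b' /r2.
  have ok x y : out P u (local_input (inp x y) u) (history P (inp x y) T u) = [forall i, x i != y i].
    by have /forallP/(_ u) := Pok (inp x y); rewrite uK /= inpED => /eqP.
  by rewrite !ok.
have := nonequality_rank M2 rect'; rewrite cTr => Mm.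
(* Maximality of [M] gives [2 ^ n <= M * #|K| <= M * 2 ^ l <= M ^ l.+1]: a symbol is worth at least
   [n / l.+1] bits. This is the origin of [Q = l.+1]. *)
have nM : (2 ^ n <= M ^ l.+1)%N.
  have kl : (#|K| <= 2 ^ l)%N by apply: leq_trans Gl; apply: max_card.
  have Ml : (2 ^ l <= M ^ l)%N by case: (l) => // l'; rewrite leq_exp2r.
  rewrite expnS; apply: (@leq_trans (M * #|K|)); last by rewrite leq_mul2l (leq_trans kl) ?orbT.
  rewrite -(@leq_pmul2l 2) // ltnW // (leq_trans Mk1) // mulnA leq_mul2r.
  by apply/orP; right; lia.
rewrite -(@leq_exp2l 2) // expnM [(l.+1 * _)%N]mulnC expnM.
apply: (@leq_trans ((M ^ l.+1) ^ m)); first by rewrite leq_exp2r.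
by rewrite -expnM mulnC expnM leq_exp2r.
Qed.

Lemma rand_cut_condition (R : realType) (eps delta : R) (G : sgraph) (K : {set G})
    (n T Q : nat) :
  0 < eps < 2^-1 -> 0 < delta -> slack delta K n ->
  192 <= Q%:R * (1 - 2 * eps) ^+ 2 * Num.min 1 delta ->
  rand_rounds eps (@ED G K n) T -> cut_condition K (T + T) 1 Q.
Proof.
move=> /andP[e0 e1] d0 [k2 slackK] Qbig [Omega [mu [P [mu0 mu1 err]]]] S mono.
have m2 := card_cut_sides K (T + T) mono.
set m' := minn #|_| _ in m2 *.
have [->|m'0] := posnP m'; first by rewrite muln0.
(* With three symbols per coordinate the embedding needs [#|K| + m] codes, so the slack in the
   universe limits the number of coordinates; this costs the factor [Num.min 1 delta]. *)
pose m := minn m' (2 ^ n - #|K|).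
have kR : 0 < #|K|%:R :> R by rewrite ltr0n; apply: leq_trans k2.
have dk : delta * #|K|%:R <= (2 ^ n - #|K|)%:R.
  rewrite natrB; first by rewrite natrX; lra.
  rewrite -(ler_nat R) natrX (le_trans _ slackK) // mulrDl mul1r lerDl mulr_ge0 //.
  exact: ltW.
have gap0 : (0 < 2 ^ n - #|K|)%N.
  by rewrite -(ltr_nat R) (lt_le_trans _ dk) // mulr_gt0.
have m0 : (0 < m)%N by rewrite leq_min m'0.
have m'm : Num.min 1 delta * m'%:R <= m%:R.
  rewrite /m; case: leqP => _.
    by rewrite ler_piMl // ge_min lexx.
  apply: le_trans dk; apply: ler_pM => //.
  - by rewrite le_min ler01 ltW.
  - by rewrite ge_min lexx orbT.
  - by rewrite ler_nat; move: m2; rewrite -addnn; lia.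
have mA : (m <= #|K :&: S 0%N|)%N by rewrite (leq_trans (geq_minl _ _)) // geq_minl.
have mB : (m <= #|K :\: S (T + T)%N|)%N by rewrite (leq_trans (geq_minl _ _)) // geq_minr.
have fits : (3 * m + (#|K| - m.*2) <= 2 ^ n)%N.
  have : (m <= m')%N by apply: geq_minl.
  have : (m <= 2 ^ n - #|K|)%N by apply: geq_minr.
  lia.
have [inp [u [uK inpED sim]]] := cut_protocol mono m0 mA mB fits.
pose X := {ffun 'I_m -> bool}.
(* Alice writes 2 for a one and 0 for a zero, Bob 2 and 1: the symbols agree exactly where both bits
   are one. *)
pose xa (x : X) : {ffun 'I_m -> 'I_3} := [ffun i => if x i then inord 2 else inord 0].
pose yb (y : X) : {ffun 'I_m -> 'I_3} := [ffun i => if y i then inord 2 else inord 1].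
pose f w x y := out (P w) u (local_input (inp (xa x) (yb y)) u)
                    (history (P w) (inp (xa x) (yb y)) T u).
have EDxy x y : ED (inp (xa x) (yb y)) = [forall i, ~~ (x i && y i)].
  rewrite inpED; apply: eq_forallb => i; rewrite !ffunE -(inj_eq val_inj) /=.
  by case: (x i); case: (y i); rewrite !inordK.
have fok w x y : correct (@ED G K n) T (P w) (inp (xa x) (yb y)) ->
    f w x y = [forall i, ~~ (x i && y i)].
  by move=> /forallP/(_ u); rewrite uK /= EDxy => /eqP.
have ge1 (x y : X) : [forall i, ~~ (x i && y i)] -> 1 - eps <= \sum_w mu w * (f w x y)%:R.
  move=> xy; have := err (inp (xa x) (yb y)).
  have := mu1; rewrite (bigID (fun w => correct (@ED G K n) T (P w) (inp (xa x) (yb y)))) /=.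
  have : \sum_(w | correct (@ED G K n) T (P w) (inp (xa x) (yb y))) mu w <=
      \sum_w mu w * (f w x y)%:R.
    rewrite big_mkcond; apply: ler_sum => w _; case: ifP => [/fok ->|_].
      by rewrite xy mulr1.
    by rewrite mulr_ge0.
  lra.
have le1 (x y : X) : ~~ [forall i, ~~ (x i && y i)] -> \sum_w mu w * (f w x y)%:R <= eps.
  move=> xy; apply: le_trans (err (inp (xa x) (yb y))); rewrite [leRHS]big_mkcond.
  apply: ler_sum => w _; case: ifPn => [_|/negPn/fok ->].
    by rewrite ler_piMr // lern1 leq_b1.
  by rewrite (negbTE xy) mulr0.
pose N : R := #|{: X}|%:R.
have N0 : 0 < N by rewrite ltr0n; apply/card_gt0P; exists [ffun=> true].
pose c := #|cut_edges (T + T) S|.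
have bound w : (\sum_i \sum_d and_gap R (f w) i d) ^+ 2 <= 192 * m%:R * N ^+ 2 * c%:R.
  have [Tr [tr [cTr [r1 r2]]]] := sim (P w).
  have rect : rectangular (fun x y : X => tr (xa x) (yb y)) (f w).
    by split=> [a b a' b'|a b b']; [apply: r1 | apply: r2].
  apply: le_trans (disjointness_gap R rect) _; rewrite card_ord cTr -/c.
  rewrite ler_wpM2l ?mulr_ge0 ?exprn_ge0 ?(ltW N0) // natrX lnXn //.
  rewrite -[leRHS]mul1r -[leLHS]mulr_natr ler_wpM2r //.
  by have := @le_ln1Dx R 1; rewrite -[1 + 1]/2; apply; lra.
pose Bd := Num.sqrt (192 * m%:R * N ^+ 2 * c%:R).
have Bd0 : 0 <= 192 * m%:R * N ^+ 2 * c%:R by rewrite !mulr_ge0 ?exprn_ge0 ?(ltW N0).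
have boundB w : \sum_i \sum_d and_gap R (f w) i d <= Bd.
  by rewrite (le_trans (ler_norm _)) // -sqrtr_sqr ler_sqrt.
have avg : m%:R * N * (1 - 2 * eps) <= \sum_w mu w * \sum_i \sum_d and_gap R (f w) i d.
  have -> : \sum_w mu w * \sum_i \sum_d and_gap R (f w) i d =
      \sum_(i < m) \sum_(d : X) \sum_w mu w * and_gap R (f w) i d.
    under eq_bigr => w _ do rewrite mulr_sumr.
    rewrite exchange_big; apply: eq_bigr => i _ /=.
    under eq_bigr => w _ do rewrite mulr_sumr.
    by rewrite exchange_big.
  have -> : m%:R * N * (1 - 2 * eps) = \sum_(i < m) \sum_(d : X) (1 - 2 * eps).
    by rewrite !sumr_const -mulrnA -[RHS]mulr_natl card_ord mulnC natrM.
  apply: ler_sum => i _; apply: ler_sum => d _.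
  have -> : \sum_w mu w * and_gap R (f w) i d = N^-1 ^+ 2 * \sum_u \sum_v
     \sum_w mu w * ((f w (upd i true (alice d u)) (upd i false (bob d v)))%:R -
     (f w (upd i true (alice d u)) (upd i true (bob d v)))%:R).
    rewrite mulr_sumr; under [RHS]eq_bigr => x _ do rewrite exchange_big mulr_sumr /=.
    rewrite exchange_big; apply: eq_bigr => w _ /=.
    rewrite /and_gap mulrCA -[RHS]mulr_sumr; congr (_ * _).
    by rewrite mulr_sumr; apply: eq_bigr => x _; rewrite mulr_sumr.
  have -> : 1 - 2 * eps = N^-1 ^+ 2 * \sum_(u : X) \sum_(v : X) (1 - 2 * eps).
    rewrite !sumr_const -mulrnA -[_ *+ (_ * _)]mulr_natl natrM -/N.
    by field; rewrite gt_eqF.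
  rewrite ler_wpM2l ?exprn_ge0 ?invr_ge0 ?(ltW N0) //.
  apply: ler_sum => x _; apply: ler_sum => y _.
  under eq_bigr => w _ do rewrite mulrBr.
  rewrite sumrB.
  have a1 : [forall j, ~~ (upd i true (alice d x) j && upd i false (bob d y) j)].
    by apply/forallP => j; rewrite !ffunE; case: eqP => // _; case: (d j); rewrite ?andbF.
  have a2 : ~~ [forall j, ~~ (upd i true (alice d x) j && upd i true (bob d y) j)].
    by apply/forallPn; exists i; rewrite !ffunE eqxx.
  have := ge1 _ _ a1; have := le1 _ _ a2; lra.
have le : m%:R * N * (1 - 2 * eps) <= Bd.
  apply: le_trans avg _; rewrite -[leRHS]mul1r -mu1 mulr_suml.
  by apply: ler_sum => w _; rewrite ler_wpM2l.
have mR : 0 < m%:R :> R by rewrite ltr0n.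
have mc : m%:R * (1 - 2 * eps) ^+ 2 <= 192 * c%:R.
  have : (m%:R * N * (1 - 2 * eps)) ^+ 2 <= Bd ^+ 2.
    by rewrite lerXn2r ?nnegrE ?sqrtr_ge0 // !mulr_ge0 ?(ltW N0) //; lra.
  rewrite sqr_sqrtr //.
  have -> : (m%:R * N * (1 - 2 * eps)) ^+ 2 = (m%:R * N ^+ 2) * (m%:R * (1 - 2 * eps) ^+ 2) by ring.
  have -> : 192 * m%:R * N ^+ 2 * c%:R = (m%:R * N ^+ 2) * (192 * c%:R) by ring.
  by rewrite ler_pM2l // mulr_gt0 // exprn_gt0.
rewrite mul1n -(ler_nat R) natrM -/c.
have e2 : 0 < (1 - 2 * eps) ^+ 2 by rewrite exprn_gt0 //; lra.
have dm : 0 < Num.min 1 delta by rewrite lt_min ltr01.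
have : 192 * m'%:R <= Q%:R * 192 * c%:R :> R.
  apply: le_trans (ler_wpM2r (ler0n _ _) Qbig) _.
  have := ler_wpM2l (ltW e2) m'm; have := ler0n R Q.
  move: (Num.min 1 delta) (m'%:R) => dd mm; move: mc.
  move: (m%:R) (c%:R) ((1 - 2 * eps) ^+ 2) (Q%:R) => M C E q h1 q0 h2.
  have : q * (E * (dd * mm)) <= q * (E * M) by rewrite ler_wpM2l.
  have : q * (M * E) <= q * (192 * C) by rewrite ler_wpM2l.
  lra.
by rewrite [leRHS]mulrAC [leRHS]mulrC ler_pM2l.
Qed.

(** * Integral routing of balanced demands *)

(* First moment method for the random variable 2^load. *)
Lemma rounding (R : realType) (J I E : finType) (pr : J -> I -> R)
    (use : I -> E -> bool) (lam : R) :
  (forall j i, 0 <= pr j i) -> (forall j, \sum_i pr j i = 1) ->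
  (forall e, \sum_j \sum_i pr j i * (use i e)%:R <= lam) ->
  exists c : J -> I, (forall j, 0 < pr j (c j)) /\
    forall e, 2 ^+ #|[set j | use (c j) e]| <= #|E|%:R * expR lam.
Proof.
move=> pr0 pr1 load; pose B := #|E|%:R * expR lam.
pose w (c : {ffun J -> I}) := \prod_j pr j (c j).
pose S (c : {ffun J -> I}) : R := \sum_e 2 ^+ #|[set j | use (c j) e]|.
have w0 c : 0 <= w c by apply: prodr_ge0.
have w1 : \sum_c w c = 1.
  by rewrite -(bigA_distr_bigA pr) big1.
have Sle : \sum_c w c * S c <= B.
  under eq_bigr => c _ do rewrite /S mulr_sumr.
  rewrite exchange_big /=; have -> : B = \sum_(e : E) expR lam.
    by rewrite sumr_const -[RHS]mulr_natl.
  apply: ler_sum => e _.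
  have two c : w c * 2 ^+ #|[set j | use (c j) e]| =
      \prod_j (pr j (c j) * (1 + (use (c j) e)%:R)).
    rewrite big_split /=; congr (_ * _).
    rewrite -prodr_const big_mkcond; apply: eq_bigr => j _; rewrite inE.
    by case: (use _ _); rewrite ?addr0.
  under eq_bigr => c _ do rewrite two.
  rewrite -(bigA_distr_bigA (fun j i => pr j i * (1 + (use i e)%:R))).
  apply: (@le_trans _ _ (\prod_j expR (\sum_i pr j i * (use i e)%:R))).
    apply: ler_prod => j _; apply/andP; split.
      by apply: sumr_ge0 => i _; rewrite mulr_ge0 // addr_ge0.
    under eq_bigr => i _ do rewrite mulrDr mulr1.
    by rewrite big_split /= pr1 expR_ge1Dx.
  by rewrite -expR_sum ler_expR.
(* The bound is met by an outcome of positive probability, which also keeps every [c j] in its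
   support. *)
have [c [cw cS]] : exists c, 0 < w c /\ S c <= B.
  apply: contrapT => /forallNP bad.
  have pos c : 0 <= w c * (S c - B).
    have [wz|wn] := eqVneq (w c) 0; first by rewrite wz mul0r.
    have wp : 0 < w c by rewrite lt_neqAle eq_sym wn w0.
    rewrite mulr_ge0 // subr_ge0 leNgt; apply/negP => lt.
    by apply: (bad c); split=> //; apply: ltW.
  have sle : \sum_c w c * (S c - B) <= 0.
    under eq_bigr => c _ do rewrite mulrBr.
    by rewrite sumrB -mulr_suml w1 mul1r subr_le0.
  have : \sum_c w c * (S c - B) == 0 by rewrite eq_le sle sumr_ge0.
  rewrite psumr_eq0 // => /allP z.
  have : \sum_c w c = 0.
    apply: big1 => c _; have := z c (mem_index_enum c); rewrite mulf_eq0 subr_eq0.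
    case/orP => /eqP // e; apply/eqP; rewrite eq_le w0 andbT leNgt; apply/negP => wp.
    by apply: (bad c); split; rewrite // e.
  by rewrite w1 => /eqP; rewrite oner_eq0.
exists c; split=> [j|e].
  rewrite lt_neqAle pr0 andbT eq_sym; apply/eqP => z.
  by move: cw; rewrite /w (bigD1 j) //= z mul0r ltxx.
apply: le_trans cS; rewrite /S (bigD1 e) //= lerDl.
by apply: sumr_ge0 => e' _; apply: exprn_ge0.
Qed.

Lemma flow_walks (R : realType) (G : sgraph) (tau : nat) (u v : G) (d : R)
    (phi : G * 'I_tau.+1 -> G * 'I_tau.+1 -> R) :
  (0 < tau)%N -> 0 <= d -> is_flow (u, ord0) (v, ord_max) d phi ->
  (forall a b : G * 'I_tau.+1, b.2 != a.2.+1 :> nat -> phi a b = 0) ->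
  exists (I : finType) (wt : I -> R) (pos : I -> nat -> G),
    [/\ forall i, 0 <= wt i,
        forall x y, \sum_(i | (pos i 0%N == x) && (pos i tau == y)) wt i =
          ((x == u) && (y == v))%:R * d &
        forall t x y, (t < tau)%N ->
          wload wt pos t x y = phi (x, inord t) (y, inord t.+1)].
Proof.
move=> tau0 d0 [phi0 cons] lay.
pose F t x y := phi (x, inord t) (y, inord t.+1).
have row (f : G * 'I_tau.+1 -> R) t : (t <= tau)%N ->
  (forall b : G * 'I_tau.+1, b.2 != t :> nat -> f b = 0) -> \sum_b f b = \sum_y f (y, inord t).
  move=> tt fz; rewrite (eq_bigr (fun b => f (b.1, b.2))); last by case.
  rewrite -(pair_big xpredT xpredT (fun y j => f (y, j))) /=; apply: eq_bigr => y _.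
  rewrite (bigD1 (inord t)) //= big1 ?addr0 // => j jt; apply: fz => /=.
  by apply: contra jt => /eqP e; rewrite -(inj_eq val_inj) /= inordK // e.
have out t x : (t < tau)%N -> \sum_b phi (x, inord t) b = \sum_y F t x y.
  by move=> tt; apply: (row _ t.+1) => // b bt; apply: lay; rewrite /= inordK // ltnS ltnW.
have outT x : \sum_b phi (x, inord tau) b = 0.
  apply: big1 => b _; apply: lay; rewrite /= inordK //.
  by rewrite neq_ltn ltnS -ltnS ltn_ord.
have inn t x : (t < tau)%N -> \sum_b phi b (x, inord t.+1) = \sum_y F t y x.
  move=> tt; apply: (row (fun b => phi b (x, inord t.+1)) t); first exact: ltnW.
  by move=> b bt; apply: lay; rewrite /= inordK // eqSS eq_sym.
have inn0 x : \sum_b phi b (x, inord 0) = 0.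
  by apply: big1 => b _; apply: lay; rewrite /= inordK.
have eq0 t : (t <= tau)%N -> (inord t == ord0 :> 'I_tau.+1) = (t == 0%N).
  by move=> tt; rewrite -(inj_eq val_inj) /= inordK.
have eqT t : (t <= tau)%N -> (inord t == ord_max :> 'I_tau.+1) = (t == tau).
  by move=> tt; rewrite -(inj_eq val_inj) /= inordK.
have bal t x : (t <= tau)%N -> \sum_b phi (x, inord t) b - \sum_b phi b (x, inord t) =
    ((x == u) && (t == 0%N))%:R * d - ((x == v) && (t == tau))%:R * d.
  by move=> tt; rewrite cons !xpair_eqE eq0 // eqT.
have start x : \sum_y F 0%N x y = (x == u)%:R * d.
  have := bal 0%N x (leq0n _); rewrite out // inn0 subr0 eqxx andbT.
  by rewrite (ltn_eqF tau0) andbF mul0r subr0.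
have finish y : \sum_x F tau.-1 x y = (y == v)%:R * d.
  have e := inn tau.-1 y; rewrite prednK // leqnn in e.
  have := bal tau y (leqnn _); rewrite outT sub0r e //.
  by rewrite eqxx andbT (gtn_eqF tau0) andbF mul0r sub0r => /oppr_inj.
have [t x y|x|x _|t y tt|I [wt [pos [w0 wi wl]]]] :=
    @layered_flow_walks R G tau F (fun x => (x == u)%:R * d).
- exact: phi0.
- by rewrite mulr_ge0.
- exact: start.
- have := bal t.+1 y (ltnW tt); rewrite out // inn ?(ltnW tt) //= (ltn_eqF tt) !andbF.
  by rewrite !mul0r subr0 => /eqP; rewrite subr_eq0 => /eqP.
exists I, wt, pos; split=> // x y.
have wz i : pos i 0%N != u -> wt i = 0.
  move=> iu; have := wi (pos i 0%N); rewrite (negbTE iu) mul0r => /eqP.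
  by rewrite psumr_eq0 // => /allP/(_ i (mem_index_enum i)); rewrite eqxx => /eqP.
have wz' i : pos i tau != v -> wt i = 0.
  move=> iu; have e : \sum_(j | pos j tau == pos i tau) wt j = 0.
    rewrite -{1}(prednK tau0) -sum_wload_in.
    under eq_bigr => z _ do rewrite wl ?prednK //.
    have := finish (pos i tau); rewrite (negbTE iu) mul0r => fin; rewrite -[RHS]fin.
    by apply: eq_bigr => z _; rewrite /F prednK.
  move/eqP: e; rewrite psumr_eq0 // => /allP/(_ i (mem_index_enum i)).
  by rewrite eqxx => /eqP.
have [xu|xu] := eqVneq x u; last first.
  by rewrite mul0r big1 // => i /andP[/eqP ix _]; rewrite wz // ix.
have [yv|yv] := eqVneq y v; last first.
  by rewrite mul0r big1 // => i /andP[_ /eqP iy]; rewrite wz' // iy.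
rewrite mul1r; have := wi u; rewrite eqxx mul1r => <-; rewrite xu yv.
rewrite [RHS](bigID (fun i => pos i tau == v)) /= [X in _ = _ + X]big1 ?addr0 //.
by move=> i /andP[_]; apply: wz'.
Qed.

Lemma mcf_routing (R : realType) (G : sgraph) (K : {set G}) (n' : R) (tau : nat) :
  (0 < tau)%N -> 0 <= n' -> mcf_feasible K n' tau ->
  routing tau 1 (fun u v => ((u \in K) && (v \in K))%:R * (n' / #|K|%:R)).
Proof.
move=> tau0 n0 [phi [flow cap]].
pose d := n' / #|K|%:R; have d0 : 0 <= d by rewrite divr_ge0.
pose inK (p : G * G) := (p.1 \in K) && (p.2 \in K).
have phi0 p a b : inK p -> 0 <= phi p.1 p.2 a b.
  by move=> /andP[uK vK]; have [] := flow _ _ uK vK.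
have phile p a b (c : R) : inK p -> ((\sum_(u in K) \sum_(v in K) phi u v a b)%:E <= c%:E)%E ->
    phi p.1 p.2 a b <= c.
  case/andP => uK vK; rewrite lee_fin; apply: le_trans.
  rewrite (bigD1 p.1) //= (bigD1 p.2) //= -addrA lerDl addr_ge0 ?sumr_ge0 // => [v /andP[vK' _]|u /andP[uK' _]].
    by apply: (phi0 (p.1, v)); rewrite /inK uK.
  by apply: sumr_ge0 => v vK'; apply: (phi0 (u, v)); rewrite /inK uK'.
have lay p (a b : G * 'I_tau.+1) : inK p -> b.2 != a.2.+1 :> nat -> phi p.1 p.2 a b = 0.
  move=> pK ab; apply/eqP; rewrite eq_le phi0 // andbT.
  by apply: (phile _ _ _ 0 pK); have := cap a b; rewrite /timed_cap (negbTE ab).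
(* Pairs outside [K] get a family of weight zero, so that one choice function covers all pairs and
   the families merge into a tagged sum. *)
have walks p : exists X : {I : finType & ((I -> R) * (I -> nat -> G))%type},
   let wt := (projT2 X).1 in let pos := (projT2 X).2 in
    [/\ forall i, 0 <= wt i,
        forall x y, \sum_(i | (pos i 0%N == x) && (pos i tau == y)) wt i =
          (inK p && (p == (x, y)))%:R * d &
        forall t x y, (t < tau)%N ->
          wload wt pos t x y = if inK p then phi p.1 p.2 (x, inord t) (y, inord t.+1) else 0].
  have [pK|pK] := boolP (inK p).
    have /andP[uK vK] := pK.
    have [I [wt [pos [h1 h2 h3]]]] := flow_walks tau0 d0 (flow _ _ uK vK) (fun a b => lay p a b pK).
    exists (existT _ I (wt, pos)); split=> // x y; rewrite h2.
    by case: (p) => a b /=; rewrite xpair_eqE [a == x]eq_sym [b == y]eq_sym.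
  exists (existT (fun I : finType => ((I -> R) * (I -> nat -> G))%type) (vert G)
    (fun _ => 0, fun x _ => x)); split=> // [x y|t x y _].
    by rewrite big1 // mul0r.
  by rewrite /wload big1.
have [f fP] := choice walks.
pose I := {p : G * G & projT1 (f p)}.
pose wt (i : I) := (projT2 (f (tag i))).1 (tagged i).
pose pos (i : I) := (projT2 (f (tag i))).2 (tagged i).
have sumI (P : forall p, pred (projT1 (f p))) :
   \sum_(i : I | P (tag i) (tagged i)) wt i = \sum_p \sum_(j | P p j) (projT2 (f p)).1 j.
  by rewrite (sig_big_dep xpredT P (fun p j => (projT2 (f p)).1 j)).
exists I, wt, pos; split.
- by move=> i; have [h _ _] := fP (tag i); apply: h.
- move=> x y; rewrite (sumI (fun p j => ((projT2 (f p)).2 j 0%N == x) && ((projT2 (f p)).2 j tau == y))).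
  rewrite (bigD1 (x, y)) //= [X in _ + X]big1 ?addr0.
    by have [_ h _] := fP (x, y); apply: etrans (h x y) _; rewrite eqxx andbT.
  move=> p /negbTE pxy; have [_ h _] := fP p; apply: etrans (h x y) _.
  by rewrite pxy andbF mul0r.
- move=> t x y tt xy; rewrite mulr1 /wload.
  rewrite (sumI (fun p j => ((projT2 (f p)).2 j t == x) && ((projT2 (f p)).2 j t.+1 == y))).
  have -> : \sum_p \sum_(j | ((projT2 (f p)).2 j t == x) && ((projT2 (f p)).2 j t.+1 == y)) (projT2 (f p)).1 j =
     \sum_(u in K) \sum_(v in K) phi u v (x, inord t) (y, inord t.+1).
    rewrite pair_big_dep /= [RHS]big_mkcond /=; apply: eq_bigr => p _.
    by have [_ _ h] := fP p; apply: h.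
  have := cap (x, inord t) (y, inord t.+1); rewrite /timed_cap /= !inordK ?ltnS ?(ltnW tt) // eqxx.
  by rewrite (negbTE xy); case: (edge x y); rewrite lee_fin.
Qed.

(* Valiant's trick: every item first goes to a random intermediate terminal, so
   that an arbitrary balanced set of demands is as easy as the uniform one. *)
Lemma two_phase_walks (R : realType) (G : sgraph) (K : {set G}) (n' : R) (tau h L : nat)
    (J : finType) (src dst : J -> G) :
  (0 < tau)%N -> 0 < n' -> mcf_feasible K n' tau ->
  (forall j, src j \in K) -> (forall j, dst j \in K) ->
  (forall u, (#|[set j | src j == u]| <= h)%N) ->
  (forall u, (#|[set j | dst j == u]| <= h)%N) ->
  (tau + tau)%:R * #|G|%:R ^+ 2 * expR (h%:R / n') <= 2 ^+ L ->
  exists p : J -> nat -> G,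
    [/\ forall j, p j 0%N = src j, forall j, p j (tau + tau)%N = dst j,
        forall j t, (t < tau + tau)%N -> p j t != p j t.+1 -> edge (p j t) (p j t.+1) &
        forall t x y, (t < tau + tau)%N -> x != y ->
          (#|[set j | (p j t == x) && (p j t.+1 == y)]| <= L)%N].
Proof.
move=> tau0 n0 feas srcK dstK srch dsth Lbig.
have [j0 _|J0] := pickP (fun _ : J => true); last first.
  exists (fun j _ => src j); split=> // [j|j|t x y _ _]; [by have := J0 j | by have := J0 j |].
  by rewrite (_ : [set _ | _] = finset.set0) ?cards0 //; apply/setP => j; have := J0 j.
have K0 : (0 < #|K|)%N by apply/card_gt0P; exists (src j0).
have kR : 0 < #|K|%:R :> R by rewrite ltr0n.
have [I [wt [pos [w0 wm wl]]]] := mcf_routing tau0 (ltW n0) feas.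
pose d := n' / #|K|%:R; have d0 : 0 < d by rewrite divr_gt0.
have kd : #|K|%:R * d = n' by rewrite mulrC divfK ?gt_eqF.
pose A1 j i := pos i 0%N == src j.
pose A2 j i := pos i tau == dst j.
pose nd := (n' * d)^-1; have nd0 : 0 < nd by rewrite invr_gt0 mulr_gt0.
(* Item [j] takes a pair of walks that meet at a terminal, with probability proportional to the
   product of their weights. Summing over the meeting point gives [#|K| * d ^ 2 = n' * d], hence the
   normalization [nd]. *)
pose pr j (q : I * I) : R := nd * (((A1 j q.1)%:R * wt q.1) * ((A2 j q.2)%:R * wt q.2)
   * (pos q.1 tau == pos q.2 0%N)%:R).
have pr0 j q : 0 <= pr j q by rewrite /pr !mulr_ge0 // ltW.
have sum2 j i1 : \sum_i2 pr j (i1, i2) =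
    nd * ((A1 j i1)%:R * wt i1 * ((pos i1 tau \in K)%:R * d)).
  rewrite /pr /= -mulr_sumr; congr (_ * _).
  under eq_bigr => i2 _ do rewrite -mulrA.
  rewrite -mulr_sumr; congr (_ * _).
  rewrite (sum_mulb (fun i2 => pos i1 tau == pos i2 0%N)).
  have := wm (pos i1 tau) (dst j); rewrite dstK andbT => <-.
  rewrite big_mkcond [RHS]big_mkcond; apply: eq_bigr => i2 _.
  by rewrite /A2 [pos i2 0%N == _]eq_sym; case: eqP; case: eqP; rewrite ?mul1r ?mul0r.
have sum1 j i2 : \sum_i1 pr j (i1, i2) =
    nd * ((A2 j i2)%:R * wt i2 * ((pos i2 0%N \in K)%:R * d)).
  rewrite /pr /= -mulr_sumr; congr (_ * _).
  under eq_bigr => i1 _ do rewrite [_ * _ * ((A2 _ _)%:R * _)]mulrC -mulrA.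
  rewrite -mulr_sumr; congr (_ * _).
  rewrite (sum_mulb (fun i1 => pos i1 tau == pos i2 0%N)).
  have := wm (src j) (pos i2 0%N); rewrite srcK /= => <-.
  rewrite big_mkcond [RHS]big_mkcond; apply: eq_bigr => i1 _.
  by rewrite /A1; case: eqP; case: eqP; rewrite ?mul1r ?mul0r.
have ndd : nd * d = n'^-1 by rewrite /nd invfM -mulrA mulVf ?mulr1 ?gt_eqF.
have pr1 j : \sum_q pr j q = 1.
  rewrite (sum_pair_fst xpredT) /=.
  under eq_bigr => i1 _ do rewrite sum2.
  rewrite -mulr_sumr (partition_big (fun i => pos i tau) xpredT) //=.
  rewrite (eq_bigr (fun w => (w \in K)%:R * (d * d))).
    rewrite -mulr_suml mulrCA [nd * (d * d)]mulrA ndd.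
    have -> : \sum_(w : G) (w \in K)%:R = #|K|%:R :> R.
      rewrite (eq_bigr (fun w => if w \in K then 1 else 0)) => [|w _]; last by case: (w \in K).
      by rewrite -big_mkcond sumr_const.
    by rewrite mulrCA kd mulVf // gt_eqF.
  move=> w _; have := wm (src j) w; rewrite srcK /= => hw.
  transitivity (\sum_(i | (pos i 0%N == src j) && (pos i tau == w)) wt i * ((w \in K)%:R * d)).
    rewrite big_mkcond [RHS]big_mkcond; apply: eq_bigr => i _; rewrite /A1.
    by case: (pos i tau =P w) => [->|]; case: eqP; rewrite ?mul1r ?mul0r.
  rewrite -mulr_suml hw mulrACA; congr (_ * _).
  by case: (w \in K); rewrite ?mul1r ?mul0r.
pose walk (q : I * I) t := if (t <= tau)%N then pos q.1 t else pos q.2 (t - tau)%N.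
pose use (q : I * I) (e : 'I_(tau + tau) * (G * G)) :=
  [&& e.2.1 != e.2.2, walk q e.1 == e.2.1 & walk q e.1.+1 == e.2.2].
(* In either phase an item uses walk [i] with probability at most [wt i / n'], and only if its
   endpoint matches. At most [h] items match, and the walks load an edge by at most 1. *)
have count (f : J -> G) (A : J -> I -> bool) (P : pred I) t x y : (t < tau)%N -> x != y ->
    (forall u, (#|[set j | f j == u]| <= h)%N) ->
    (exists g : I -> G, forall j i, A j i = (g i == f j)) ->
    \sum_j \sum_(i | (pos i t == x) && (pos i t.+1 == y)) (A j i)%:R * wt i * n'^-1 <= h%:R / n'.
  move=> tt xy fh [g gA]; rewrite exchange_big /=.
  apply: (@le_trans _ _ (h%:R / n' * wload wt pos t x y)); last first.
    rewrite -[leRHS]mulr1 ler_wpM2l ?divr_ge0 ?(ltW n0) // (le_trans (wl t x y tt xy)) //.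
    by rewrite mulr1 lern1 leq_b1.
  rewrite mulr_sumr; apply: ler_sum => i _.
  rewrite -mulr_suml -mulr_suml mulrAC ler_wpM2r // ler_wpM2r ?invr_ge0 ?(ltW n0) //.
  rewrite -natr_sum ler_nat (leq_trans _ (fh (g i))) // -sum1_card [leqRHS]big_mkcond.
  by apply: leq_sum => j _; rewrite inE gA eq_sym; case: eqP.
have load e : \sum_j \sum_q pr j q * (use q e)%:R <= h%:R / n'.
  case: e => t [x y]; have hn : 0 <= h%:R / n' by rewrite divr_ge0 // ltW.
  have [xy|xy] := eqVneq x y.
    by rewrite big1 // => j _; rewrite big1 // => q _; rewrite /use /= xy eqxx mulr0.
  have [tt|tt] := ltnP t tau.
    apply: le_trans (count src A1 xpredT t x y tt xy srch _); last by exists (fun i => pos i 0%N).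
    apply: ler_sum => j _; rewrite sum_mulb (eq_bigl (fun q : I * I => (pos q.1 t == x) && (pos q.1 t.+1 == y))).
      rewrite (sum_pair_fst (fun i => (pos i t == x) && (pos i t.+1 == y))).
      apply: ler_sum => i _; rewrite sum2 -ndd mulrCA ler_wpM2l ?mulr_ge0 // ler_wpM2l ?(ltW nd0) //.
      by rewrite ler_piMl ?(ltW d0) // lern1 leq_b1.
    by move=> q; rewrite /use /= xy /walk tt (ltnW tt).
  have tt' : (t - tau < tau)%N by rewrite ltn_subLR.
  apply: le_trans (count dst A2 xpredT (t - tau)%N x y tt' xy dsth _); last by exists (fun i => pos i tau).
  apply: ler_sum => j _.
  apply: (@le_trans _ _ (\sum_(q : I * I | (pos q.2 (t - tau)%N == x) && (pos q.2 (t - tau).+1 == y)) pr j q)).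
    rewrite [leRHS]big_mkcond; apply: ler_sum => q _.
    have [e|ne] := eqVneq (pos q.1 tau) (pos q.2 0%N); last first.
      by rewrite /pr (negbTE ne) !mulr0 mul0r if_same.
    have -> : use q (t, (x, y)) = (pos q.2 (t - tau)%N == x) && (pos q.2 (t - tau).+1 == y).
      rewrite /use /= xy /walk [(t < tau)%N]ltnNge tt /= subSn //.
      have [->|tn] := eqVneq (t : nat) tau; first by rewrite leqnn subnn e.
      suff -> : (t <= tau)%N = false by [].
      by apply/negbTE; rewrite -ltnNge ltn_neqAle eq_sym tn.
    by case: ifP; rewrite ?mulr1 ?mulr0.
  rewrite (sum_pair_snd (fun i => (pos i (t - tau)%N == x) && (pos i (t - tau).+1 == y))).
  apply: ler_sum => i _; rewrite sum1 -ndd mulrCA ler_wpM2l ?mulr_ge0 // ler_wpM2l ?(ltW nd0) //.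
  by rewrite ler_piMl ?(ltW d0) // lern1 leq_b1.
have [c [cpos cload]] := rounding pr0 pr1 load.
have cP j : [/\ A1 j (c j).1, A2 j (c j).2, pos (c j).1 tau = pos (c j).2 0%N,
    0 < wt (c j).1 & 0 < wt (c j).2].
  have := cpos j; rewrite /pr pmulr_rgt0 //.
  have := w0 (c j).1; have := w0 (c j).2; rewrite !le_eqVlt.
  case/predU1P => [<-|->]; first by rewrite mulr0 mulr0 mul0r ltxx.
  case/predU1P => [<-|->]; first by rewrite mulr0 mul0r mul0r ltxx.
  case: (A1 j _); last by rewrite !mul0r ltxx.
  case: (A2 j _); last by rewrite mul0r mulr0 mul0r ltxx.
  by case: eqP => // _; rewrite mulr0 ltxx.
have step i t : (t < tau)%N -> 0 < wt i -> pos i t != pos i t.+1 -> edge (pos i t) (pos i t.+1).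
  move=> tt wi ne; apply: contraLR (ne) => nedge; rewrite negbK.
  have := wl t _ _ tt ne; rewrite (negbTE nedge) mul0r.
  rewrite /wload (bigD1 i) ?eqxx //= => le.
  have : wt i <= 0 by apply: le_trans le; rewrite lerDl sumr_ge0.
  by rewrite leNgt wi.
exists (fun j => walk (c j)); split.
- by move=> j; have [/eqP h1 _ _ _ _] := cP j; rewrite /walk leq0n.
- move=> j; have [_ /eqP h1 _ _ _] := cP j.
  by rewrite /walk -[leqRHS]addn0 leq_add2l leqNgt tau0 addnK.
- move=> j t tt; have [_ _ e w1 w2] := cP j; rewrite /walk.
  have [t1|t1] := ltnP t tau; first by rewrite (ltnW t1) => ne; apply: step.
  have t2 : (t - tau < tau)%N by rewrite ltn_subLR.
  have -> : (if (t <= tau)%N then pos (c j).1 t else pos (c j).2 (t - tau)%N) = pos (c j).2 (t - tau)%N.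
    have [et|et] := eqVneq t tau; first by rewrite et leqnn subnn e.
    suff -> : (t <= tau)%N = false by [].
    by apply/negbTE; rewrite -ltnNge ltn_neqAle eq_sym et.
  by rewrite subSn // => ne; apply: step.
- move=> t x y tt xy; have := cload (Ordinal tt, (x, y)).
  rewrite !card_prod card_ord natrM [(#|_| * #|_|)%:R]natrM -expr2 => le.
  have {le}le := le_trans le Lbig; rewrite ler_eXn2l ?ltr1n // in le.
  apply: leq_trans le; apply/subset_leq_card/subsetP => j.
  by rewrite !inE /use /= xy.
Qed.

(** * Element distinctness by sorting *)

(* The smaller [kappa u], the more u knows about the input after T rounds. *)
Definition attainable (G : sgraph) (K : {set G}) (n T : nat)
    (kappa : G -> input K n -> input K n -> Prop) : Prop :=
  exists P : protocol G n, forall u x x',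
    local_input x u = local_input x' u -> history P x T u = history P x' T u ->
    kappa u x x'.

Section Knowledge.
Variables (G : sgraph) (K : {set G}) (n : nat).
Local Notation input := (input K n).

Lemma attainable0 :
  attainable 0 (fun u (x x' : input) => local_input x u = local_input x' u).
Proof. by exists (Protocol (fun _ _ _ _ => false) (fun _ _ _ => false)). Qed.

Lemma attainable_weaken T (k1 k2 : G -> input -> input -> Prop) :
  (forall u x x', k1 u x x' -> k2 u x x') -> attainable T k1 -> attainable T k2.
Proof. by move=> h [P hP]; exists P => u x x' e1 e2; apply/h/hP. Qed.

Lemma size_history (P : protocol G n) (x : input) t u : size (history P x t u) = t.
Proof. by elim: t u => //= t IH u; rewrite size_rcons IH. Qed.

(** The sender asks whether some input consistent with all it has seen makes the bit true. As its
    knowledge [kappa] determines the bit, every consistent input gives the right answer. *)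
Lemma attainable_step T (kappa : G -> input -> input -> Prop) (b : G -> G -> input -> bool) :
  attainable T kappa ->
  (forall u v x x', kappa u x x' -> b u v x = b u v x') ->
  attainable T.+1 (fun v x x' =>
    kappa v x x' /\ forall u, edge u v -> b u v x = b u v x').
Proof.
move=> [P hP] bk.
pose m u v a h := if size h == T then
  `[< exists x : input, [/\ local_input x u = a, history P x T u = h & b u v x] >]
  else msg P u v a h.
pose P' := Protocol m (out P).
have same (x : input) t u : (t <= T)%N -> history P' x t u = history P x t u.
  elim: t u => //= t IH u tT; rewrite IH ?(ltnW tT) //; congr rcons.
  apply/ffunP => w; rewrite !ffunE IH ?(ltnW tT) //=.
  by rewrite /P' /m /= size_history ltn_eqF.
have mb x u v : m u v (local_input x u) (history P x T u) = b u v x.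
  rewrite /m size_history eqxx; apply/asboolP/idP => [[x' [e1 e2 bx']]|bx].
    by rewrite -(bk _ _ _ _ (hP _ _ _ e1 e2)).
  by exists x.
exists P' => v x x' e1; rewrite /= !same // => /rcons_inj[e2 e3]; split.
  exact: hP.
by move=> u uv; have /ffunP/(_ u) := e3; rewrite !ffunE uv /= !same // !mb.
Qed.

(* L rounds simulate a step of the walks, each edge carrying at most L of them. *)
Lemma attainable_walks T tau L (kappa : G -> input -> input -> Prop) (J : finType)
    (beta : J -> input -> bool) (p : J -> nat -> G) :
  attainable T kappa ->
  (forall j x x', kappa (p j 0%N) x x' -> beta j x = beta j x') ->
  (forall j t, (t < tau)%N -> p j t != p j t.+1 -> edge (p j t) (p j t.+1)) ->
  (forall t x y, (t < tau)%N -> x != y ->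
     (#|[set j | (p j t == x) && (p j t.+1 == y)]| <= L)%N) ->
  attainable (T + L * tau) (fun u x x' =>
    kappa u x x' /\ forall j, p j tau = u -> beta j x = beta j x').
Proof.
move=> att src; elim: tau => [|t IH] steps cong.
  by rewrite muln0 addn0; apply: attainable_weaken att => u x x' k; split=> // j ju; apply: src; rewrite ju.
have {}IH := IH (fun j s st => steps j s (ltnW st)) (fun s x y st => cong s x y (ltnW st)).
pose A u v := [set j | (p j t == u) && (p j t.+1 == v)].
(* State after [l] of the [L] rounds: of the items crossing an edge, the first [l] in enumeration
   order have arrived. *)
pose k1 l u (x x' : input) := (kappa u x x' /\ (forall j, p j t = u -> beta j x = beta j x')) /\
  (forall j, p j t != u -> p j t.+1 = u -> (index j (enum (A (p j t) u)) < l)%N ->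
     beta j x = beta j x').
suff att1 l : attainable (T + L * t + l) (k1 l).
  rewrite mulnS [(L + _)%N]addnC addnA; apply: attainable_weaken (att1 L).
  move=> u x x' [[k kt] k2]; split=> // j ju.
  have [e|ne] := eqVneq (p j t) u; first exact: kt.
  apply: k2 => //; apply: leq_trans (cong t (p j t) u _ ne); rewrite // cardE index_mem mem_enum.
  by rewrite inE eqxx ju eqxx.
elim: l => [|l IHl].
  by rewrite addn0; apply: attainable_weaken IH => u x x' k; split.
rewrite addnS.
pose b u v x := nth false [seq beta j x | j <- enum (A u v)] l.
have bk u v x x' : k1 l u x x' -> b u v x = b u v x'.
  move=> [[_ kt] _]; congr (nth _ _ _); apply/eq_in_map => j.
  by rewrite mem_enum inE => /andP[/eqP/kt].
apply: attainable_weaken (attainable_step IHl bk) => u x x' [[k0 k2] kb]; split=> // j ne ju.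
rewrite ltnS leq_eqVlt => /predU1P[e|]; last exact: k2.
have ed : edge (p j t) u by rewrite -ju; apply: steps; rewrite // ju.
have := kb _ ed; rewrite /b.
have jA : j \in enum (A (p j t) u) by rewrite mem_enum inE eqxx ju eqxx.
by rewrite !(nth_map j) -?e ?index_mem // !nth_index.
Qed.

Lemma attainable_det_rounds T (kappa : G -> input -> input -> Prop) (f : input -> bool) :
  attainable T kappa ->
  (forall u x x', u \in K -> kappa u x x' -> f x = f x') -> det_rounds f T.
Proof.
move=> [P hP] kf.
pose o u a h := `[< exists x : input, [/\ local_input x u = a, history P x T u = h & f x] >].
pose P' := Protocol (msg P) o.
have same (x : input) t u : history P' x t u = history P x t u.
  by elim: t u => //= t IH u; rewrite IH; congr rcons; apply/ffunP => w; rewrite !ffunE IH.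
exists P' => x; apply/forallP => u; apply/implyP => uK; apply/eqP.
rewrite /= same; apply/asboolP/idP => [[x' [e1 e2 fx']]|fx]; last by exists x.
by rewrite -(kf _ _ _ uK (hP _ _ _ e1 e2)).
Qed.

End Knowledge.

(* A layer of comparators is given by the partner of each wire. *)
Definition compare_exchange (p : nat -> nat) (y : nat -> nat) (i : nat) : nat :=
  if (i <= p i)%N then minn (y i) (y (p i)) else maxn (y i) (y (p i)).

Definition run (net : seq (nat -> nat)) (y : nat -> nat) : nat -> nat :=
  foldl (fun y p => compare_exchange p y) y net.

Definition network_on (N : nat) (net : seq (nat -> nat)) : Prop :=
  forall k i, (k < size net)%N -> (i < N)%N ->
    let p := nth id net k in (p i < N)%N /\ p (p i) = i.

Definition on_residues (p : nat -> nat) (i : nat) : nat := (p i./2).*2 + odd i.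
Definition on_blocks (N : nat) (p : nat -> nat) (i : nat) : nat :=
  (i %/ N * N + p (i %% N))%N.
(** Compares wires [2j + 1] and [2j + 2]; for even [N] the first and the last wire are their own
    partners, the first because [0.-1] is 0. *)
Definition merge_last (N i : nat) : nat :=
  if odd i then if (i.+1 < N)%N then i.+1 else i else i.-1.

(* Batcher's odd-even merge sort. *)
Fixpoint merge_net (d : nat) : seq (nat -> nat) :=
  if d is d'.+1 then rcons (map on_residues (merge_net d')) (merge_last (2 ^ d'.+2))
  else [:: fun i => (1 - i)%N].

Fixpoint sort_net (d : nat) : seq (nat -> nat) :=
  if d is d'.+1 then map (on_blocks (2 ^ d')) (sort_net d') ++ merge_net d'
  else [::].

Lemma run_cat s1 s2 y : run (s1 ++ s2) y = run s2 (run s1 y).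
Proof. exact: foldl_cat. Qed.

Lemma run_rcons s p y : run (rcons s p) y = compare_exchange p (run s y).
Proof. exact: foldl_rcons. Qed.

Lemma network_cons N p s : network_on N (p :: s) ->
  (forall i, (i < N)%N -> (p i < N)%N /\ p (p i) = i) /\ network_on N s.
Proof.
move=> h; split=> [i iN|k i ks iN]; first exact: (h 0%N i).
exact: (h k.+1 i).
Qed.

Lemma network_cat N s1 s2 : network_on N s1 -> network_on N s2 -> network_on N (s1 ++ s2).
Proof.
move=> h1 h2 k i; rewrite size_cat nth_cat => ks iN.
by case: ltnP => k1; [apply: h1 | apply: h2; rewrite // ltn_subLR].
Qed.

Lemma network_map N M g s : network_on N s ->
  (forall p, (forall i, (i < N)%N -> (p i < N)%N /\ p (p i) = i) ->
     forall i, (i < M)%N -> (g p i < M)%N /\ g p (g p i) = i) ->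
  network_on M (map g s).
Proof.
move=> h hg k i; rewrite size_map => ks iM; rewrite (nth_map id) //.
by apply: hg => // j jN; apply: h.
Qed.

Lemma on_residues_network N p :
  (forall i, (i < N)%N -> (p i < N)%N /\ p (p i) = i) ->
  forall i, (i < N.*2)%N -> (on_residues p i < N.*2)%N /\ on_residues p (on_residues p i) = i.
Proof.
move=> h i iN; rewrite /on_residues.
have hi : (i./2 < N)%N by rewrite ltn_half_double.
have [h1 h2] := h _ hi; split; first by case: (odd i); lia.
have -> : ((p i./2).*2 + odd i)./2 = p i./2 by case: (odd i); lia.
rewrite h2 oddD odd_double oddb addFb addnC.
exact: odd_double_half.
Qed.

Lemma on_blocks_network N p : (0 < N)%N ->
  (forall i, (i < N)%N -> (p i < N)%N /\ p (p i) = i) ->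
  forall i, (i < N.*2)%N -> (on_blocks N p i < N.*2)%N /\ on_blocks N p (on_blocks N p i) = i.
Proof.
move=> N0 h i iN; rewrite /on_blocks.
have [h1 h2] := h _ (ltn_pmod i N0).
rewrite divnMDl // modnMDl (divn_small h1) (modn_small h1) addn0 h2 -divn_eq; split=> //.
have : (i %/ N < 2)%N by rewrite ltn_divLR // mul2n.
by case: (i %/ N)%N => [|[|]] //; lia.
Qed.

Lemma merge_last_network M i : (i < M.*2)%N ->
  (merge_last M.*2 i < M.*2)%N /\ merge_last M.*2 (merge_last M.*2 i) = i.
Proof.
rewrite /merge_last => iM; case: (boolP (odd i)) => oi; last first.
  case: i iM oi => [|i] iM /=; first by [].
  by rewrite negbK => oi; rewrite oi iM; split=> //; apply: ltnW.
case: (ltnP i.+1 M.*2) => h; last by rewrite oi (leq_gtF h).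
by rewrite /= oi.
Qed.

Lemma merge_network d : network_on (2 ^ d.+1) (merge_net d).
Proof.
elim: d => [|d IH] /=.
  by move=> [|k] [|[|i]].
rewrite -cats1; apply: network_cat.
  rewrite expnS mul2n; apply: network_map IH _; exact: on_residues_network.
by move=> [|k] i //= _ iN; rewrite expnS mul2n in iN *; apply: merge_last_network.
Qed.

Lemma sort_network d : network_on (2 ^ d) (sort_net d).
Proof.
elim: d => [|d IH] //=; apply: network_cat; last exact: merge_network.
rewrite expnS mul2n; apply: network_map IH _ => p.
by apply: on_blocks_network; rewrite expn_gt0.
Qed.

Lemma size_merge_net d : size (merge_net d) = d.+1.
Proof. by elim: d => //= d IH; rewrite size_rcons size_map IH. Qed.

Lemma size_sort_net d : (size (sort_net d) <= d * d)%N.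
Proof.
elim: d => //= d IH; rewrite size_cat size_map size_merge_net.
by lia.
Qed.

Lemma run_ext N net y y' : network_on N net ->
  (forall i, (i < N)%N -> y i = y' i) -> forall i, (i < N)%N -> run net y i = run net y' i.
Proof.
elim: net y y' => [|p s IH] y y' /= h e; first exact: e.
have [hp hs] := network_cons h; apply: IH => // i iN.
by rewrite /compare_exchange !e //; case: (hp i iN).
Qed.

Lemma run_residues net y i (e : bool) :
  run (map on_residues net) y (i.*2 + e) = run net (fun j => y (j.*2 + e)%N) i.
Proof.
elim: net y => [|p s IH] y //=; rewrite IH; congr (run s _ i).
apply/funext => j; rewrite /compare_exchange /on_residues.
have -> : (j.*2 + e)./2 = j by clear; case: e; lia.
have -> : odd (j.*2 + e) = e by rewrite oddD odd_double oddb.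
by rewrite leq_add2r leq_double.
Qed.

Lemma run_blocks N net y b i : network_on N net -> (i < N)%N ->
  run (map (on_blocks N) net) y (b * N + i) = run net (fun j => y (b * N + j)%N) i.
Proof.
move=> h iN; have N0 : (0 < N)%N by apply: leq_trans iN.
elim: net y h => [|p s IH] y h //=; have [hp hs] := network_cons h.
rewrite IH //; apply: (run_ext hs) => // j jN.
rewrite /compare_exchange /on_blocks divnMDl // modnMDl divn_small // modn_small //.
by rewrite addn0 leq_add2l.
Qed.

(** The 0-1 principle: thresholds commute with minima and maxima. *)
Lemma run_threshold net y (t i : nat) :
  (t <= run net y i)%N = run net (fun j => (t <= y j)%N : nat) i :> nat.
Proof.
elim: net y => [|p s IH] y //=; rewrite IH; congr (run s _ i).
apply/funext => j; rewrite /compare_exchange; case: ifP => _.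
  by rewrite leq_min; case: (_ <= _)%N; case: (_ <= _)%N.
by rewrite leq_max; case: (_ <= _)%N; case: (_ <= _)%N.
Qed.

(** Here [z1] and [z2] count zeros. The merged even wires carry [uphalf z1 + uphalf z2] zeros and
    the odd ones [z1./2 + z2./2]. These differ by at most two, so one layer of neighbour comparisons
    repairs the order. *)
Lemma merge_correct d y z1 z2 : (z1 <= 2 ^ d)%N -> (z2 <= 2 ^ d)%N ->
  (forall i, (i < 2 ^ d)%N -> y i = (z1 <= i)%N :> nat) ->
  (forall i, (i < 2 ^ d)%N -> y (2 ^ d + i)%N = (z2 <= i)%N :> nat) ->
  forall i, (i < 2 ^ d.+1)%N -> run (merge_net d) y i = (z1 + z2 <= i)%N :> nat.
Proof.
elim: d y z1 z2 => [|d IH] y z1 z2 hz1 hz2 y1 y2 i iN.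
  have e0 := y1 0%N isT; have e1 := y2 0%N isT; rewrite /= in e1.
  rewrite /= /compare_exchange.
  by case: i iN => [|[|i]] // _; rewrite /= ?subn0 ?subnn ?e0 ?e1;
    case: (z1) hz1 => [|[|?]] //; case: (z2) hz2 => [|[|?]].
rewrite /= run_rcons.
have D : (2 ^ d.+1 = (2 ^ d).*2)%N by rewrite expnS mul2n.
have D2 : (2 ^ d.+2 = (2 ^ d.+1).*2)%N by rewrite expnS mul2n.
have we j : (j < 2 ^ d.+1)%N ->
    run (map on_residues (merge_net d)) y j.*2 = (uphalf z1 + uphalf z2 <= j)%N :> nat.
  move=> jN; have := run_residues (merge_net d) y j false; rewrite addn0 => ->.
  apply: (IH _ (uphalf z1) (uphalf z2)) => // [||k kd|k kd].
  - by rewrite leq_uphalf_double -D.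
  - by rewrite leq_uphalf_double -D.
  - by rewrite addn0 y1 ?D ?ltn_double // leq_uphalf_double.
  - rewrite addn0 doubleD -D y2 ?leq_uphalf_double //; by rewrite D ltn_double.
have wo j : (j < 2 ^ d.+1)%N ->
    run (map on_residues (merge_net d)) y j.*2.+1 = (z1./2 + z2./2 <= j)%N :> nat.
  have hd a b : (a <= b.*2.+1)%N = (a./2 <= b)%N by rewrite leq_half_double.
  move=> jN; have := run_residues (merge_net d) y j true; rewrite addn1 => ->.
  apply: (IH _ z1./2 z2./2) => // [||k kd|k kd].
  - by rewrite leq_half_double -D leqW.
  - by rewrite leq_half_double -D leqW.
  - by rewrite addn1 y1 ?hd // D -doubleS leq_double.
  - rewrite addn1 doubleD -D -addnS y2 ?hd //; by rewrite D -doubleS leq_double.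
move: (run _ y) we wo => w we wo.
have u1 := uphalf_half z1; have u2 := uphalf_half z2.
have o1 := odd_double_half z1; have o2 := odd_double_half z2.
have b1 : (uphalf z1 <= 2 ^ d)%N by rewrite leq_uphalf_double -D.
have b2 : (uphalf z2 <= 2 ^ d)%N by rewrite leq_uphalf_double -D.
move: we wo u1 u2 o1 o2 b1 b2.
move: (uphalf z1) (uphalf z2) (z1./2) (z2./2) => c1 c2 h1 h2 we wo u1 u2 o1 o2 b1 b2.
have bo (b : bool) : (b <= 1)%N by case: b.
have q1 := bo (odd z1); have q2 := bo (odd z2).
rewrite /compare_exchange /merge_last; case: (boolP (odd i)) => oi.
  have iE : i = (i./2).*2.+1 by rewrite -[LHS]odd_double_half oi.
  case: ltnP => hi.
    have e1 : w i = (h1 + h2 <= i./2)%N by rewrite [in LHS]iE wo //; lia.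
    have e2 : w i.+1 = (c1 + c2 <= i./2.+1)%N.
      by rewrite [in LHS]iE -doubleS we //; lia.
    rewrite leqnSn e1 e2.
    have -> : (z1 + z2 <= i)%N = (h1 + h2 <= i./2)%N && (c1 + c2 <= i./2.+1)%N by lia.
    by case: (h1 + h2 <= _)%N; case: (c1 + c2 <= _)%N.
  have e1 : w i = (h1 + h2 <= i./2)%N by rewrite [in LHS]iE wo //; lia.
  rewrite leqnn minnn e1; congr nat_of_bool; lia.
have iE : i = (i./2).*2 by rewrite -[LHS]odd_double_half (negbTE oi).
case: (posnP i) => i0.
  have := we 0%N (expn_gt0 2 d.+1); rewrite i0 /= minnn => ->.
  congr nat_of_bool; lia.
have -> : (i <= i.-1)%N = false by lia.
have e1 : w i = (c1 + c2 <= i./2)%N by rewrite [in LHS]iE we //; lia.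
have e2 : w i.-1 = (h1 + h2 <= i./2.-1)%N.
  have -> : i.-1 = (i./2.-1).*2.+1 by lia.
  by rewrite wo //; lia.
rewrite e1 e2.
have -> : (z1 + z2 <= i)%N = (c1 + c2 <= i./2)%N || (h1 + h2 <= i./2.-1)%N by lia.
by case: (c1 + c2 <= _)%N; case: (h1 + h2 <= _)%N.
Qed.

Lemma sort_correct d (b : nat -> bool) i : (i < 2 ^ d)%N ->
  run (sort_net d) (fun j => b j : nat) i = (\sum_(j < 2 ^ d) ~~ b j <= i)%N :> nat.
Proof.
have le_sum D c : (\sum_(j < D) ~~ (c j : bool) <= D)%N.
  rewrite -[X in (_ <= X)%N]card_ord -sum1_card; apply: leq_sum => j _; exact: leq_b1.
elim: d b i => [|d IH] b i iN.
  by case: i iN => // _; rewrite big_ord1 /=; case: (b 0%N).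
rewrite /= run_cat.
have N2 : (2 ^ d.+1 = 2 ^ d + 2 ^ d)%N by rewrite expnS mul2n addnn.
rewrite N2 big_split_ord /=.
apply: (merge_correct (d := d)) => //.
- exact: le_sum.
- exact: (le_sum _ (fun j => b (2 ^ d + j)%N)).
- move=> j jN; have := run_blocks (fun j => b j : nat) 0 (@sort_network d) jN.
  by rewrite mul0n !add0n => ->; apply: IH.
- move=> j jN; have := run_blocks (fun j => b j : nat) 1 (@sort_network d) jN.
  by rewrite mul1n => ->; apply: (IH (fun j => b (2 ^ d + j)%N)).
Qed.

(** [C t] counts the inputs below [t], and by the 0-1 principle exactly the wires from [C t] on end
    with values at least [t]. So [v] occupies the wires from [C v] up to but excluding [C v.+1], and
    a repeated value two consecutive ones. *)
Lemma sort_distinct d (y : nat -> nat) :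
  let s := run (sort_net d) y in
  (forall i, (i.+1 < 2 ^ d)%N -> s i != s i.+1) <->
  (forall i j, (i < 2 ^ d)%N -> (j < 2 ^ d)%N -> y i = y j -> i = j).
Proof.
move=> s; set N := (2 ^ d)%N.
pose C t := (\sum_(j < N) (y j < t))%N.
have sC t i : (i < N)%N -> (t <= s i)%N = (C t <= i)%N.
  move=> iN; have := run_threshold (sort_net d) y t i.
  rewrite (sort_correct (fun j => (t <= y j)%N)) // => e.
  have -> : C t = (\sum_(j < N) ~~ (t <= y j))%N by apply: eq_bigr => j _; rewrite ltnNge.
  by apply: (can_inj oddb); rewrite /s e.
have Cs v : C v.+1 = (C v + #|[pred j : 'I_N | y j == v]|)%N.
  rewrite -sum1_card big_mkcond -big_split; apply: eq_bigr => j _ /=.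
  by rewrite inE ltnS leq_eqVlt; case: ltngtP.
split=> [adj i j iN jN yij|inj i iN].
  apply/eqP/negPn/negP => ij.
  have two : (2 <= #|[pred j : 'I_N | y j == y i]|)%N.
    rewrite (cardD1 (Ordinal iN)) inE /= eqxx (cardD1 (Ordinal jN)) !inE /= yij eqxx.
    by rewrite -(inj_eq val_inj) /= eq_sym ij.
  have CN : (C (y i).+1 <= N)%N.
    rewrite -[X in (_ <= X)%N]card_ord -sum1_card; apply: leq_sum => h _; exact: leq_b1.
  have := Cs (y i) => e.
  have c1 : ((C (y i)).+1 < N)%N by lia.
  have := adj _ c1; case/eqP.
  have h1 := sC (y i) _ (ltnW c1); have h2 := sC (y i).+1 _ (ltnW c1).
  have h3 := sC (y i) _ c1; have h4 := sC (y i).+1 _ c1.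
  by lia.
apply/negP => /eqP e.
have h1 := sC (s i) _ (ltnW iN); have h2 := sC (s i).+1 _ iN.
have : (1 < #|[pred j : 'I_N | y j == s i]|)%N.
  by have := Cs (s i); lia.
case/card_gt1P => j [k [jA kA]]; case/eqP; apply: val_inj.
have /eqP jv : y j == s i := jA.
have /eqP kv : y k == s i := kA.
exact: inj (ltn_ord j) (ltn_ord k) (etrans jv (esym kv)).
Qed.

Lemma eq_from_bits (m a b : nat) : (a < 2 ^ m)%N -> (b < 2 ^ m)%N ->
  (forall j, (j < m)%N -> odd (a %/ 2 ^ j) = odd (b %/ 2 ^ j)) -> a = b.
Proof.
elim: m a b => [|m IH] a b; first by rewrite !ltnS !leqn0 => /eqP -> /eqP ->.
rewrite expnS mul2n -!ltn_half_double => am bm bits.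
have h : a./2 = b./2.
  apply: IH => // j jm; have := bits j.+1 jm.
  by rewrite expnS !divnMA !divn2.
have := bits 0%N isT; rewrite !divn1 => o.
by rewrite -(odd_double_half a) -(odd_double_half b) h o.
Qed.

(** * Simulating the sorting network on the terminals *)

Section Wires.
Variables (R : realType) (G : sgraph) (K : {set G}) (n : nat) (n' : R) (tau d L : nat).
Hypotheses (tau0 : (0 < tau)%N) (n0 : 0 < n') (feas : mcf_feasible K n' tau).
Variable u0 : G.
Hypotheses (u0K : u0 \in K) (Kd : (#|K| <= 2 ^ d)%N) (dK : (2 ^ d <= 2 * #|K|)%N).
Local Notation m := (n + d).+1.
Hypothesis Lbig :
  (tau + tau)%:R * #|G|%:R ^+ 2 * expR ((2 * m)%:R / n') <= 2 ^+ L.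

Local Notation N := (2 ^ d)%N.
Local Notation T0 := (L * (tau + tau))%N.
Local Notation input := (input K n).

(* The terminals simulate the wires of the sorting network, one or two each. *)
Definition host (i : nat) : G := nth u0 (enum K) (i %% #|K|).

Let k0 : (0 < #|K|)%N. Proof. by apply/card_gt0P; exists u0. Qed.

Let hostK i : host i \in K.
Proof. by rewrite -mem_enum mem_nth // -cardE ltn_mod. Qed.

Let host_eq i j : (host i == host j) = (i == j %[mod #|K|])%N.
Proof. by rewrite nth_uniq -?cardE ?ltn_mod // enum_uniq. Qed.

Let host2 u : (#|[set i : 'I_N | host i == u]| <= 2)%N.
Proof.
apply: (@leq_trans #|{: bool}|); last by rewrite card_bool.
rewrite -(@card_in_imset _ _ (fun i : 'I_N => (#|K| <= i)%N) [set i : 'I_N | host i == u]) ?max_card //.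
move=> i j; rewrite !inE => /eqP iu /eqP ju e; apply: val_inj => /=.
have /eqP ij : (i == j %[mod #|K|])%N by rewrite -host_eq iu ju.
have q (h : 'I_N) : (h %/ #|K|)%N = (#|K| <= h)%N.
  have : (h %/ #|K| < 2)%N by rewrite ltn_divLR // (leq_trans (ltn_ord h)).
  have -> : (#|K| <= h)%N = (1 <= h %/ #|K|)%N by rewrite leq_divRL // mul1n.
  by case: (_ %/ _)%N => [|[|]].
by rewrite (divn_eq i #|K|) (divn_eq j #|K|) ij !q e.
Qed.

Definition wires_known (T : nat) (Y : nat -> input -> nat) : Prop :=
  attainable T (fun u (x x' : input) =>
    forall i, (i < N)%N -> host i = u -> Y i x = Y i x').

Definition wires_bounded (Y : nat -> input -> nat) : Prop :=
  forall i x, (i < N)%N -> (Y i x < 2 ^ m)%N.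

(** Wire [i] obtains the [m] bits of wire [rho i]. A terminal hosts at most two wires and [rho] is
    injective, so it sends and receives at most [2 * m] bits, the load in [Lbig]. Comparators and
    rotations are both of this form. *)
Lemma wire_layer T Y (rho : nat -> nat) (F : nat -> nat -> nat -> nat) :
  wires_known T Y -> wires_bounded Y ->
  (forall i, (i < N)%N -> (rho i < N)%N) ->
  (forall i j, (i < N)%N -> (j < N)%N -> rho i = rho j -> i = j) ->
  wires_known (T + T0) (fun i x => F i (Y i x) (Y (rho i) x)).
Proof.
move=> att Yb rhoN rhoI.
pose J := ('I_N * 'I_m)%type.
pose rh (i : 'I_N) := Ordinal (rhoN i (ltn_ord i)).
have rhI : injective rh.
  by move=> i j /(congr1 val) /= /rhoI e; apply: val_inj; apply: e.
pose src (j : J) := host (rho j.1); pose dst (j : J) := host j.1.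
pose beta (j : J) (x : input) := odd (Y (rho j.1) x %/ 2 ^ j.2).
have prodm (A : {set 'I_N}) : (#|A| <= 2)%N -> (#|setX A [set: 'I_m]| <= 2 * m)%N.
  by move=> A2; rewrite cardsX cardsT card_ord leq_mul2r A2 orbT.
have dsth u : (#|[set j | dst j == u]| <= 2 * m)%N.
  apply: leq_trans (prodm _ (host2 u)); apply/subset_leq_card/subsetP => j.
  by rewrite !inE andbT.
have srch u : (#|[set j | src j == u]| <= 2 * m)%N.
  have A2 : (#|[set i : 'I_N | host (rh i) == u]| <= 2)%N.
    apply: leq_trans (host2 u); rewrite -(card_imset _ rhI).
    by apply/subset_leq_card/subsetP => i /imsetP[j]; rewrite !inE => h ->.
  apply: leq_trans (prodm _ A2); apply/subset_leq_card/subsetP => j.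
  by rewrite !inE andbT.
have srcK (j : J) : src j \in K := hostK (rho j.1).
have dstK (j : J) : dst j \in K := hostK j.1.
have [p [p0 p1 ps pc]] := two_phase_walks tau0 n0 feas srcK dstK srch dsth Lbig.
have bsrc j (x x' : input) : (forall i, (i < N)%N -> host i = p j 0%N -> Y i x = Y i x') ->
    beta j x = beta j x'.
  by move=> h; rewrite /beta (h _ (rhoN _ (ltn_ord j.1)) (esym (p0 j))).
apply: attainable_weaken (attainable_walks att bsrc ps pc) => u x x' [h1 h2] i iN iu.
rewrite h1 //; congr F; have rN := rhoN i iN.
apply: (@eq_from_bits m); rewrite ?Yb //.
move=> j jm; apply: (h2 (Ordinal iN, Ordinal jm)).
by rewrite p1.
Qed.

Lemma wires_network T Y net : network_on N net ->
  wires_known T Y -> wires_bounded Y ->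
  wires_known (T + T0 * size net) (fun i x => run net (fun j => Y j x) i) /\
  wires_bounded (fun i x => run net (fun j => Y j x) i).
Proof.
elim: net T Y => [|p s IH] T Y net Yk Yb; first by rewrite muln0 addn0.
have [hp hs] := network_cons net.
rewrite mulnS addnA; apply: (IH _ (fun i x => compare_exchange p (fun j => Y j x) i) hs).
  apply: (wire_layer (fun i a b => if (i <= p i)%N then minn a b else maxn a b)) => //.
    by move=> i iN; case: (hp i iN).
  move=> i j iN jN e; case: (hp i iN) => _ <-; case: (hp j jN) => _ <-.
  by rewrite e.
move=> i x iN; have [piN _] := hp i iN; have := Yb i x iN; have := Yb _ x piN.
by rewrite /compare_exchange minnE maxnE; case: ifP => _; lia.
Qed.

(** Padding wires get distinct values above all codes, so they never create a collision. *)
Definition start (i : nat) (x : input) : nat :=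
  if (i < #|K|)%N then oapp (fun t => nat_of_ord (enum_rank t)) 0%N (local_input x (host i))
  else (2 ^ n + i)%N.

Let local_val (x : input) u (uK : u \in K) : local_input x u = Some (x (exist _ u uK)).
Proof. by rewrite /local_input insubT. Qed.

Let code_lt (t : n.-tuple bool) : (enum_rank t < 2 ^ n)%N.
Proof. by apply: leq_trans (ltn_ord _) _; rewrite card_tuple card_bool. Qed.

Lemma start_ED (x : input) :
  (forall i j, (i < N)%N -> (j < N)%N -> start i x = start j x -> i = j) <-> ED x.
Proof.
split=> [inj|/ED_P inj i j iN jN].
  apply/ED_P => -[u uK] [v vK] e; apply: val_inj => /=.
  have iu w : w \in K -> (index w (enum K) < #|K|)%N.
    by move=> wK; rewrite cardE index_mem mem_enum.
  have hu w : w \in K -> host (index w (enum K)) = w.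
    by move=> wK; rewrite /host modn_small ?iu // nth_index // mem_enum.
  have := inj (index u (enum K)) (index v (enum K)).
  rewrite /start !iu // !hu // (local_val x uK) (local_val x vK) /= e.
  move=> /(_ (leq_trans (iu _ uK) Kd) (leq_trans (iu _ vK) Kd) erefl) eq.
  by rewrite -(hu u uK) eq hu.
rewrite /start (local_val x (hostK i)) (local_val x (hostK j)) /=.
have ci := code_lt (x (exist (fun u => u \in K) _ (hostK i))); have cj := code_lt (x (exist (fun u => u \in K) _ (hostK j))).
case: ltnP => ik; case: ltnP => jk; last by move/addnI.
2: by move=> e; rewrite e ltnNge leq_addr in ci.
2: by move=> e; rewrite -e ltnNge leq_addr in cj.
move/ord_inj/enum_rank_inj/inj/(congr1 val) => /= /eqP; rewrite host_eq.
by rewrite !modn_small // => /eqP.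
Qed.

Lemma start_known : wires_known 0 start.
Proof.
apply: attainable_weaken (attainable0 K n) => u x x' e i iN iu.
by rewrite /start iu e.
Qed.

Lemma start_bounded : wires_bounded start.
Proof.
move=> i x iN; have h : (2 ^ n + 2 ^ d <= 2 ^ m)%N.
  have h1 : (2 ^ n <= 2 ^ (n + d))%N by rewrite leq_exp2l // leq_addr.
  have h2 : (2 ^ d <= 2 ^ (n + d))%N by rewrite leq_exp2l // leq_addl.
  by rewrite [(2 ^ m)%N]expnS; lia.
apply: leq_trans h; rewrite /start (local_val x (hostK i)) /=.
case: ifP => _; last by rewrite ltn_add2l.
by apply: leq_trans (leq_addr _ _); apply: code_lt.
Qed.

Lemma det_upper_bound : det_rounds (@ED G K n) (T0 * (size (sort_net d) + 1 + d)).
Proof.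
have [Sk Sb] := wires_network (@sort_network d) start_known start_bounded.
set S := (fun i x => run _ _ i) in Sk Sb.
have Ngt0 : (0 < N)%N by rewrite expn_gt0.
have bool_lt (b : bool) : (b < 2 ^ m)%N.
  by apply: leq_ltn_trans (leq_b1 b) _; rewrite -{1}(expn0 2) ltn_exp2l.
have rot s i : (i < N)%N -> ((i + s) %% N < N)%N by rewrite ltn_mod.
have rotI s i j : (i < N)%N -> (j < N)%N -> ((i + s) %% N = (j + s) %% N)%N -> i = j.
  move=> iN jN /eqP; rewrite eqn_modDr !modn_small // => /eqP. by [].
pose E i x := (i.+1 < N)%N ==> (S i x != S i.+1 x).
(* The conjunction of the neighbour tests on [2 ^ s] cyclically consecutive wires from [i].
   Combining it with its rotation by [2 ^ s] doubles the range, so after [d] layers every wire holds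
   the answer. *)
pose A s i x : nat := all (fun j => E ((i + j) %% N)%N x) (iota 0 (2 ^ s)).
have A0 : wires_known (T0 * (size (sort_net d) + 1)) (A 0%N).
  have := wire_layer (fun i a b => ((i.+1 < N)%N ==> (a != b) : nat)) Sk Sb (rot 1%N) (rotI 1%N).
  rewrite addn1 mulnSr add0n; apply: attainable_weaken => u x x' h i iN iu.
  have AE y : A 0%N i y = ((i.+1 < N)%N ==> (S i y != S ((i + 1) %% N)%N y)).
    rewrite /A expn0 /= andbT addn0 (modn_small iN) /E addn1.
    by case: (ltnP i.+1 N) => //= iN1; rewrite modn_small.
  by rewrite !AE; apply: h.
have As s : wires_known (T0 * (size (sort_net d) + 1 + s)) (A s).
  elim: s => [|s IH]; first by rewrite addn0.
  have := wire_layer (fun i a b => ((a != 0) && (b != 0) : nat)%N) IH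
    (fun i x _ => bool_lt _) (rot (2 ^ s)%N) (rotI (2 ^ s)%N).
  rewrite [(_ + s.+1)%N]addnS mulnSr; apply: attainable_weaken => u x x' h i iN iu.
  have AS y : A s.+1 i y = ((A s i y != 0) && (A s ((i + 2 ^ s) %% N)%N y != 0))%N.
    rewrite /A expnS mul2n -addnn iotaD all_cat add0n.
    rewrite -[iota (2 ^ s) _]/(iota (2 ^ s) (2 ^ s)) -{2}[(2 ^ s)%N]addn0 iotaDl all_map.
    have -> : all (preim (addn (2 ^ s)) (fun j => E ((i + j) %% N)%N y)) (iota 0 (2 ^ s)) =
              all (fun j => E (((i + 2 ^ s) %% N + j) %% N)%N y) (iota 0 (2 ^ s)).
      by apply: eq_all => j /=; rewrite modnDml addnA.
    by case: (all _ _); case: (all _ _).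
  by rewrite !AS; apply: h.
apply: attainable_det_rounds (As d) _ => u x x' uK h.
have /(_ (index u (enum K))) := h.
have iu : (index u (enum K) < #|K|)%N by rewrite cardE index_mem mem_enum.
rewrite (leq_trans iu Kd) /host modn_small // nth_index ?mem_enum // => /(_ isT erefl).
have AED y i : (i < N)%N -> A d i y = ED y :> nat.
  move=> iN; congr nat_of_bool; apply/allP/idP => [h1|Ey j].
    apply/start_ED/sort_distinct => j jN.
    have /h1 : ((j + (N - i)) %% N)%N \in iota 0 N by rewrite mem_iota ltn_mod.
    rewrite modnDmr addnCA subnKC ?(ltnW iN) // modnDr modn_small ?(ltnW jN) //.
    by rewrite /E jN.
  move=> _; apply/implyP => jN.
  by have /start_ED/sort_distinct := Ey; apply.
rewrite !AED ?(leq_trans iu) //.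
by case: (ED x); case: (ED x').
Qed.

End Wires.

(** * Capping the duration; the deterministic upper bound *)

Lemma feasible_connect (R : realType) (G : sgraph) (K : {set G}) (n' : R) (tau : nat) u v :
  (0 < tau)%N -> 0 < n' -> mcf_feasible K n' tau -> u \in K -> v \in K ->
  connect (@edge G) u v.
Proof.
move=> tau0 n0 feas uK vK.
have [I [wt [pos [w0 wm wl]]]] := mcf_routing tau0 (ltW n0) feas.
have k0 : 0 < #|K|%:R :> R by rewrite ltr0n; apply/card_gt0P; exists u.
have := wm u v; rewrite uK vK mul1r => mass.
have [i /andP[/andP[/eqP iu /eqP iv] wi]] :
    exists i, ((pos i 0%N == u) && (pos i tau == v)) && (0 < wt i).
  apply: contrapT => /forallNP none.
  have : n' / #|K|%:R = 0.
    rewrite -mass big1 // => i iP; apply/eqP; rewrite eq_le w0 andbT leNgt.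
    by apply/negP => wi; apply: (none i); rewrite iP.
  by move/eqP; rewrite gt_eqF // divr_gt0.
rewrite -iu -iv; elim: {-2}tau (leqnn tau) => [|t IH] tt; first exact: connect0.
apply: connect_trans (IH (ltnW tt)) _.
have [->|ne] := eqVneq (pos i t) (pos i t.+1); first exact: connect0.
apply: connect1; apply: contraLR (ne) => nedge; rewrite negbK.
have := wl t _ _ tt ne; rewrite (negbTE nedge) mul0r /wload (bigD1 i) ?eqxx //= => le.
have : wt i <= 0 by apply: le_trans le; rewrite lerDl sumr_ge0.
by rewrite leNgt wi.
Qed.

(** A token that follows a simple path between the two sides, one step per round, is inside at time
    0 and outside at time [#|G|], so it crosses the cut. One edge against at most [#|K|] terminals
    gives the crude ratio. *)
Lemma connected_cut_condition (G : sgraph) (K : {set G}) :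
  (forall u v, u \in K -> v \in K -> connect (@edge G) u v) ->
  cut_condition K #|G| 1 #|K|.
Proof.
move=> con S mono; rewrite mul1n.
have [->//|] := posnP (minn #|K :&: S 0%N| #|K :\: S #|G| |).
rewrite leq_min => /andP[/card_gt0P[u] ] /[swap] /card_gt0P[v].
rewrite !inE => /andP[vS vK] /andP[uK uS].
apply: (@leq_trans #|K|); first by rewrite (leq_trans (geq_minl _ _)) // subset_leq_card // subsetIl.
rewrite leq_pmulr //; apply/card_gt0P.
have /connectP[p0 ep0 vE] := con u v uK vK.
case: (shortenP ep0) vE => p ep up _ vE.
have sp : (size p < #|G|)%N by have := max_card (mem (u :: p)); rewrite (card_uniqP up).
(* The default value lets the token wait at [v] once the path is exhausted. *)
pose w t := nth v (u :: p) t.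
have w0 : w 0%N \in S 0%N by [].
have wG : w #|G| \notin S #|G|.
  suff -> : w #|G| = v by [].
  by rewrite /w nth_default.
have [t tG /andP[wt wt1]] : exists2 t, (t < #|G|)%N & (w t \in S t) && (w t.+1 \notin S t.+1).
  elim: #|G| wG => [|k IH] wk; first by rewrite w0 in wk.
  have [wk'|wk'] := boolP (w k \in S k); first by exists k; rewrite ?wk'.
  by have [t tk h] := IH wk'; exists t; first exact: ltnW.
exists (Ordinal tG, (w t, w t.+1)); rewrite inE /= wt wt1 !andbT.
have tp : (t < size p)%N.
  rewrite ltnNge; apply/negP => pt; case/negP: wt1.
  have -> : w t.+1 = w t; last exact: (subsetP (mono t)).
  rewrite /w nth_default //; case: ltngtP pt => // [pt|<-] _.
    by rewrite nth_default.
  by rewrite vE nth_last.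
by rewrite /w /=; have /pathP -/(_ v t tp) := ep.
Qed.

Lemma cut_condition_pos (G : sgraph) (K : {set G}) (T q Q : nat) :
  (2 <= #|K|)%N -> (0 < q)%N -> cut_condition K T q Q -> (0 < T)%N.
Proof.
move=> k2 q0 cut; rewrite lt0n; apply/eqP => T0; subst T.
have /card_gt0P[u uK] : (0 < #|K|)%N by apply: ltnW.
have := cut (fun _ => [set u]) (fun _ => subxx _).
have -> : #|cut_edges 0 (fun _ => [set u])| = 0%N.
  by apply: eq_card0 => -[[i i0] e].
have -> : K :&: [set u] = [set u] by apply/setIidPr; rewrite sub1set.
have := cardsD1 u K; rewrite uK cards1 muln0 => e.
by rewrite leqn0 muln_eq0 minnE => /orP[/eqP|/eqP]; lia.
Qed.

Lemma mixing_steps_le l : (0 < l)%N -> (mixing_steps l <= 3456 * l ^ 2)%N.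
Proof. by rewrite /mixing_steps expnS expn1; nia. Qed.

Lemma expR_le_pow4 (R : realType) (m : nat) : expR m%:R <= 2 ^+ (2 * m) :> R.
Proof.
rewrite -[m%:R]mulr1 expRM_natl exprM lerXn2r ?nnegrE ?expR_ge0 ?exprn_ge0 //.
have h : expR (2^-1) <= 2 :> R.
  have := @expR_ge1Dx R (- 2^-1); rewrite expRN => h.
  rewrite -[leRHS]invrK -[leLHS]invrK lef_pV2 ?posrE ?invr_gt0 ?expR_gt0 //.
  lra.
have e : expR 1 = expR 2^-1 * expR 2^-1 :> R by rewrite -expRD; congr expR; field.
by rewrite e expr2 ler_pM ?expR_ge0.
Qed.

(** Input length [n] and flow value [nn] are separate because they differ after hashing: there
    [nn = 1] and [n] is the logarithmic hash length, while the deterministic case has [nn = n] and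
    [a = 1]. *)
Lemma det_upper (R : realType) (G : sgraph) (K : {set G}) (n nn a l tau : nat) :
  (0 < tau)%N -> (0 < nn)%N -> (0 < l)%N -> (n <= a * nn)%N ->
  (#|G| <= 2 ^ l)%N -> (nn <= 2 ^ l)%N -> mcf_feasible K (nn%:R : R) tau ->
  exists t, det_rounds (@ED G K n) t /\ (t <= (29 * l + 4 * a) * (6 * l ^ 2) * tau)%N.
Proof.
move=> tau0 nn0 l0 na Gl nl feas.
have [K0|k0] := posnP #|K|.
  exists 0%N; split=> //; exists (Protocol (fun _ _ _ _ => false) (fun _ _ _ => false)) => x.
  apply/forallP => u; apply/implyP => uK.
  by have := card0_eq K0 u; rewrite uK.
have /card_gt0P[u0 u0K] := k0.
have kG : (#|K| <= #|G|)%N by apply: max_card.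
have kl := leq_trans kG Gl.
have nR : 0 < nn%:R :> R by rewrite ltr0n.
have con := feasible_connect tau0 nR feas.
pose tau1 := (mixing_steps l * #|G| * (2 * nn * #|K|))%N.
have feas1 : mcf_feasible K (nn%:R : R) tau1.
  apply: (cut_mcf k0 (ltn0Sn 0) _ (connected_cut_condition con) Gl) => //.
  - exact: leq_trans k0 kG.
  - by rewrite !muln_gt0 nn0.
  - by rewrite !natrM mul1r.
(* The congestion [L] contains the logarithm of the duration, which must be linear in [l]; hence the
   shorter of the given flow and the one from connectivity. *)
pose ts := minn tau tau1.
have tau10 : (0 < tau1)%N.
  by rewrite /tau1 /mixing_steps !muln_gt0 !addn_gt0 nn0 k0 (leq_trans k0 kG) !orbT.
have [ts0 feass] : (0 < ts)%N /\ mcf_feasible K (nn%:R : R) ts.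
  by rewrite /ts; case: (leqP tau tau1).
have l2 : (l < 2 ^ l)%N by apply: ltn_expl.
have ts1 : (ts <= 2 ^ (13 + 5 * l))%N.
  apply: leq_trans (geq_minr _ _) _; rewrite /tau1.
  have h : (mixing_steps l <= 2 ^ 12 * (2 ^ l * 2 ^ l))%N.
    apply: leq_trans (mixing_steps_le l0) _; rewrite -mulnn.
    by apply: leq_mul => //; apply: leq_mul; apply: ltnW.
  have -> : (2 ^ (13 + 5 * l) = 2 ^ 12 * (2 ^ l * 2 ^ l) * 2 ^ l * (2 * 2 ^ l * 2 ^ l))%N.
    rewrite -!expnD -expnS -!expnD; congr expn; lia.
  by apply: leq_mul; first apply: leq_mul => //; apply: leq_mul => //; apply: leq_mul.
pose d := up_log 2 #|K|.
have Kd : (#|K| <= 2 ^ d)%N by apply: up_logP.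
have dl : (d <= l)%N by rewrite /d up_log_min.
have dK : (2 ^ d <= 2 * #|K|)%N.
  have [k1|k1] := leqP #|K| 1.
    have -> : d = 0%N by rewrite /d (_ : #|K| = 1%N) ?up_log1 //; apply/eqP; rewrite eqn_leq k1.
    by lia.
  have /andP[h _] := up_log_bounds (isT : (1 < 2)%N) k1.
  have : (0 < d)%N by rewrite lt0n; apply/eqP => d0; move: Kd; rewrite d0 leqNgt k1.
  by move: h; rewrite -/d; case: (d) => // d' /= h _; rewrite expnS leq_mul2l ltnW.
(* [ts + ts] contributes [14 + 5 * l], the pairs of nodes [2 * l], and the exponential, bounded by a
   power of 4, another [4 * (a + l + 1)]. *)
pose L := (11 * l + 4 * a + 18)%N.
have Lbig : (ts + ts)%:R * #|G|%:R ^+ 2 * expR ((2 * (n + d).+1)%:R / nn%:R) <= 2 ^+ L :> R.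
  have e1 : (2 * (n + d).+1)%:R / nn%:R <= (2 * (a + l + 1))%:R :> R.
    rewrite ler_pdivrMr // -natrM ler_nat -mulnA leq_mul2l /=.
    have : (l <= l * nn)%N by rewrite leq_pmulr.
    by rewrite !mulnDl mul1n; lia.
  have e2 : expR ((2 * (n + d).+1)%:R / nn%:R) <= 2 ^+ (2 * (2 * (a + l + 1))) :> R.
    by apply: le_trans (expR_le_pow4 _ _); rewrite ler_expR.
  have e3 : (ts + ts)%:R * #|G|%:R ^+ 2 <= 2 ^+ (14 + 5 * l + 2 * l) :> R.
    rewrite -!natrX -natrM ler_nat expnD; apply: leq_mul.
      by rewrite addnn -mul2n expnS leq_mul2l.
    by rewrite mulnC expnM leq_exp2r.
  apply: (@le_trans _ _ (2 ^+ (14 + 5 * l + 2 * l) * 2 ^+ (2 * (2 * (a + l + 1))))).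
    by apply: ler_pM; rewrite ?mulr_ge0 ?exprn_ge0 ?expR_ge0.
  by rewrite -exprD ler_eXn2l ?ltr1n // /L; lia.
exists (L * (ts + ts) * (size (sort_net d) + 1 + d))%N; split.
  exact: (det_upper_bound ts0 nR feass u0K Kd dK Lbig).
have h1 : (size (sort_net d) + 1 + d <= 3 * l ^ 2)%N.
  have := size_sort_net d; have : (d * d <= l * l)%N by apply: leq_mul.
  by rewrite expnS expn1; nia.
have h2 : (L <= 29 * l + 4 * a)%N by rewrite /L; lia.
have h3 : (ts + ts <= 2 * tau)%N by have := geq_minl tau tau1; rewrite -/ts; lia.
apply: leq_trans (leq_mul (leq_mul h2 h3) h1) _.
by rewrite eq_leq //; ring.
Qed.

(** * Public-coin hashing *)

Section Hashing.
Variables (R : realType) (G : sgraph) (K : {set G}) (n m T : nat).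
Local Notation Omega := {ffun n.-tuple bool -> m.-tuple bool}.

Definition hashed_protocol (P : protocol G m) (w : Omega) : protocol G n :=
  Protocol (fun u v a h => msg P u v (omap w a) h) (fun u a h => out P u (omap w a) h).

Definition hashed_input (w : Omega) (x : input K n) : input K m := [ffun u => w (x u)].

Lemma hashed_correct (P : protocol G m) (w : Omega) (x : input K n) :
  correct (@ED G K m) T P (hashed_input w x) -> ED (hashed_input w x) = ED x ->
  correct (@ED G K n) T (hashed_protocol P w) x.
Proof.
have li u : local_input (hashed_input w x) u = omap w (local_input x u).
  by rewrite /local_input; case: insub => //= v; rewrite ffunE.
have hist t u : history P (hashed_input w x) t u = history (hashed_protocol P w) x t u.
  elim: t u => //= t IH u; rewrite IH; congr rcons; apply/ffunP => v; rewrite !ffunE.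
  by rewrite li IH.
move=> /forallP ok e; apply/forallP => u; have := ok u.
by rewrite li hist e.
Qed.

Lemma collision_prob (a b : n.-tuple bool) : a != b ->
  \sum_(w : Omega) (w a == w b)%:R = #|{: Omega}|%:R / 2 ^+ m :> R.
Proof.
move=> ab; pose F (c : m.-tuple bool) (j : n.-tuple bool) (y : m.-tuple bool) : R :=
  if (j == a) || (j == b) then (y == c)%:R else 1.
(* Summing over the common value [c] turns the collision into a product over the arguments, so that
   the sum over all functions factors. *)
have e (w : Omega) : (w a == w b)%:R = \sum_c \prod_j F c j (w j).
  rewrite (bigD1 (w a)) //= [X in _ + X]big1 ?addr0.
    rewrite (bigD1 a) //= (bigD1 b) 1?eq_sym //= big1 /F ?eqxx ?orbT ?mul1r ?mulr1.
      by rewrite eq_sym.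
    by move=> j /andP[/negbTE -> /negbTE ->].
  by move=> c /negbTE ca; rewrite (bigD1 a) //= /F eqxx /= [w a == c]eq_sym ca mul0r.
under eq_bigr => w _ do rewrite e.
rewrite exchange_big /=.
have s c : \sum_(w : Omega) \prod_j F c j (w j) = #|{: Omega}|%:R / (2 ^+ m) ^+ 2.
  rewrite -(bigA_distr_bigA (F c)).
  have tc : #|{: m.-tuple bool}|%:R = 2 ^+ m :> R by rewrite card_tuple card_bool natrX.
  have t0 : 2 ^+ m != 0 :> R by rewrite expf_neq0.
  have -> : #|{: Omega}|%:R = \prod_(j : n.-tuple bool) (2 ^+ m : R).
    by rewrite prodr_const card_ffun natrX tc.
  have s1 : \sum_(y : m.-tuple bool) (y == c)%:R = 1 :> R.
    by rewrite (bigD1 c) //= eqxx big1 ?addr0 // => y /negbTE ->.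
  rewrite [LHS](bigD1 a) //= [X in _ * X](bigD1 b) 1?eq_sym //=.
  rewrite [in RHS](bigD1 a) //= [in RHS](bigD1 b) 1?eq_sym //=.
  rewrite /F !eqxx orbT /= !s1 !mul1r.
  rewrite mulrA -expr2 mulrAC divff ?expf_neq0 // mul1r.
  apply: eq_bigr => j /andP[/negbTE -> /negbTE ->] /=.
  by rewrite sumr_const -[LHS]mulr_natl mulr1 tc.
under eq_bigr => c _ do rewrite s.
rewrite sumr_const -[LHS]mulr_natl card_tuple card_bool natrX.
by field; rewrite expf_neq0.
Qed.

(** The hashed protocol errs only if two different inputs collide: a union bound over at most
    [#|K| ^ 2] ordered pairs, each of probability [1 / 2 ^ m]. *)
Lemma hashing (eps : R) : #|K|%:R ^+ 2 <= eps * 2 ^+ m ->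
  det_rounds (@ED G K m) T -> rand_rounds eps (@ED G K n) T.
Proof.
move=> km [P hP].
pose N : R := #|{: Omega}|%:R.
have N0 : 0 < N by rewrite ltr0n; apply/card_gt0P; exists [ffun=> [tuple of nseq m false]].
have t0 : 0 < 2 ^+ m :> R by rewrite exprn_gt0.
exists Omega, (fun _ => N^-1), (hashed_protocol P); split.
- by move=> _; rewrite invr_ge0 ltW.
- by rewrite sumr_const -[LHS]mulr_natl divff // gt_eqF.
move=> x; pose U := {u : G | u \in K}.
apply: (@le_trans _ _ (\sum_(u : U) \sum_(v : U | x u != x v) \sum_(w : Omega) N^-1 * (w (x u) == w (x v))%:R)).
  rewrite big_mkcond /= (eq_bigr (fun u : U => \sum_(w : Omega) \sum_(v : U | x u != x v) N^-1 * (w (x u) == w (x v))%:R)).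
    rewrite exchange_big /=; apply: ler_sum => w _.
    have nonneg u : 0 <= \sum_(v : U | x u != x v) N^-1 * (w (x u) == w (x v))%:R :> R.
      by apply: sumr_ge0 => v _; rewrite mulr_ge0 ?invr_ge0 ?(ltW N0).
    case: ifP => [bad|_]; last exact: sumr_ge0.
    have [u [v [xuv wuv]]] : exists u v, x u != x v /\ w (x u) == w (x v).
      apply: contrapT => none; move: bad; apply/negP; rewrite negbK.
      apply: hashed_correct; first exact: hP.
      apply/ED_P/ED_P => [inj u v e|inj u v].
        by apply: inj; rewrite !ffunE e.
      rewrite !ffunE => e; apply: inj; apply/eqP/negPn/negP => ne; apply: none.
      by exists u, v; rewrite e.
    rewrite (bigD1 u) //= (bigD1 v) //= wuv mulr1 -addrA lerDl addr_ge0 //.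
      by apply: sumr_ge0 => v' _; rewrite mulr_ge0 ?invr_ge0 ?(ltW N0).
    exact: sumr_ge0.
  by move=> u _; rewrite exchange_big.
apply: (@le_trans _ _ (\sum_(u : U) \sum_(v : U) (2 ^+ m)^-1)).
  apply: ler_sum => u _; rewrite big_mkcond; apply: ler_sum => v _.
  case: ifP => xuv; last by rewrite invr_ge0 ltW.
  by rewrite -mulr_sumr collision_prob // -/N mulrA mulVf ?gt_eqF // mul1r.
rewrite !sumr_const -mulrnA -[leLHS]mulr_natl card_sig ler_pdivrMr // natrM -expr2.
by [].
Qed.

End Hashing.

(** * Logarithmic bookkeeping *)

Definition log_size (G : sgraph) (n : nat) : nat := up_log 2 (#|G| + n + 2).

Lemma log_sizeP G n :
  [/\ (0 < log_size G n)%N, (#|G| <= 2 ^ log_size G n)%N & (n <= 2 ^ log_size G n)%N].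
Proof.
have h : (#|G| + n + 2 <= 2 ^ log_size G n)%N by apply: up_logP.
split; try lia.
by rewrite lt0n; apply/eqP => z; move: h; rewrite z; lia.
Qed.

Lemma log_size_ln (R : realType) G n :
  (log_size G n)%:R <= 4 * ln (#|G| + n + 2)%:R :> R.
Proof.
set X := (#|G| + n + 2)%N; set l := log_size G n.
have X2 : (1 < X)%N by rewrite /X addn2.
have /andP[h _] := up_log_bounds (isT : (1 < 2)%N) X2.
have [l0 _ _] := log_sizeP G n.
have XR : 2 <= X%:R :> R by rewrite (ler_nat R 2).
have ln2 : 2^-1 <= ln 2 :> R.
  have := @le_ln1Dx R (- 2^-1) _; rewrite (_ : 1 + - 2^-1 = 2^-1); last by field.
  by rewrite lnV ?posrE // => h'; have := h' ltac:(lra); lra.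
have ln2X : ln 2 <= ln X%:R :> R by rewrite ler_ln ?posrE ?ltr0n //; lia.
have : (l.-1)%:R * ln 2 <= ln X%:R :> R.
  rewrite mulr_natl -lnXn // ler_ln ?posrE ?exprn_gt0 ?ltr0n //; last by lia.
  by rewrite -natrX ler_nat ltnW.
have : (l%:R = (l.-1)%:R + 1 :> R) by rewrite natr1 prednK.
have := ler0n R l.-1; nra.
Qed.

Lemma minE_attained (R : realType) (F : nat -> Prop) :
  minE R F = +oo%E \/ exists t, F t /\ minE R F = (t%:R)%:E.
Proof.
have [[t0 Ft0]|none] := pselect (exists t, F t); last first.
  left; apply/eqP; rewrite eq_le leey /=; apply: le_ereal_inf_tmp => _ [t Ft <-].
  by case: none; exists t.
right; have ex : exists t, `[< F t >] by exists t0; apply/asboolP.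
case: (ex_minnP ex) => t /asboolP {}Ft tmin; exists t; split=> //.
apply/eqP; rewrite eq_le; apply/andP; split.
  by apply: ereal_inf_lbound; exists t.
by apply: le_ereal_inf_tmp => _ [s Fs <-]; rewrite lee_fin ler_nat tmin //; apply/asboolP.
Qed.

Lemma soft_O_rounds (R : realType) (D : forall G : sgraph, {set G} -> nat -> Prop)
    (F F' : forall G : sgraph, {set G} -> nat -> nat -> Prop) (A c : nat) :
  (forall (G : sgraph) (K : {set G}) n t, D G K n -> F' G K n t ->
     exists t', F G K n t' /\ (t' <= A * log_size G n ^ c * t)%N) ->
  soft_O D (fun G K n => minE R (F G K n)) (fun G K n => minE R (F' G K n)).
Proof.
(* The factor [4 ^ c] converts [log_size] to [ln]; the successor keeps the constant positive, as an
   infinite right-hand side requires. *)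
move=> h; exists ((A * 4 ^ c)%N.+1%:R), c; split; first by rewrite ltr0n.
move=> G K n DG.
have ln0 : 0 < ln (#|G| + n + 2)%:R :> R by apply: ln_gt0; rewrite ltr1n addn2.
have C0 : 0 < ((A * 4 ^ c)%N.+1%:R * ln (#|G| + n + 2)%:R ^+ c) :> R.
  by rewrite mulr_gt0 ?ltr0n // exprn_gt0.
have [->|[t [Ft ->]]] := minE_attained R (F' G K n).
  by rewrite gt0_muley ?leey // lte_fin.
have [t' [Ft' le]] := h G K n t DG Ft.
apply: (@le_trans _ _ (t'%:R)%:E); first by apply: ereal_inf_lbound; exists t'.
rewrite -EFinM lee_fin; apply: (@le_trans _ _ (A * log_size G n ^ c * t)%:R).
  by rewrite ler_nat.
rewrite natrM ler_wpM2r // natrM natrX.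
apply: (@le_trans _ _ (A%:R * (4 * ln (#|G| + n + 2)%:R) ^+ c)).
  by rewrite ler_wpM2l // lerXn2r ?nnegrE ?mulr_ge0 ?(ltW ln0) // log_size_ln.
rewrite exprMn mulrA ler_wpM2r ?exprn_ge0 ?(ltW ln0) //.
by rewrite -natrX -natrM ler_nat.
Qed.

Lemma det_rounds_trivial (G : sgraph) (K : {set G}) (n : nat) (f : input K n -> bool) :
  (forall x y, f x = f y) -> det_rounds f 0.
Proof.
move=> fc; pose x0 : input K n := [ffun _ => [tuple of nseq n false]].
exists (Protocol (fun _ _ _ _ => false) (fun _ _ _ => f x0)) => x.
by apply/forallP => u; rewrite /= (fc x x0) eqxx implybT.
Qed.

Lemma rand_upper (R : realType) (eps : R) : 0 < eps < 2^-1 ->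
  exists A, forall (G : sgraph) (K : {set G}) n t, True ->
    (1 <= t)%N /\ mcf_feasible K (1 : R) t ->
    exists t', rand_rounds eps (@ED G K n) t' /\ (t' <= A * log_size G n ^ 3 * t)%N.
Proof.
case/andP=> e0 _.
(* [2 ^ e] is at least [1 / eps], so hashes of [2 * l + e] bits satisfy the hypothesis of
   [hashing]. *)
pose e := (Num.trunc (eps^-1)).+1.
have ee : 1 <= eps * 2 ^+ e.
  rewrite -ler_pdivrMl // mulr1; have := truncnS_gt (eps^-1).
  move=> /ltW/le_trans; apply; rewrite -natrX ler_nat; exact/ltnW/ltn_expl.
exists (6 * (37 + 4 * e))%N => G K n t _ [t1 feas].
have [l0 Gl nl] := log_sizeP G n; set l := log_size G n in l0 Gl nl *.
have [||t' [det le]] := @det_upper R G K (2 * l + e) 1 (2 * l + e) l t t1 isT l0 _ Gl _ feas.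
- by rewrite muln1.
- by rewrite expn_gt0.
exists t'; split; last first.
  apply: leq_trans le _; rewrite leq_mul2r; apply/orP; right.
  rewrite !expnS expn0 !muln1; nia.
apply: hashing det; rewrite exprD mulrCA.
have kl : #|K|%:R <= 2 ^+ l :> R.
  by rewrite -natrX ler_nat (leq_trans _ Gl) // max_card.
apply: (@le_trans _ _ (2 ^+ (2 * l))).
  by rewrite mulnC exprM lerXn2r ?nnegrE ?exprn_ge0.
by rewrite ler_peMr ?exprn_ge0.
Qed.

Lemma det_upper_log (R : realType) (G : sgraph) (K : {set G}) n t : True ->
  (1 <= t)%N /\ mcf_feasible K (n%:R : R) t ->
  exists t', det_rounds (@ED G K n) t' /\ (t' <= 198 * log_size G n ^ 3 * t)%N.
Proof.
move=> _ [t1 feas].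
have [l0 Gl nl] := log_sizeP G n; set l := log_size G n in l0 Gl nl *.
have [n0|n0] := posnP n.
  exists 0%N; split=> //; apply: det_rounds_trivial => x y; congr ED.
  by apply/ffunP => u; move: (x u) (y u); rewrite n0 => a b; rewrite (tuple0 a) (tuple0 b).
have [|t' [det le]] := @det_upper R G K n n 1 l t t1 n0 l0 _ Gl nl feas.
  by rewrite mul1n.
exists t'; split=> //; apply: leq_trans le _; rewrite leq_mul2r; apply/orP; right.
rewrite !expnS expn0 !muln1; nia.
Qed.

Lemma rand_lower (R : realType) (eps delta : R) : 0 < eps < 2^-1 -> 0 < delta ->
  exists A, forall (G : sgraph) (K : {set G}) n t, slack delta K n ->
    rand_rounds eps (@ED G K n) t ->
    exists t', ((1 <= t')%N /\ mcf_feasible K (1 : R) t') /\ (t' <= A * log_size G n ^ 2 * t)%N.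
Proof.
move=> eps12 d0; have /andP[e0 e1] := eps12.
pose c := (1 - 2 * eps) ^+ 2 * Num.min 1 delta.
have c0 : 0 < c by rewrite mulr_gt0 ?exprn_gt0 ?lt_min ?ltr01 //; lra.
pose Q := (Num.trunc (192 / c)).+1.
have Qbig : 192 <= Q%:R * (1 - 2 * eps) ^+ 2 * Num.min 1 delta.
  by rewrite -mulrA -/c -ler_pdivrMr // ltW // truncnS_gt.
exists (3456 * 4 * Q)%N => G K n t sl rr.
have [l0 Gl nl] := log_sizeP G n; set l := log_size G n in l0 Gl nl *.
have cut := rand_cut_condition eps12 d0 sl Qbig rr.
have [k2 _] := sl; have k0 := ltnW k2.
have T0 := cut_condition_pos k2 (ltn0Sn 0) cut.
exists (mixing_steps l * (t + t) * (2 * Q))%N; split; last first.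
  have := mixing_steps_le l0; move: (mixing_steps l) (l ^ 2)%N => M l2 hM.
  have : (M * (t + t) * (2 * Q) <= 3456 * l2 * (t + t) * (2 * Q))%N.
    by rewrite !leq_mul2r hM !orbT.
  by move/leq_trans; apply; rewrite leq_eqVlt; apply/orP; left; apply/eqP; ring.
split.
  by rewrite /mixing_steps !muln_gt0 T0 !addn_gt0 !orbT.
apply: (cut_mcf k0 _ T0 cut Gl) => //.
by rewrite mul1r natrM mulr1.
Qed.

Lemma det_lower (R : realType) (G : sgraph) (K : {set G}) n t : nontrivial K n ->
  det_rounds (@ED G K n) t ->
  exists t', ((1 <= t')%N /\ mcf_feasible K (n%:R : R) t') /\
    (t' <= (3456 * 8) * log_size G n ^ 3 * t)%N.
Proof.
move=> nt dr; have /andP[k2 kn] := nt; have k0 := ltnW k2.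
have [l0 Gl nl] := log_sizeP G n; set l := log_size G n in l0 Gl nl *.
have n0 : (0 < n)%N by case: (n) kn => // kn; have := leq_trans k2 kn.
have cut := det_cut_condition nt Gl dr.
have T0 := cut_condition_pos k2 n0 cut.
exists (mixing_steps l * (t + t) * (2 * l.+1))%N; split; last first.
  have := mixing_steps_le l0; rewrite [(l ^ 3)%N]expnS; move: (mixing_steps l) (l ^ 2)%N => M l2 hM.
  have : (M * (t + t) * (2 * l.+1) <= 3456 * l2 * (t + t) * (2 * (2 * l)))%N.
    by apply: leq_mul; [rewrite leq_mul2r hM orbT | lia].
  by move/leq_trans; apply; rewrite leq_eqVlt; apply/orP; left; apply/eqP; ring.
split.
  by rewrite /mixing_steps !muln_gt0 T0 !addn_gt0 !orbT.
apply: (cut_mcf k0 n0 T0 cut Gl) => //.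
by rewrite natrM; lra.
Qed.

Theorem theorem1p2 (R : realType) (eps delta : R)
    (heps : 0 < eps < 2^-1) (hdelta : 0 < delta) :
  soft_Theta (slack delta)
    (fun G K n => Reps eps (@ED G K n))
    (fun G K n => tau_MCF K (1 : R))
  /\
  soft_Theta nontrivial
    (fun G K n => R0 R (@ED G K n))
    (fun G K n => tau_MCF K (n%:R : R)).
Proof.
pose mcf1 (G : sgraph) (K : {set G}) (_ t : nat) := (1 <= t)%N /\ mcf_feasible K (1 : R) t.
pose mcfn (G : sgraph) (K : {set G}) (n t : nat) := (1 <= t)%N /\ mcf_feasible K (n%:R : R) t.
pose rand (G : sgraph) (K : {set G}) n := rand_rounds eps (@ED G K n).
pose det (G : sgraph) (K : {set G}) n := det_rounds (@ED G K n).
have [A up] := rand_upper heps; have [B low] := rand_lower heps hdelta.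
split; split.
- exact: (soft_O_rounds R (F := rand) (F' := mcf1) up).
- exact: (soft_O_rounds R (F := mcf1) (F' := rand) low).
- exact: (soft_O_rounds R (F := det) (F' := mcfn) (@det_upper_log R)).
- exact: (soft_O_rounds R (F := mcfn) (F' := det) (@det_lower R)).
Qed.
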